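(* Let $\beta\in\mathbb{R}$, $a_1=a_2>0$, $\mu_1=\mu_2>0$, and let $\mathcal{F}$ be a $\sigma$-homotopy stable family of compact subsets of $\mathcal{P}_\beta$, with closed boundary $B\subset\mathcal{P}_\beta$. Let $$c_{\mathcal{F},\beta}:=\inf_{A\in\mathcal{F}}\max_{(u,v)\in A}J_\beta(u,v).$$ Suppose that $B$ is contained in a connected component of $\mathcal{P}_\beta$, and that $$\max\{\sup J_\beta(B),0\}<c_{\mathcal{F},\beta}<+\infty .$$ Then there exists a sequence $\{(u_n,v_n)\}$ with the following properties: (i) $(u_n,v_n)\in\mathcal{P}_\beta$ for every $n$; (ii) $J_\beta(u_n,v_n)\to c_{\mathcal{F},\beta}$ as $n\to\infty$; (iii) $\|\nabla(J_\beta|_{\mathcal{S}})(u_n,v_n)\|\to0$ as $n\to\infty$, i.e. $\{(u_n,v_n)\}$ is a Palais-Smale sequence for $J_\beta$ on $\mathcal{S}$. If moreover there is a minimizing sequence $\{A_n\}\subset\mathcal{F}$ for $c_{\mathcal{F},\beta}$ (i.e. $\max_{A_n}J_\beta\to c_{\mathcal{F},\beta}$) such that $(u,v)\in A_n$ implies $u,v\ge0$ a.e., then the sequence $\{(u_n,v_n)\}$ can be found satisfying the additional condition (iv) $u_n^-,v_n^-\to0$ a.e. in $\mathbb{R}^3$ as $n\to\infty$.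
   Context: $H^1_{\mathrm{rad}}(\mathbb{R}^3)$ is the space of radial functions in $H^1(\mathbb{R}^3)$, $S_a=\{w\in H^1_{\mathrm{rad}}(\mathbb{R}^3):\int_{\mathbb{R}^3}w^2=a^2\}$, $\mathcal{S}=S_{a_1}\times S_{a_2}$, $$J_\beta(u,v)=\frac12\int_{\mathbb{R}^3}(|\nabla u|^2+|\nabla v|^2)-\frac14\int_{\mathbb{R}^3}(\mu_1u^4+2\beta u^2v^2+\mu_2v^4),$$ $$\mathcal{P}_\beta=\Big\{(u,v)\in\mathcal{S}:\int_{\mathbb{R}^3}(|\nabla u|^2+|\nabla v|^2)=\tfrac34\int_{\mathbb{R}^3}(\mu_1u^4+2\beta u^2v^2+\mu_2v^4)\Big\}.$$ $\|\cdot\|$ is the $H^1(\mathbb{R}^3,\mathbb{R}^2)$ norm; $w^-$ denotes the negative part of $w$. All sets carry the $H^1$ topology. Let $\sigma(u,v)=(v,u)$. A set $A$ is $\sigma$-invariant if $\sigma(A)=A$; a homotopy $\eta:[0,1]\times X\to X$ is $\sigma$-equivariant if $\eta(t,\sigma(u,v))=\sigma(\eta(t,(u,v)))$ for all $t$ and $(u,v)$. Let $X\subset H^1_{\mathrm{rad}}(\mathbb{R}^3,\mathbb{R}^2)$ and let $B$ be a closed $\sigma$-invariant subset of $X$. A class $\mathcal{F}$ of compact subsets of $X$ is a $\sigma$-homotopy stable family with closed boundary $B$ if: (a) every set in $\mathcal{F}$ contains $B$; (b) for any $A\in\mathcal{F}$ and any $\sigma$-equivariant homotopy $\eta\in C([0,1]\times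 X,X)$ satisfying $\eta(t,x)=x$ for all $(t,x)\in(\{0\}\times X)\cup([0,1]\times B)$, one has $\eta(\{1\}\times A)\in\mathcal{F}$; (c) every set in $\mathcal{F}$ is $\sigma$-invariant. The case $B=\emptyset$ is admissible, with the convention $\sup(\emptyset)=-\infty$. *)

(* Defs.v *)
From HB Require Import structures.
From mathcomp Require Import all_boot all_order all_algebra.
From mathcomp Require Import all_classical all_reals all_analysis.
From mathcomp Require Import measurable_realfun.
From mathcomp Require Import ring lra.
Set Implicit Arguments.
Unset Strict Implicit.
Unset Printing Implicit Defensive.
Import Order.TTheory GRing.Theory Num.Theory.
Import numFieldNormedType.Exports.
Local Open Scope classical_set_scope.
Local Open Scope ring_scope.

(* The library's [LspaceType2 mu] (square-integrable functions modulo equality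
   almost everywhere) comes without algebraic structure: it is added here. *)
Section L2_space.
Context d (T : measurableType d) (R : realType).
Variable mu : {measure set T -> \bar R}.

Definition L2 : Type := LspaceType2 mu.
HB.instance Definition _ := gen_eqMixin L2.
HB.instance Definition _ := gen_choiceMixin L2.

Definition L2_fun (u : L2) : T -> R := (u : LspaceType2 mu).
Coercion L2_fun : L2 >-> Funclass.

Lemma Lfun2P (f : T -> R) : f \in Lfun mu 2%:E <->
  measurable_fun setT f /\ mu.-integrable setT (fun x => (f x ^+ 2)%:E).
Proof.
split=> [f2|[mf f2]].
  split; last exact: Lfun2_integrable_sqr.
  by move: f2; rewrite inE => /andP[/set_mem].
rewrite inE; apply/andP; split; first exact/mem_set.
apply/mem_set => /=; rewrite /finite_norm unlock/=; apply: poweR_lty.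
under eq_integral => x _ do rewrite powR_mulrn// -normrX ger0_norm ?sqr_ge0//.
case/integrableP : f2 => _; apply: le_lt_trans.
rewrite le_eqVlt; apply/orP; left; apply/eqP.
by apply: eq_integral => x _; rewrite /= ger0_norm ?sqr_ge0.
Qed.

Lemma Lfun2_lin (a : R) (f g : T -> R) : f \in Lfun mu 2%:E ->
  g \in Lfun mu 2%:E -> (fun x => a * f x + g x) \in Lfun mu 2%:E.
Proof.
move=> f2 g2.
have [_ h] := @Lfun_submod_closed _ _ _ mu _ (lee1n 2).
exact: (h a f g f2 g2).
Qed.

Lemma L2_Lfun (u : L2) : (u : T -> R) \in Lfun mu 2%:E.
Proof.
case: u => s [[/= h]]; rewrite inE; apply/andP; split; apply/mem_set => //=.
exact: (@measurable_funPT _ _ _ _ (repr s)).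
Qed.

Lemma L2_ext (u v : L2) : {ae mu, forall x, u x = v x} -> u = v.
Proof.
case: u v => [s [[/= hs]]] [t [[/= ht]]] uv.
suff st : s = t by subst t; do 3 f_equal; exact: Prop_irrelevance.
have : (s == t %[mod {mfun_ mu, T >-> measurableTypeR R}])%qT.
  by apply/ae_eqP; apply: filterS uv => x /= h _.
by move/eqP; rewrite !reprK.
Qed.

Section mk.
Variables (f : T -> R) (f2 : f \in Lfun mu 2%:E).

Let mf : measurable_fun setT (f : T -> measurableTypeR R).
Proof. by have /Lfun2P[] := f2. Qed.

Let fm : {mfun T >-> measurableTypeR R} :=
  HB.pack f (@isMeasurableFun.Build _ _ T (measurableTypeR R) f mf).

Let c : {mfun_ mu, T >-> measurableTypeR R} := \pi%qT fm.

Let c_ae : {ae mu, forall x, c x = f x}.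
Proof.
have : (repr c == fm %[mod {mfun_ mu, T >-> measurableTypeR R}])%qT.
  by rewrite reprK.
by rewrite eqmodE => /asboolP; apply: filterS => x /(_ I).
Qed.

Let c_fin : finite_norm mu 2 c.
Proof.
have /Lfun2P[_ fi] := f2.
have : (c : T -> R) \in Lfun mu 2%:E.
  have : measurable_fun setT (c : T -> R).
    exact: (@measurable_funPT _ _ _ _ (repr c)).
  move: c_ae; move: (c : T -> R) => g gf mg; apply/Lfun2P.
  have mg2 : measurable_fun setT (fun x => (g x ^+ 2)%:E).
    by apply/measurable_EFinP; exact: measurable_funX.
  split => //; apply/integrableP; split => //.
  case/integrableP : fi => mf2; apply: le_lt_trans.
  rewrite le_eqVlt (@ge0_ae_eq_integral _ _ _ _ _
    (fun x => `|(g x ^+ 2)%:E|%E) (fun x => `|(f x ^+ 2)%:E|%E)) ?eqxx//.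
  - exact: measurableT_comp.
  - exact: measurableT_comp.
  - by apply: filterS gf => x gx _ /=; rewrite gx.
by rewrite inE => /andP[_ /set_mem].
Qed.

Definition L2_mk : L2 := LebesgueSpace.Pack
  (LebesgueSpace.Class (@isFinLebesgue.Axioms_ d T R mu _ (lee1n 2) c c_fin)).

Lemma L2_mkE : {ae mu, forall x, L2_mk x = f x}.
Proof. exact: c_ae. Qed.

End mk.

Lemma Lfun2_0 : (fun=> 0) \in Lfun mu 2%:E.
Proof. by have [] := @Lfun_submod_closed _ _ _ mu _ (lee1n 2). Qed.

Definition L2_0 : L2 := L2_mk Lfun2_0.
Definition L2_lin (a : R) (u v : L2) : L2 :=
  L2_mk (Lfun2_lin a (L2_Lfun u) (L2_Lfun v)).

Let L2_linE a (u v : L2) : {ae mu, forall x, L2_lin a u v x = a * u x + v x}.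
Proof. exact: L2_mkE. Qed.

Let L2_0E : {ae mu, forall x, L2_0 x = 0}.
Proof. exact: L2_mkE. Qed.

Let L2_addA : associative (L2_lin 1).
Proof.
move=> u v w; apply: L2_ext.
apply: filter_app (L2_linE 1 u v);
  apply: filter_app (L2_linE 1 (L2_lin 1 u v) w);
  apply: filter_app (L2_linE 1 v w);
  apply: filter_app (L2_linE 1 u (L2_lin 1 v w));
  apply: filterE => x -> -> -> ->.
by rewrite !mul1r addrA.
Qed.

Let L2_addC : commutative (L2_lin 1).
Proof.
move=> u v; apply: L2_ext.
apply: filter_app (L2_linE 1 v u); apply: filter_app (L2_linE 1 u v);
  apply: filterE => x -> ->.
by rewrite !mul1r addrC.
Qed.

Let L2_add0 : left_id L2_0 (L2_lin 1).
Proof.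
move=> u; apply: L2_ext.
by apply: filter_app (L2_0E); apply: filter_app (L2_linE 1 L2_0 u);
  apply: filterE => x -> ->; rewrite mulr0 add0r.
Qed.

Let L2_addN : left_inverse L2_0 (fun u => L2_lin (-1) u L2_0) (L2_lin 1).
Proof.
move=> u; apply: L2_ext.
apply: filter_app (L2_0E); apply: filter_app (L2_linE (-1) u L2_0);
  apply: filter_app (L2_linE 1 (L2_lin (-1) u L2_0) u); apply: filterE.
by move=> x -> -> ->; rewrite addr0 mul1r mulN1r addNr.
Qed.

HB.instance Definition _ :=
  GRing.isZmodule.Build L2 L2_addA L2_addC L2_add0 L2_addN.

Let L2_scale a u := L2_lin a u L2_0.

Let L2_scaleE a (u : L2) : {ae mu, forall x, L2_scale a u x = a * u x}.
Proof.
apply: filter_app (L2_0E); apply: filter_app (L2_linE a u L2_0);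
  apply: filterE => x; rewrite /L2_scale => -> ->.
by rewrite addr0.
Qed.

Let L2_addE (u v : L2) : {ae mu, forall x, (u + v : L2) x = u x + v x}.
Proof. by apply: filter_app (L2_linE 1 u v);
  apply: filterE => x ->; rewrite mul1r. Qed.

Let L2_scaleA a b v : L2_scale a (L2_scale b v) = L2_scale (a * b) v.
Proof.
apply: L2_ext.
apply: filter_app (L2_scaleE (a * b) v);
  apply: filter_app (L2_scaleE b v);
  apply: filter_app (L2_scaleE a (L2_scale b v)); apply: filterE.
by move=> x -> -> ->; rewrite mulrA.
Qed.

Let L2_scale1 : left_id 1 L2_scale.
Proof.
move=> u; apply: L2_ext.
by apply: filter_app (L2_scaleE 1 u); apply: filterE => x ->; rewrite mul1r.
Qed.

Let L2_scaleDr : right_distributive L2_scale +%R.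
Proof.
move=> a u v; apply: L2_ext.
apply: filter_app (L2_addE (L2_scale a u) (L2_scale a v));
  apply: filter_app (L2_scaleE a v); apply: filter_app (L2_scaleE a u);
  apply: filter_app (L2_addE u v);
  apply: filter_app (L2_scaleE a (u + v));
  apply: filterE => x e1 e2 e3 e4 e5.
by rewrite e1 e2 e5 e3 e4 mulrDr.
Qed.

Let L2_scaleDl v : {morph L2_scale^~ v : a b / a + b}.
Proof.
move=> a b; apply: L2_ext.
apply: filter_app (L2_addE (L2_scale a v) (L2_scale b v));
  apply: filter_app (L2_scaleE b v); apply: filter_app (L2_scaleE a v);
  apply: filter_app (L2_scaleE (a + b) v);
  apply: filterE => x -> + + -> => -> ->.
by rewrite mulrDl.
Qed.

HB.instance Definition _ := GRing.Zmodule_isLmodule.Build R L2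
  L2_scaleA L2_scale1 L2_scaleDr L2_scaleDl.

Lemma L2D (u v : L2) : {ae mu, forall x, (u + v : L2) x = u x + v x}.
Proof. exact: L2_addE. Qed.

Lemma L2Z (a : R) (u : L2) : {ae mu, forall x, (a *: u : L2) x = a * u x}.
Proof. exact: L2_scaleE. Qed.

Lemma L20 : {ae mu, forall x, (0 : L2) x = 0}.
Proof. exact: L2_0E. Qed.

Lemma L2_integrableM (u v : T -> R) : u \in Lfun mu 2%:E ->
  v \in Lfun mu 2%:E -> mu.-integrable setT (fun x => (u x * v x)%:E).
Proof. by move=> u2 v2; apply/Lfun1_integrable; exact: Lfun2_mul_Lfun1. Qed.

Lemma ae_eq_Rintegral (f g : T -> R) : measurable_fun setT f ->
  measurable_fun setT g -> {ae mu, forall x, f x = g x} ->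
  \int[mu]_x f x = \int[mu]_x g x.
Proof.
move=> mf mg fg; congr fine; apply: ae_eq_integral => //.
- exact/measurable_EFinP.
- exact/measurable_EFinP.
- by apply: filterS fg => x -> _.
Qed.

Lemma L2_measurable (u : L2) : measurable_fun setT u.
Proof. by have /Lfun2P[] := L2_Lfun u. Qed.

Lemma Lfun2_measurable (f : T -> R) : f \in Lfun mu 2%:E ->
  measurable_fun setT f.
Proof. by case/Lfun2P. Qed.

Lemma L2_int_lin a (u v : L2) (h : T -> R) : h \in Lfun mu 2%:E ->
  \int[mu]_x ((a *: u + v : L2) x * h x) =
  a * (\int[mu]_x (u x * h x)) + \int[mu]_x (v x * h x).
Proof.
move=> h2; have uh := L2_integrableM (L2_Lfun u) h2.
have vh := L2_integrableM (L2_Lfun v) h2.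
have mh := Lfun2_measurable h2.
have mu' := L2_measurable u; have mv := L2_measurable v.
rewrite -RintegralZl// -RintegralD//; last first.
  exact: (integrableZl measurableT a uh).
apply: ae_eq_Rintegral.
- by apply: measurable_funM => //; exact: L2_measurable.
- apply: measurable_funD; last exact: measurable_funM.
  by apply: measurable_funM => //; exact: measurable_funM.
- apply: filter_app (L2Z a u); apply: filter_app (L2D (a *: u) v);
  apply: filterE => x -> ->.
  by rewrite mulrDl mulrA.
Qed.

Definition L2_dot (u v : L2) : R := \int[mu]_x (u x * v x).

Lemma L2_dotC u v : L2_dot u v = L2_dot v u.
Proof. by apply: eq_Rintegral => x _; rewrite mulrC. Qed.

Lemma L2_dot_lin a u v w :
  L2_dot (a *: u + v) w = a * L2_dot u w + L2_dot v w.
Proof. exact/L2_int_lin/L2_Lfun. Qed.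

Lemma L2_dot_ge0 u : 0 <= L2_dot u u.
Proof. by apply: Rintegral_ge0 => x _; rewrite -expr2 sqr_ge0. Qed.

Lemma L2_dot_eq0 u : L2_dot u u = 0 -> u = 0.
Proof.
move=> u0; apply: L2_ext.
have fin := L2_integrableM (L2_Lfun u) (L2_Lfun u).
have : (\int[mu]_x `|(u x * u x)%:E| = 0)%E.
  under eq_integral => x _ do rewrite /= ger0_norm -?expr2 ?sqr_ge0//.
  rewrite -[LHS]fineK; last exact: integrable_fin_num.
  by congr EFin; rewrite -[RHS]u0.
move/ae_eq_integral_abs => /(_ measurableT (measurable_int _ fin)) uu.
apply: filter_app (L20); apply: filter_app (uu);
  apply: filterE => x /(_ I) [/eqP] /[swap] ->.
by rewrite mulf_eq0 orbb => /eqP.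
Qed.

End L2_space.

Section R3_space.
Variable R : realType.

Definition R3 : Type := (R * R * R)%type.
HB.instance Definition _ := NormedModule.copy R3 (R * R * R)%type.
HB.instance Definition _ := Measurable.copy R3
  (measurableTypeR R * measurableTypeR R * measurableTypeR R)%type.

Definition lebesgue3 : {measure set R3 -> \bar R} :=
  ((@lebesgue_measure R \x @lebesgue_measure R \x @lebesgue_measure R)%E :
    {measure set (measurableTypeR R * measurableTypeR R * measurableTypeR R)
      -> \bar R}).

(* [`|x|] on [R3] is the sup norm; this is the Euclidean one. *)
Definition euclid (x : R3) : R :=
  Num.sqrt (x.1.1 ^+ 2 + x.1.2 ^+ 2 + x.2 ^+ 2).

Definition basis3 (i : 'I_3) : R3 :=
  ((i == 0%N :> nat)%:R, (i == 1%N :> nat)%:R, (i == 2%N :> nat)%:R).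

Fixpoint Ck (k : nat) (f : R3 -> R) : Prop :=
  continuous f /\
  if k is k'.+1 then
    forall i, (forall x, derivable f x (basis3 i)) /\
              Ck k' (fun x => 'D_(basis3 i) f x)
  else True.

Definition test_function (phi : R3 -> R) : Prop :=
  (forall k, Ck k phi) /\ compact (closure [set x | phi x != 0]).

Definition weak_partial (i : 'I_3) (u g : R3 -> R) : Prop :=
  forall phi, test_function phi ->
    \int[lebesgue3]_x (u x * 'D_(basis3 i) phi x) =
    - \int[lebesgue3]_x (g x * phi x).

Definition radial (u : R3 -> R) : Prop :=
  exists g : R -> R, {ae lebesgue3, forall x, u x = g (euclid x)}.

Lemma R3_ball_measurable (x : R3) (r : R) : measurable (ball x r).
Proof.
suff -> : ball x r = (ball x.1.1 r `*` ball x.1.2 r) `*` ball x.2 r.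
  have mb (a : R) : measurable (ball a r : set (measurableTypeR R)).
    by rewrite ball_itv; exact: measurable_itv.
  exact: measurableX (measurableX (mb _) (mb _)) (mb _).
by apply/seteqP; split.
Qed.

Lemma R3_ball_finite (x : R3) (r : R) : (lebesgue3 (ball x r) < +oo)%E.
Proof.
have -> : ball x r = (ball x.1.1 r `*` ball x.1.2 r) `*` ball x.2 r.
  by apply/seteqP; split.
have mb (a : R) : measurable (ball a r : set (measurableTypeR R)).
  by rewrite ball_itv; exact: measurable_itv.
have fb (a : R) :
    lebesgue_measure (ball a r : set (measurableTypeR R)) \is a fin_num.
  by rewrite ball_itv lebesgue_measure_itv/=; case: ifP.
rewrite [X in (X < _)%E](product_measure1E _ _
  (measurableX (mb _) (mb _)) (mb _)).
rewrite [X in (X * _ < _)%E](product_measure1E _ _ (mb _) (mb _)).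
by rewrite ltey_eq; apply/orP; left; rewrite !fin_numM//; exact: fb.
Qed.

Lemma R3_open_measurable (U : set R3) : open U -> measurable U.
Proof.
move=> oU.
pose q3 (q : rat * rat * rat * rat) : R3 :=
  (ratr q.1.1.1, ratr q.1.1.2, ratr q.1.2).
pose B (q : rat * rat * rat * rat) : set R3 :=
  if `[< ball (q3 q) (ratr q.2) `<=` U >] then ball (q3 q) (ratr q.2) else set0.
suff -> : U = \bigcup_q B q.
  apply: countable_bigcupT_measurable => [|q]; first exact: countableP.
  by rewrite /B; case: ifP => // _; exact: R3_ball_measurable.
apply/seteqP; split=> [x Ux|x [q _]]; last first.
  by rewrite /B; case: asboolP => // qU /qU.
have /nbhs_ballP[e /= e0 xeU] : nbhs x U by exact: open_nbhs_nbhs.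
have near_rat (a d : R) : 0 < d -> exists q : rat, `|ratr q - a| < d.
  move=> d0; have [|q] := @rat_in_itvoo R (a - d) (a + d).
    by rewrite ltrBlDr -addrA ltrDl addr_gt0.
  by rewrite in_itv/= => qad; exists q; rewrite ltr_distl.
have [q qe] : exists q : rat, (ratr q : R) \in `](e / 4), (e / 2)[.
  by apply: rat_in_itvoo; lra.
move: qe; rewrite in_itv/= => /andP[q1 q2].
have e4 : 0 < e / 4 by rewrite divr_gt0.
have [p1 h1] := near_rat x.1.1 _ e4.
have [p2 h2] := near_rat x.1.2 _ e4.
have [p3 h3] := near_rat x.2 _ e4.
exists (p1, p2, p3, q) => //; rewrite /B; case: asboolP => [_|].
  by split=> /=; [split=> /=|]; rewrite /ball/=; apply: lt_trans q1.
case=> y [[y1 y2] y3]; apply: xeU; split=> /=; [split=> /=|];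
  rewrite /ball/= in y1 y2 y3 *.
- by rewrite -(subrK (ratr p1) x.1.1) -addrA;
  apply: le_lt_trans (ler_normD _ _) _; rewrite distrC; lra.
- by rewrite -(subrK (ratr p2) x.1.2) -addrA;
  apply: le_lt_trans (ler_normD _ _) _; rewrite distrC; lra.
- by rewrite -(subrK (ratr p3) x.2) -addrA;
  apply: le_lt_trans (ler_normD _ _) _; rewrite distrC; lra.
Qed.

Lemma R3_continuous_measurable (f : R3 -> R) :
  continuous f -> measurable_fun setT f.
Proof.
move=> /continuousP cf; apply: (measurability _ (RGenOpens.measurableE R)).
move=> _ [_ [a [b ->] <-]]; rewrite setTI.
by apply: R3_open_measurable; exact: cf.
Qed.

Lemma compact_support_Lfun (f : R3 -> R) (K : set R3) :
  continuous f -> compact K ->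
  (forall x, ~ K x -> f x = 0) -> f \in Lfun lebesgue3 2%:E.
Proof.
move=> cf cK f0; have mf := R3_continuous_measurable cf.
apply/Lfun2P; split => //.
have [M [_ /(_ (`|M| + 1)) hM]] := compact_bounded cK.
have [N [_ /(_ (`|N| + 1)) hN]] :=
  compact_bounded (continuous_compact (continuous_subspaceT cf) cK).
have {}hM x : K x -> `|x| <= `|M| + 1.
  by apply: hM; rewrite ltr_pwDr// ler_norm.
have {}hN x : K x -> `|f x| <= `|N| + 1.
  by move=> Kx; apply: hN; [rewrite ltr_pwDr// ler_norm|exists x].
pose A := ball (0 : R3) (`|M| + 2).
have KA x : K x -> A x.
  move=> /hM xM; rewrite /A -ball_normE/= sub0r normrN (le_lt_trans xM)//.
  by rewrite ltrD2l ltr1n.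
have mA : measurable A by exact: R3_ball_measurable.
have -> : (fun x => (f x ^+ 2)%:E) = (EFin \o (fun x => f x ^+ 2)) \_ A.
  apply/funext => x; rewrite patchE; case: ifPn => //= xA.
  by rewrite f0 ?expr0n// => /KA /mem_set; exact/negP.
apply/(integrable_mkcond _ mA); apply: measurable_bounded_integrable => //.
- exact: R3_ball_finite.
- by apply: measurable_funX; exact: measurable_funTS.
- exists ((`|N| + 1) ^+ 2); split; first exact: num_real.
  move=> e eN x _; apply: le_trans (ltW eN); rewrite normrX.
  have [/hN fx|/f0 ->] := pselect (K x); first by rewrite ler_pXn2r// nnegrE.
  by rewrite normr0 expr0n/= exprn_ge0.
Qed.

Lemma test_function_Lfun phi : test_function phi ->
  phi \in Lfun lebesgue3 2%:E.
Proof.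
case=> /(_ 0%N)[cphi _] K; apply: compact_support_Lfun K _ => // x Kx.
by apply/eqP/negPn/negP => fx; apply: Kx; exact: subset_closure.
Qed.

Lemma test_partial_Lfun i phi : test_function phi ->
  (fun x => 'D_(basis3 i) phi x) \in Lfun lebesgue3 2%:E.
Proof.
case=> /(_ 1%N)[_ /(_ i)[_ [cphi _]]] K.
apply: compact_support_Lfun K _ => // x Kx.
rewrite (@near_eq_derive _ _ _ _ (cst 0)) ?derive_cst//.
have oK : open (~` closure [set x | phi x != 0]).
  by apply: closed_openC; exact: closed_closure.
have := open_nbhs_nbhs (conj oK Kx); apply: filterS => y Ky.
by apply/eqP/negPn/negP => fy; apply: Ky; exact: subset_closure.
Qed.

(* An element of [H1rad] is an L2 function together with its weak gradient;
   weak derivatives being unique almost everywhere, the second component is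
   determined by the first one. *)
Definition H1rad_mem : {pred L2 lebesgue3 * {ffun 'I_3 -> L2 lebesgue3}} :=
  fun w => `[< (forall i, weak_partial i w.1 (w.2 i)) /\ radial w.1 >].

Lemma H1rad_submod_closed : submod_closed H1rad_mem.
Proof.
split=> [|a u v].
  apply/asboolP; split=> [i phi tphi|]; last first.
    by exists (fun=> 0); exact: L20.
  have int0 h : h \in Lfun lebesgue3 2%:E ->
      \int[lebesgue3]_x ((0 : L2 lebesgue3) x * h x) = 0.
    move=> h2; have := L2_int_lin (-1) 0 0 h2.
    by rewrite scaler0 addr0 mulN1r addNr.
  rewrite ffunE !int0 ?oppr0//; last exact: test_partial_Lfun.
  exact: test_function_Lfun.
move=> /asboolP[wu [gu hu]] /asboolP[wv [gv hv]].
apply/asboolP; split=> [i phi tphi|].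
  rewrite /= !ffunE.
  rewrite !L2_int_lin ?wu ?wv; [by rewrite mulrN opprD|by []..| |].
  - exact: test_function_Lfun.
  - exact: test_partial_Lfun.
exists (fun r => a * gu r + gv r).
apply: filter_app (L2D (a *: u.1) v.1); apply: filter_app (L2Z a u.1);
  apply: filter_app hv; apply: filter_app hu; apply: filterE => x.
by move=> hu hv -> ->; rewrite hu hv.
Qed.

HB.instance Definition _ := GRing.isSubmodClosed.Build R _ H1rad_mem
  H1rad_submod_closed.

Record H1rad : Type := MkH1rad {
  h1pair : L2 lebesgue3 * {ffun 'I_3 -> L2 lebesgue3};
  h1pairP : h1pair \in H1rad_mem }.
HB.instance Definition _ := [isSub for h1pair].
HB.instance Definition _ := [Choice of H1rad by <:].
HB.instance Definition _ := [SubChoice_isSubLmodule of H1rad by <:].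

Definition h1fun (u : H1rad) : R3 -> R := (h1pair u).1.
Coercion h1fun : H1rad >-> Funclass.

Definition partial (i : 'I_3) (u : H1rad) : R3 -> R := (h1pair u).2 i.

Definition h1dot (u v : H1rad) : R :=
  \int[lebesgue3]_x (u x * v x) +
  \sum_i \int[lebesgue3]_x (partial i u x * partial i v x).

Definition h1norm (u : H1rad) : R := Num.sqrt (h1dot u u).

Let h1dotE u v : h1dot u v = L2_dot (h1pair u).1 (h1pair v).1 +
  \sum_i L2_dot ((h1pair u).2 i) ((h1pair v).2 i).
Proof. by []. Qed.

Lemma h1pair_lin a u v : h1pair (a *: u + v) = a *: h1pair u + h1pair v.
Proof.
have := linearP (\val : H1rad -> _) a u v.
by [].
Qed.

Lemma h1dotC u v : h1dot u v = h1dot v u.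
Proof.
rewrite !h1dotE L2_dotC; congr (_ + _); apply: eq_bigr => i _.
exact: L2_dotC.
Qed.

Lemma h1dot_lin a u v w : h1dot (a *: u + v) w = a * h1dot u w + h1dot v w.
Proof.
rewrite !h1dotE h1pair_lin mulrDr addrACA.
rewrite [(_ + _).1]/= L2_dot_lin; congr (_ + _).
rewrite mulr_sumr -big_split; apply: eq_bigr => i _.
by rewrite /= !ffunE L2_dot_lin.
Qed.

Lemma h1dot_ge0 u : 0 <= h1dot u u.
Proof. by apply: addr_ge0; [|apply: sumr_ge0 => i _]; exact: L2_dot_ge0. Qed.

Lemma h1dot_eq0 u : h1dot u u = 0 -> u = 0.
Proof.
move=> /eqP; rewrite paddr_eq0; last 2 first.
- exact: L2_dot_ge0.
- by apply: sumr_ge0 => i _; exact: L2_dot_ge0.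
move=> /andP[/eqP u0]; rewrite psumr_eq0 => [/allP du0|i _]; last first.
  exact: L2_dot_ge0.
apply: val_inj => /=; case: u u0 du0 => -[u g] ug u0 du0.
congr pair; first exact: L2_dot_eq0.
apply/ffunP => i; rewrite ffunE; apply: L2_dot_eq0; apply/eqP.
exact: (du0 i (mem_index_enum i)).
Qed.

Lemma h1dotZ a u v : h1dot (a *: u) v = a * h1dot u v.
Proof.
have := h1dot_lin a u 0 v; rewrite addr0 => ->.
by have := h1dot_lin (-1) 0 0 v; rewrite scaler0 addr0; lra.
Qed.

Lemma h1norm_triangle u v : h1norm (u + v) <= h1norm u + h1norm v.
Proof.
have h1dotD w z t : h1dot (w + z) t = h1dot w t + h1dot z t.
  by have := h1dot_lin 1 w z t; rewrite scale1r mul1r.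
have dotE a b : h1dot (a *: u + b *: v) (a *: u + b *: v) =
    a ^+ 2 * h1dot u u + 2 * a * b * h1dot u v + b ^+ 2 * h1dot v v.
  rewrite h1dotD !h1dotZ ![h1dot _ (_ + _)]h1dotC !h1dotD !h1dotZ.
  by rewrite (h1dotC v u); ring.
have CS : h1dot u v <= h1norm u * h1norm v.
  have [/h1dot_eq0 ->|u0] := eqVneq (h1dot u u) 0.
    by rewrite -(scale0r u) h1dotZ mul0r mulr_ge0// sqrtr_ge0.
  rewrite -sqrtrM ?h1dot_ge0//; apply: le_trans (ler_norm _) _.
  rewrite -sqrtr_sqr ler_sqrt ?mulr_ge0 ?h1dot_ge0//.
  have := h1dot_ge0 ((- h1dot u v) *: u + h1dot u u *: v).
  rewrite dotE => h.
  have u1 : 0 < h1dot u u by rewrite lt_neqAle eq_sym u0 h1dot_ge0.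
  by rewrite -(ler_pM2l u1); nra.
rewrite -(ler_pXn2r (_ : 0 < 2)%N) ?nnegrE ?addr_ge0 ?sqrtr_ge0//.
rewrite sqrrD !sqr_sqrtr ?h1dot_ge0//.
have := dotE 1 1; rewrite !scale1r => ->; lra.
Qed.

Lemma h1normZ a u : h1norm (a *: u) = `|a| * h1norm u.
Proof.
rewrite /h1norm h1dotZ h1dotC h1dotZ mulrA -expr2 sqrtrM ?sqr_ge0//.
by rewrite sqrtr_sqr.
Qed.

Lemma h1norm_eq0 u : h1norm u = 0 -> u = 0.
Proof.
move=> /eqP; rewrite sqrtr_eq0 => u0; apply: h1dot_eq0.
by apply/eqP; rewrite eq_le u0 h1dot_ge0.
Qed.

HB.instance Definition _ :=
  Lmodule_isNormed.Build R H1rad h1norm_triangle h1normZ h1norm_eq0.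

End R3_space.

Section minimax.
Variable R : realType.
Local Notation leb := (@lebesgue3 R).

(* Radial functions in H^1(R^3, R^2). The library gives products the sup of
   the two norms, which is equivalent to [h1norm2] below and so induces the
   same topology. *)
Local Notation E := (H1rad R * H1rad R)%type.

Definition h1dot2 (w z : E) : R := h1dot w.1 z.1 + h1dot w.2 z.2.
Definition h1norm2 (w : E) : R := Num.sqrt (h1dot2 w w).

Definition grad_sqr (u : H1rad R) (x : R3 R) : R :=
  \sum_(i < 3) partial i u x ^+ 2.

Definition kinetic (w : E) : R :=
  \int[leb]_x (grad_sqr w.1 x + grad_sqr w.2 x).

Definition quartic (mu1 mu2 beta : R) (w : E) : R :=
  \int[leb]_x (mu1 * w.1 x ^+ 4 + 2 * beta * w.1 x ^+ 2 * w.2 x ^+ 2 +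
               mu2 * w.2 x ^+ 4).

Definition energy (mu1 mu2 beta : R) (w : E) : R :=
  2^-1 * kinetic w - 4^-1 * quartic mu1 mu2 beta w.

Definition mass_sphere (a : R) : set (H1rad R) :=
  [set w | \int[leb]_x (w x ^+ 2) = a ^+ 2].

Definition mass_constraint (a1 a2 : R) : set E :=
  mass_sphere a1 `*` mass_sphere a2.

Definition pohozaev (a1 a2 mu1 mu2 beta : R) : set E :=
  mass_constraint a1 a2 `&`
  [set w : E | kinetic w = 3 / 4 * quartic mu1 mu2 beta w].

(* Tangent space at [w] of the product of the mass spheres through [w.1] and
   [w.2]. *)
Definition tangent (w : E) : set E :=
  [set h : E | \int[leb]_x (w.1 x * h.1 x) = 0 /\
           \int[leb]_x (w.2 x * h.2 x) = 0].

(* [g] is the gradient at [w], with respect to the H^1 inner product, of the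
   restriction of [f] to the product of mass spheres containing [w]. *)
Definition is_constrained_gradient (f : E -> R) (w g : E) : Prop :=
  [/\ differentiable f w, tangent w g &
      forall h, tangent w h -> 'd f w h = h1dot2 g h].

Definition sigma (w : E) : E := (w.2, w.1).

Definition sigma_invariant (A : set E) : Prop := sigma @` A = A.

(* Homotopies [0,1] x X -> X are encoded as total functions of which only the
   values on [0,1] x X matter. *)
Definition admissible_deformation (X B : set E) (eta : R * E -> E) : Prop :=
  [/\ {within `[0, 1] `*` X, continuous eta},
      forall t w, t \in `[0, 1] -> X w -> X (eta (t, w)),
      forall t w, t \in `[0, 1] -> X w ->
        eta (t, sigma w) = sigma (eta (t, w)),
      forall w, X w -> eta (0, w) = w &
      forall t w, t \in `[0, 1] -> B w -> eta (t, w) = w].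

Definition sigma_homotopy_stable (X B : set E) (F : set (set E)) : Prop :=
  [/\ exists2 C : set E, closed C & B = X `&` C,
      sigma_invariant B,
      forall A, F A -> compact A /\ A `<=` X,
      forall A, F A -> B `<=` A &
      (forall A eta, F A -> admissible_deformation X B eta ->
        F [set eta (1, w) | w in A]) /\
      (forall A, F A -> sigma_invariant A)].

(* Equal to -oo on the empty set; a maximum on nonempty compact sets when [f]
   is continuous. *)
Definition sup_on (f : E -> R) (A : set E) : \bar R :=
  ereal_sup [set (f w)%:E | w in A].

Definition minimax (f : E -> R) (F : set (set E)) : \bar R :=
  ereal_inf [set sup_on f A | A in F].

End minimax.

(* Main.v *)
Require Import Defs.
From HB Require Import structures.
From mathcomp Require Import all_boot all_order all_algebra.
From mathcomp Require Import all_classical all_reals all_analysis.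
From mathcomp Require Import measurable_realfun.
From mathcomp Require Import ring lra.
Set Implicit Arguments.
Unset Strict Implicit.
Unset Printing Implicit Defensive.
Import Order.TTheory GRing.Theory Num.Theory.
Import numFieldNormedType.Exports.
Local Open Scope classical_set_scope.
Local Open Scope ring_scope.

(** On the Pohozaev set [J] is one sixth of the Dirichlet energy [K], so the
    sublevel sets are bounded in [H^1], while [K] stays away from zero near the
    level [c > 0].  On such a region the derivatives of [J] are bounded and
    Lipschitz, and one explicit gradient step of uniform length replaces the
    usual pseudo-gradient flow.

    Let [V w] be the gradient of [J] restricted to the product of the spheres
    ([cgrad]).  The deformation moves [w] to [w - s V(w)], normalizes both masses
    ([grad_step]) and applies the mass preserving dilation
    [u |-> l^(3/2) u(l x)] with the factor [l] that brings the pair back to the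
    Pohozaev set ([deform]).  Since dilation multiplies [K] by [l^2] and the
    quartic term by [l^3], the Pohozaev set consists of the maxima of [J] along
    the dilation orbits.  At such a maximum the derivative along the orbit
    vanishes, so that normalizing and dilating back cost only terms of order
    [s^2 |V w|^2], and [J] decreases by at least [s |V w|^2 / 2] for all
    [s <= tau], with [tau] uniform ([descent]).  As [mu1 = mu2] and [a1 = a2],
    everything commutes with the exchange of the components; a cutoff in [J]
    makes the deformation trivial on [B].

    If [A] is in the family and [max_A J < c + e], the deformed set is in the
    family as well, so some point [w] of [A] is deformed to a point of energy
    greater than [c - e].  Then [|J w - c| <= e] and [|V w|^2] is at most a
    constant times [e] ([near_critical_point]).  The Palais-Smale sequence is
    thus taken inside the sets [A_n] themselves: when these consist of
    nonnegative pairs, the negative parts of the sequence vanish almost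
    everywhere.

    The analytic input is built from the Lebesgue integral: completeness of
    [L^2] and of the radial [H^1] and the Riesz representation
    ([H1rad_Riesz]), for gradients; the embedding of [H^1(R^3)] in [L^4]
    ([H1rad_L4]), which makes the quartic term a bounded symmetric 4-linear
    form; and the strong continuity of the dilations ([H1dil_continuous]),
    for the continuity of the deformation. *)

(** * Inner products and the Riesz representation *)

Section inner_product.
Context (R : realType) (V : lmodType R) (dot : V -> V -> R).
Hypothesis dotC : forall u v, dot u v = dot v u.
Hypothesis dot_lin : forall a u v w, dot (a *: u + v) w = a * dot u w + dot v w.
Hypothesis dot_ge0 : forall u, 0 <= dot u u.

Lemma dot0l w : dot 0 w = 0.
Proof. by have := dot_lin (-1) 0 0 w; rewrite scaler0 addr0; lra. Qed.

Lemma dotDl u v w : dot (u + v) w = dot u w + dot v w.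
Proof. by have := dot_lin 1 u v w; rewrite scale1r mul1r. Qed.

Lemma dotZl a u w : dot (a *: u) w = a * dot u w.
Proof. by have := dot_lin a u 0 w; rewrite addr0 dot0l addr0. Qed.

Lemma dotNl u w : dot (- u) w = - dot u w.
Proof. by rewrite -scaleN1r dotZl mulN1r. Qed.

Lemma dotBl u v w : dot (u - v) w = dot u w - dot v w.
Proof. by rewrite dotDl dotNl. Qed.

Lemma dotDr u v w : dot u (v + w) = dot u v + dot u w.
Proof. by rewrite dotC dotDl !(dotC u). Qed.

Lemma dotZr a u w : dot u (a *: w) = a * dot u w.
Proof. by rewrite dotC dotZl (dotC u). Qed.

Lemma dotNr u w : dot u (- w) = - dot u w.
Proof. by rewrite dotC dotNl (dotC u). Qed.

Lemma dotBr u v w : dot u (v - w) = dot u v - dot u w.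
Proof. by rewrite dotC dotBl !(dotC u). Qed.

(** The form may be degenerate, so the case [dot v v = 0] is separate: a
    polynomial of degree one in [t] that is nonnegative everywhere is constant. *)
Lemma dot_CauchySchwarz u v : dot u v ^+ 2 <= dot u u * dot v v.
Proof.
have key t : 0 <= dot u u + 2 * t * dot u v + t ^+ 2 * dot v v.
  have := dot_ge0 (u + t *: v).
  by rewrite dotDl !dotDr !dotZl !dotZr (dotC v u); nra.
have [v0|v0] := eqVneq (dot v v) 0; last first.
  have vgt0 : 0 < dot v v by rewrite lt_neqAle eq_sym v0 dot_ge0.
  have := key (- dot u v / dot v v).
  have -> : dot u u + 2 * (- dot u v / dot v v) * dot u v +
    (- dot u v / dot v v) ^+ 2 * dot v v =
    (dot u u * dot v v - dot u v ^+ 2) / dot v v by field.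
  by rewrite pmulr_lge0 ?invr_gt0// subr_ge0.
rewrite v0 mulr0; have [->|uv0] := eqVneq (dot u v) 0; first by rewrite expr0n.
have := key (- (dot u u + 1) / (2 * dot u v)).
rewrite v0 mulr0 addr0.
have -> : 2 * (- (dot u u + 1) / (2 * dot u v)) * dot u v = - (dot u u + 1).
  by field.
by lra.
Qed.

Variable M : V -> Prop.
Hypothesis M0 : M 0.
Hypothesis Mlin : forall a u v, M u -> M v -> M (a *: u + v).
Hypothesis Mcomplete : forall u : nat -> V, (forall n, M (u n)) ->
  (forall n, dot (u n.+1 - u n) (u n.+1 - u n) <= 16^-1 ^+ n) ->
  exists2 l, M l & dot (u n - l) (u n - l) @[n --> \oo] --> (0 : R).

(** The representing vector minimizes [|v|^2 - 2 f v] over [M]: by the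
    parallelogram identity a fast minimizing sequence is Cauchy, and the
    first-order condition at its limit is the representation. *)
Lemma Riesz_representation (f : V -> R) (C : R) :
  (forall a u v, M u -> M v -> f (a *: u + v) = a * f u + f v) -> 0 <= C ->
  (forall v, M v -> f v ^+ 2 <= C * dot v v) ->
  exists2 g, M g & forall v, M v -> f v = dot g v.
Proof.
move=> flin C0 fC.
pose Phi v := dot v v - 2 * f v.
have Mh u v : M u -> M v -> M (2^-1 *: (u + v)).
  move=> Mu Mv; rewrite -[X in M X]addr0; apply: Mlin => //.
  by rewrite -[u]scale1r; exact: Mlin.
have f0 : f 0 = 0 by have := flin (-1) 0 0 M0 M0; rewrite scaler0 addr0; lra.
have fh u v : M u -> M v -> f (2^-1 *: (u + v)) = 2^-1 * (f u + f v).
  move=> Mu Mv; have Muv : M (u + v) by rewrite -[u]scale1r; exact: Mlin.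
  have := flin (2^-1) _ _ Muv M0; rewrite addr0 f0 addr0 => ->.
  by have := flin 1 _ _ Mu Mv; rewrite scale1r mul1r => ->.
pose S := [set Phi v | v in [set v | M v]].
have Sinf : has_inf S.
  split; first by exists (Phi 0); exists 0.
  exists (- C) => _ [v Mv <-]; rewrite /Phi.
  have := fC v Mv; have := dot_ge0 v.
  have [|] := leP (2 * f v) (dot v v + C); first lra.
  move=> h1 h2 h3; have h4 : 0 < (2 * f v - (dot v v + C)) * (2 * f v + dot v v + C).
    by apply: mulr_gt0; lra.
  by have := sqr_ge0 (dot v v - C); nra.
pose m := inf S.
have Phim v : M v -> m <= Phi v.
  by move=> Mv; apply: ge_inf; [case: Sinf | exists v].
pose d n : R := 16^-1 ^+ n / 4.
have d_gt0 n : 0 < d n by rewrite divr_gt0// exprn_gt0.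
have ex n : exists v, M v /\ Phi v < m + d n.
  have [_ [v Mv <-] h] := inf_adherent (d_gt0 n) Sinf.
  by exists v; split.
have [u Hu] := choice ex.
have Mu n : M (u n) by case: (Hu n).
have [|g Mg ug] := Mcomplete Mu.
  move=> n; have := Phim _ (Mh _ _ (Mu n) (Mu n.+1)).
  rewrite /Phi fh//; have [_] := Hu n; have [_] := Hu n.+1; rewrite /Phi.
  rewrite !(dotNl, dotNr, dotZl, dotZr, dotDl, dotDr) (dotC (u n.+1) (u n)).
  have : d n.+1 <= d n.
    by rewrite /d ler_pM2r ?invr_gt0// ler_wiXn2l// invf_le1//; lra.
  have -> : 16^-1 ^+ n = 4 * d n by rewrite /d; field.
  by lra.
exists g => // v Mv.
have lim0 : d n @[n --> \oo] --> (0 : R).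
  rewrite -[0](mul0r 4^-1); apply: cvgMl.
  by apply: cvg_expr; rewrite ger0_norm ?invr_ge0// invf_lt1//; lra.
have dotlim : dot (u n) v @[n --> \oo] --> dot g v.
  apply/cvgrPdist_lt => /= e e0.
  move/cvgrPdist_lt : ug => /(_ (e ^+ 2 / (dot v v + 1))) /=.
  have v1 : 0 < dot v v + 1 by have := dot_ge0 v; lra.
  rewrite divr_gt0 ?exprn_gt0// => /(_ isT); apply: filterS => n.
  rewrite sub0r normrN ger0_norm// => un.
  rewrite -dotBl -(ltr_pXn2r (_ : 0 < 2)%N) ?nnegrE ?normr_ge0 ?(ltW e0)//.
  rewrite -normrX ger0_norm ?sqr_ge0//.
  apply: le_lt_trans (dot_CauchySchwarz _ _) _.
  rewrite -opprB dotNl dotC dotNl opprK.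
  move: un; rewrite ltr_pdivlMr// => un.
  by have := dot_ge0 v; have := dot_ge0 (u n - g); nra.
have key t : 0 <= 2 * t * (dot g v - f v) + t ^+ 2 * dot v v.
  have Pn n : 0 <= 2 * t * (dot (u n) v - f v) + t ^+ 2 * dot v v + d n.
    have := Phim _ (Mlin t Mv (Mu n)); rewrite /Phi flin//.
    have [_] := Hu n; rewrite /Phi.
    by rewrite !(dotNl, dotNr, dotZl, dotZr, dotDl, dotDr) (dotC v (u n)); nra.
  have : 2 * t * (dot (u n) v - f v) + t ^+ 2 * dot v v + d n @[n --> \oo] -->
      2 * t * (dot g v - f v) + t ^+ 2 * dot v v + 0.
    apply: cvgD => //; apply: cvgD; last exact: cvg_cst.
    by apply: cvgMr; apply: cvgB => //; exact: cvg_cst.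
  by rewrite addr0 => /cvgr_to_ge; apply; exact: nearW.
apply/eqP; rewrite eq_sym -subr_eq0; apply/eqP; set a := _ - _ in key *.
apply/eqP; apply: contraT => a0.
have := dot_ge0 v => v0.
have := key (- a / (dot v v + 1)).
have -> : 2 * (- a / (dot v v + 1)) * a + (- a / (dot v v + 1)) ^+ 2 * dot v v =
  - (a ^+ 2 * (dot v v + 2) / (dot v v + 1) ^+ 2).
  by field; lra.
have a2 : 0 < a ^+ 2 by rewrite exprn_even_gt0.
rewrite oppr_ge0 leNgt => /negP; case; apply: divr_gt0.
  by apply: mulr_gt0 => //; lra.
by apply: exprn_gt0; lra.
Qed.

End inner_product.

(** * Completeness of L2 *)

Section L2_theory.
Context d (T : measurableType d) (R : realType).
Variable mu : {measure set T -> \bar R}.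
Local Notation L2 := (@L2 _ T R mu).

Lemma L2B (u v : L2) : {ae mu, forall x, (u - v : L2) x = u x - v x}.
Proof.
rewrite -scaleN1r; apply: filter_app (L2D u (-1 *: v));
  apply: filter_app (L2Z (-1) v); apply: filterE => x -> ->.
by rewrite mulN1r.
Qed.

Lemma L2_dotE (u v : L2) (f g : T -> R) : measurable_fun setT f ->
  measurable_fun setT g -> {ae mu, forall x, u x = f x} ->
  {ae mu, forall x, v x = g x} -> L2_dot u v = \int[mu]_x (f x * g x).
Proof.
move=> mf mg uf vg; apply: ae_eq_Rintegral.
- by apply: measurable_funM; exact: L2_measurable.
- exact: measurable_funM.
- by apply: filter_app vg; apply: filter_app uf; apply: filterE => x -> ->.
Qed.

Lemma L2_dot_sqr (u : L2) (f : T -> R) : measurable_fun setT f ->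
  {ae mu, forall x, u x = f x} ->
  (\int[mu]_x (f x ^+ 2)%:E = (L2_dot u u)%:E)%E.
Proof.
move=> mf uf; have ui := L2_integrableM (L2_Lfun u) (L2_Lfun u).
rewrite -[RHS]/((fine _)%:E) fineK; last exact: integrable_fin_num.
apply: ae_eq_integral => //.
- by apply/measurable_EFinP; exact: measurable_funX.
- exact: measurable_int ui.
- by apply: filterS uf => x -> _; rewrite expr2.
Qed.

Lemma Lfun2_dominated (f : T -> R) : measurable_fun setT f ->
  (\int[mu]_x (f x ^+ 2)%:E < +oo)%E -> f \in Lfun mu 2%:E.
Proof.
move=> mf fi; apply/Lfun2P; split => //; apply/integrableP; split.
  by apply/measurable_EFinP; exact: measurable_funX.
by under eq_integral => x _ do rewrite /= ger0_norm ?sqr_ge0//.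
Qed.

Lemma L2_dot_le_sqr (u : L2) (f : T -> R) (C : R) : measurable_fun setT f ->
  {ae mu, forall x, u x = f x} ->
  (\int[mu]_x (f x ^+ 2)%:E <= C%:E)%E -> L2_dot u u <= C.
Proof. by move=> mf uf; rewrite (L2_dot_sqr mf uf) lee_fin. Qed.

(** Cauchy-Schwarz with the weights [2 ^ -k]: the weighted square sums dominate
    all oscillations beyond [n], and their integrals converge for a fast Cauchy
    sequence. *)
Lemma sqr_diff_le_weighted_sum (a : nat -> R) n m : (n <= m)%N ->
  (a m - a n) ^+ 2 <= 2 * (2^-1 ^+ n - 2^-1 ^+ m) *
    \sum_(n <= k < m) 2 ^+ k * (a k.+1 - a k) ^+ 2.
Proof.
elim: m => [|m IH]; first by rewrite leqn0 => /eqP ->; rewrite !subrr expr0n/= mulr0 mul0r.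
rewrite leq_eqVlt => /predU1P[<-|]; first by rewrite !subrr expr0n/= mulr0 mul0r.
rewrite ltnS => nm; move: (IH nm); rewrite big_nat_recr//=.
have S0 : 0 <= \sum_(n <= k < m) 2 ^+ k * (a k.+1 - a k) ^+ 2.
  by apply: sumr_ge0 => k _; rewrite mulr_ge0 ?sqr_ge0 ?exprn_ge0//.
have p0 : 0 < (2 : R)^-1 ^+ m by rewrite exprn_gt0.
have pp : (2 : R)^-1 ^+ m * 2 ^+ m = 1.
  by rewrite -exprMn mulVf ?expr1n.
have A0 : 0 <= (2 : R)^-1 ^+ n - 2^-1 ^+ m.
  by rewrite subr_ge0 ler_wiXn2l ?invr_ge0 ?invf_le1 ?ler1n//.
rewrite (exprS 2^-1).
have -> : a m.+1 - a n = (a m - a n) + (a m.+1 - a m) by ring.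
set x := a m - a n; set y := a m.+1 - a m.
set S := \sum_(_ <= _ < _) _ in S0 *.
set A := _ - _ in A0 *; set p := 2^-1 ^+ m in p0 pp *; set q := 2 ^+ m in pp *.
move=> h.
have -> : 2 * (2^-1 ^+ n - 2^-1 * p) * (S + q * y ^+ 2) =
  (2 * A + p) * (S + q * y ^+ 2) by rewrite /A -/p; field.
have -> : (2 * A + p) * (S + q * y ^+ 2) =
  2 * A * S + (p * q) * y ^+ 2 + (2 * A * q * y ^+ 2 + p * S) by ring.
rewrite pp mul1r.
have q0 : 0 < q by rewrite exprn_gt0.
have S1 : 0 <= 2 * A * q * y ^+ 2 + p * S.
  apply: addr_ge0; last exact: mulr_ge0 (ltW p0) S0.
  by rewrite mulr_ge0 ?sqr_ge0// mulr_ge0 ?(ltW q0)// mulr_ge0.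
suff : 2 * x * y <= 2 * A * q * y ^+ 2 + p * S by nra.
rewrite real_leNgt ?num_real//; apply/negP => lt1.
have : (2 * A * q * y ^+ 2 + p * S) ^+ 2 < (2 * x * y) ^+ 2.
  by rewrite ltr_pXn2r// nnegrE//; apply: le_trans (ltW lt1).
apply/negP; rewrite -real_leNgt ?num_real//.
have := sqr_ge0 (2 * A * q * y ^+ 2 - p * S).
have : x ^+ 2 * y ^+ 2 <= 2 * A * S * y ^+ 2 by rewrite ler_wpM2r ?sqr_ge0.
have -> : (2 * x * y) ^+ 2 = 4 * (x ^+ 2 * y ^+ 2) by ring.
have -> : (2 * A * q * y ^+ 2 + p * S) ^+ 2 =
  (2 * A * q * y ^+ 2 - p * S) ^+ 2 + 4 * (p * q) * (2 * A * S * y ^+ 2) by ring.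
by rewrite pp; lra.
Qed.

(** Riesz-Fischer: the rate makes the weighted square increments summable in
    mean, hence almost everywhere, and the same sums bound the distance to the
    limit. *)
Lemma L2_fast_cauchy_cvg (u : nat -> L2) :
  (forall n, L2_dot (u n.+1 - u n) (u n.+1 - u n) <= 16^-1 ^+ n) ->
  exists l : L2, {ae mu, forall x, u n x @[n --> \oo] --> l x} /\
    L2_dot (u n - l) (u n - l) @[n --> \oo] --> (0 : R).
Proof.
move=> uC.
have mu_ n : measurable_fun setT (u n) := L2_measurable (u n).
pose g k x : R := 2 ^+ k * (u k.+1 x - u k x) ^+ 2.
have g0 k x : 0 <= g k x by rewrite mulr_ge0 ?sqr_ge0 ?exprn_ge0//.
have mg k : measurable_fun setT (g k).
  by apply: measurable_funM => //; apply: measurable_funX; exact: measurable_funB.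
pose G x := (\sum_(k <oo) (g k x)%:E)%E.
have G0 x : (0 <= G x)%E by apply: nneseries_ge0 => k _ _; rewrite lee_fin.
have mG : measurable_fun setT G.
  apply: (@ge0_emeasurable_sum _ _ _ _ (fun k x => (g k x)%:E) xpredT) => //.
  - by move=> k x _ _; rewrite lee_fin.
  - by move=> k _; apply/measurable_EFinP.
have intg k : (\int[mu]_x (g k x)%:E <= ((8^-1 : R) ^+ k)%:E)%E.
  under eq_integral => x _ do rewrite /g EFinM.
  rewrite ge0_integralZl//; last 2 first.
  - by apply/measurable_EFinP; apply: measurable_funX; exact: measurable_funB.
  - by move=> x _; rewrite lee_fin sqr_ge0.
  have := L2B (u k.+1) (u k).
  move/L2_dot_sqr => ->; last exact: measurable_funB.
  rewrite -EFinM lee_fin.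
  have -> : (8^-1 : R) ^+ k = 2 ^+ k * 16^-1 ^+ k.
    by rewrite -exprMn; congr (_ ^+ _); field.
  by rewrite ler_pM2l// exprn_gt0.
have sum8 n : \sum_(0 <= k < n) (8^-1 : R) ^+ k <= 2 - 2 * 8^-1 ^+ n.
  elim: n => [|n IH]; first by rewrite big_nil expr0; lra.
  rewrite big_nat_recr//= exprS; have : 0 < (8^-1 : R) ^+ n by rewrite exprn_gt0.
  by lra.
have intG : (\int[mu]_x G x <= 2%:E)%E.
  rewrite integral_nneseries//; last 2 first.
  - by move=> k; apply/measurable_EFinP.
  - by move=> k x _; rewrite lee_fin.
  apply: lime_le.
    by apply: is_cvg_nneseries => k _ _; apply: integral_ge0 => x _; rewrite lee_fin.
  apply: nearW => n.
  apply: (@le_trans _ _ (\sum_(0 <= k < n) (8^-1 : R) ^+ k)%:E).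
    by rewrite -sumEFin; apply: lee_sum.
  by rewrite lee_fin (le_trans (sum8 n))// gerBl mulr_ge0 ?exprn_ge0.
have Gfin : {ae mu, forall x, G x \is a fin_num}.
  have Gi : mu.-integrable setT G.
    apply/integrableP; split => //.
    under eq_integral => x _ do rewrite gee0_abs//.
    by apply: le_lt_trans intG _; rewrite ltry.
  by apply: filterS (integrable_ae measurableT Gi) => x; apply.
have osc x n m : G x \is a fin_num -> (n <= m)%N ->
    (u m x - u n x) ^+ 2 <= 2 * 2^-1 ^+ n * fine (G x).
  move=> Gx nm; apply: le_trans (sqr_diff_le_weighted_sum (fun k => u k x) nm) _.
  have p0 k : 0 < (2 : R)^-1 ^+ k by rewrite exprn_gt0.
  apply: ler_pM.
  - by rewrite mulr_ge0// subr_ge0 ler_wiXn2l ?invr_ge0 ?invf_le1 ?ler1n//.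
  - by apply: sumr_ge0 => k _; exact: g0.
  - by rewrite ler_pM2l// gerBl ltW.
  - rewrite -lee_fin fineK//.
    apply: le_trans (_ : (\sum_(0 <= k < m) (g k x)%:E <= _)%E); last first.
      by apply: nneseries_lim_ge => k _ _; rewrite lee_fin.
    rewrite sumEFin lee_fin [leRHS](big_cat_nat _ nm)//= lerDr.
    by apply: sumr_ge0.
have lim2 : (2 * 2^-1 ^+ n : R) @[n --> \oo] --> (0 : R).
  rewrite -[X in _ --> X](mulr0 2); apply: cvgMr; apply: cvg_expr.
  by rewrite ger0_norm ?invr_ge0 ?invf_lt1 ?ltr1n//.
have ucvg x : G x \is a fin_num -> cvgn (fun n => u n x).
  move=> Gx; apply/cauchy_cvgP/cauchy_ballP => e e0; near_simpl.
  have : (2 * 2^-1 ^+ n * fine (G x)) @[n --> \oo] --> 0 * fine (G x).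
    exact: cvgMl lim2.
  rewrite mul0r => /cvgrPdist_lt /(_ ((e / 2) ^+ 2)).
  rewrite exprn_gt0 ?divr_gt0// => /(_ isT)[N _ hN].
  have close n : (N <= n)%N -> `|u n x - u N x| < e / 2.
    move=> Nn; have := hN N (leqnn N).
    rewrite /= sub0r normrN => h.
    rewrite -(ltr_pXn2r (_ : 0 < 2)%N) ?nnegrE ?divr_ge0 ?(ltW e0)//.
    rewrite -normrX ger0_norm ?sqr_ge0//; apply: le_lt_trans (osc _ _ _ Gx Nn) _.
    exact: le_lt_trans (ler_norm _) h.
  exists ([set n | (N <= n)%N], [set n | (N <= n)%N]).
    by split; exists N.
  move=> [n m] [/= Nn Nm]; rewrite -ball_normE/=.
  have := close _ Nn; have := close _ Nm; rewrite (distrC (u m x)) => h1 h2.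
  rewrite -(subrK (u N x) (u n x)) -addrA.
  by apply: le_lt_trans (ler_normD _ _) _; lra.
pose l x := fine (limn_esup (fun n => (u n x)%:E)).
have ml : measurable_fun setT l.
  apply: measurableT_comp; first exact: fine_measurable.
  by apply: measurable_fun_limn_esup => n; apply/measurable_EFinP.
have ul x : G x \is a fin_num -> u n x @[n --> \oo] --> l x.
  move=> /ucvg cx; have ecx : (u n x)%:E @[n --> \oo] --> (limn (fun n => u n x))%:E.
    by apply: cvg_EFin => //; exact: nearW.
  rewrite /l is_cvg_limn_esupE; last by apply/cvg_ex; eexists; exact: ecx.
  by rewrite (cvg_lim _ ecx).
have oscl x n : G x \is a fin_num ->
    (u n x - l x) ^+ 2 <= 2 * 2^-1 ^+ n * fine (G x).
  move=> Gx; have : (u m x - u n x) ^+ 2 @[m --> \oo] --> (l x - u n x) ^+ 2.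
    rewrite expr2; under eq_fun do rewrite expr2.
    have h : u m x - u n x @[m --> \oo] --> l x - u n x.
      by apply: cvgB; [exact: ul|exact: cvg_cst].
    exact: cvgM.
  rewrite -sqrrN opprB => /cvgr_to_le; apply.
  by exists n => // m /= nm; exact: osc.
have intul n : (\int[mu]_x ((u n x - l x) ^+ 2)%:E <= (4 * 2^-1 ^+ n)%:E)%E.
  apply: (@le_trans _ _ (\int[mu]_x ((2 * 2^-1 ^+ n)%:E * G x))%E).
    apply: ae_ge0_le_integral => //.
    - by move=> x _; rewrite lee_fin sqr_ge0.
    - by apply/measurable_EFinP; apply: measurable_funX; exact: measurable_funB.
    - by move=> x _; rewrite mule_ge0// lee_fin mulr_ge0// exprn_ge0.
    - exact: measurable_funeM.
    - apply: filterS Gfin => x Gx _.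
      by rewrite -(fineK Gx) -EFinM lee_fin; exact: oscl.
  rewrite ge0_integralZl//.
  have -> : 4 * 2^-1 ^+ n = 2 * 2^-1 ^+ n * 2 :> R by ring.
  by rewrite [leRHS]EFinM lee_wpmul2l// lee_fin mulr_ge0// exprn_ge0.
have ul0 : (fun x => u 0%N x - l x) \in Lfun mu 2%:E.
  apply: Lfun2_dominated; first exact: measurable_funB.
  by apply: le_lt_trans (intul 0%N) _; rewrite ltry.
have l2 : l \in Lfun mu 2%:E.
  have := Lfun2_lin (-1) ul0 (L2_Lfun (u 0%N)).
  suff -> : (fun x => -1 * (u 0%N x - l x) + u 0%N x) = l by [].
  by apply/funext => x; ring.
exists (L2_mk l2); split.
  apply: filter_app (L2_mkE l2); apply: filterS Gfin => x Gx ->.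
  exact: ul.
apply: (@squeeze_cvgr _ _ _ _ (fun=> 0) (fun n => 4 * 2^-1 ^+ n)).
- apply: nearW => n; rewrite L2_dot_ge0/=.
  apply: (@L2_dot_le_sqr _ (fun x => u n x - l x)) => //.
    exact: measurable_funB.
  by apply: filter_app (L2_mkE l2); apply: filterS (L2B (u n) (L2_mk l2)) => x -> ->.
- exact: cvg_cst.
- have -> : (fun n => 4 * 2^-1 ^+ n) = (fun n => 2 * (2 * 2^-1 ^+ n)) :> (nat -> R).
    by apply/funext => n; ring.
  by rewrite -[X in _ --> X](mulr0 2); exact: cvgMr.
Qed.

End L2_theory.

(** * Completeness of the radial Sobolev space *)

Section H1rad_complete.
Context (R : realType).
Local Notation leb := (@lebesgue3 R).
Local Notation L2 := (@L2 _ (R3 R) R leb).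

Lemma h1pairB (u v : H1rad R) : h1pair (u - v) = h1pair u - h1pair v.
Proof. by rewrite -scaleN1r addrC h1pair_lin scaleN1r addrC. Qed.

Lemma L2_dot_h1dot (u v : H1rad R) : h1dot u v =
  L2_dot (h1pair u).1 (h1pair v).1 + \sum_i L2_dot ((h1pair u).2 i) ((h1pair v).2 i).
Proof. by []. Qed.

Lemma L2_dot_cvg (u : nat -> L2) (l v : L2) :
  L2_dot (u n - l) (u n - l) @[n --> \oo] --> (0 : R) ->
  L2_dot (u n) v @[n --> \oo] --> L2_dot l v.
Proof.
move=> ul; apply/cvgrPdist_lt => /= e e0.
have v1 : 0 < L2_dot v v + 1 by have := L2_dot_ge0 v; lra.
move/cvgrPdist_lt : ul => /(_ (e ^+ 2 / (L2_dot v v + 1))) /=.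
rewrite divr_gt0 ?exprn_gt0// => /(_ isT); apply: filterS => n.
rewrite sub0r normrN ger0_norm ?L2_dot_ge0// => un.
rewrite distrC -(dotBl (@L2_dot_lin _ _ R leb)).
rewrite -(ltr_pXn2r (_ : 0 < 2)%N) ?nnegrE ?normr_ge0 ?(ltW e0)//.
rewrite -normrX ger0_norm ?sqr_ge0//.
apply: le_lt_trans (dot_CauchySchwarz (@L2_dotC _ _ R leb) (@L2_dot_lin _ _ R leb)
  (@L2_dot_ge0 _ _ R leb) _ _) _.
move: un; rewrite ltr_pdivlMr// => un.
by have := L2_dot_ge0 v; have := L2_dot_ge0 (u n - l); nra.
Qed.

Lemma L2_dot_mk (u : L2) (f : R3 R -> R) (f2 : f \in Lfun leb 2%:E) :
  L2_dot u (L2_mk f2) = \int[leb]_x (u x * f x).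
Proof.
apply: L2_dotE (L2_mkE f2).
- exact: L2_measurable.
- exact: Lfun2_measurable f2.
- exact: aeW.
Qed.

(** Both sides of the defining identity are inner products with a fixed
    square integrable function, hence pass to the limit. *)
Lemma weak_partial_cvg i (u g : nat -> L2) (v h : L2) :
  (forall n, weak_partial i (u n) (g n)) ->
  L2_dot (u n - v) (u n - v) @[n --> \oo] --> (0 : R) ->
  L2_dot (g n - h) (g n - h) @[n --> \oo] --> (0 : R) ->
  weak_partial i v h.
Proof.
move=> ug uv gh phi tphi.
rewrite -(L2_dot_mk v (test_partial_Lfun i tphi)) -(L2_dot_mk h (test_function_Lfun tphi)).
have vlim := @L2_dot_cvg _ _ (L2_mk (test_partial_Lfun i tphi)) uv.
have hlim := @L2_dot_cvg _ _ (L2_mk (test_function_Lfun tphi)) gh.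
apply: (cvg_unique _ vlim) => //.
have -> : (fun n => L2_dot (u n) (L2_mk (test_partial_Lfun i tphi))) =
          (fun n => - L2_dot (g n) (L2_mk (test_function_Lfun tphi))).
  by apply/funext => n; rewrite !L2_dot_mk; exact: ug.
exact: cvgN.
Qed.

(** The profiles converge at every radius of a point where all the identities
    and the limit hold, so their pointwise limit is a profile of the limit. *)
Lemma radial_cvg (u : nat -> R3 R -> R) (v : R3 R -> R) :
  (forall n, radial (u n)) -> {ae leb, forall x, u n x @[n --> \oo] --> v x} ->
  radial v.
Proof.
move=> /choice[g ug] uv; exists (fun r => limn (fun n => g n r)).
have {}ug : {ae leb, forall x, forall n, u n x = g n (euclid x)} by exact: ae_foralln.
apply: filter_app uv; apply: filterS ug => x ugx uvx.
apply/esym/cvg_lim => //; rewrite -[X in X @ _ --> _](_ : (fun n => u n x) = _) //.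
by apply/funext => n; rewrite ugx.
Qed.

Lemma H1rad_complete (u : nat -> H1rad R) :
  (forall n, h1dot (u n.+1 - u n) (u n.+1 - u n) <= 16^-1 ^+ n) ->
  exists l, h1dot (u n - l) (u n - l) @[n --> \oo] --> (0 : R).
Proof.
move=> uC.
have [|v [uv vL]] := @L2_fast_cauchy_cvg _ _ _ leb (fun n => (h1pair (u n)).1).
  move=> n; apply: le_trans (uC n); rewrite L2_dot_h1dot h1pairB/= lerDl.
  by apply: sumr_ge0 => i _; exact: L2_dot_ge0.
have dC i n : L2_dot ((h1pair (u n.+1)).2 i - (h1pair (u n)).2 i)
    ((h1pair (u n.+1)).2 i - (h1pair (u n)).2 i) <= 16^-1 ^+ n.
  apply: le_trans (uC n); rewrite L2_dot_h1dot h1pairB/= (bigD1 i)//= !ffunE.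
  rewrite addrCA lerDl addr_ge0 ?L2_dot_ge0//.
  by apply: sumr_ge0 => j _; exact: L2_dot_ge0.
have /choice[g gP] i : exists h : L2,
    L2_dot ((h1pair (u n)).2 i - h) ((h1pair (u n)).2 i - h) @[n --> \oo] --> (0 : R).
  by have [h [_ ?]] := L2_fast_cauchy_cvg (dC i); exists h.
have mem n : (forall i, weak_partial i (h1pair (u n)).1 ((h1pair (u n)).2 i)) /\
    radial (h1pair (u n)).1 by apply/asboolP; exact: h1pairP.
have vg : (v, [ffun i => g i]) \in @H1rad_mem R.
  apply/asboolP; split => [i|]; last first.
    by apply: radial_cvg uv => n; case: (mem n).
  by rewrite ffunE; apply: weak_partial_cvg vL (gP i) => n; case: (mem n).
exists (MkH1rad vg).
have -> : (fun n => h1dot (u n - MkH1rad vg) (u n - MkH1rad vg)) = (fun n =>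
   L2_dot ((h1pair (u n)).1 - v) ((h1pair (u n)).1 - v) +
   \sum_i L2_dot ((h1pair (u n)).2 i - g i) ((h1pair (u n)).2 i - g i)).
  apply/funext => n; rewrite L2_dot_h1dot h1pairB/=; congr (_ + _).
  by apply: eq_bigr => i _; rewrite !ffunE.
rewrite -[X in _ --> X]addr0; apply: cvgD => //.
have := cvgD (gP ord0) (cvgD (gP (lift ord0 ord0)) (gP (lift ord0 (lift ord0 ord0)))).
move=> /(_ _ _) h; have {h} := h _ _; rewrite !addr0; apply: cvg_trans; apply: near_eq_cvg; apply: nearW => n.
by rewrite !big_ord_recl big_ord0 addr0.
Qed.

Lemma H1rad_Riesz (f : H1rad R -> R) (C : R) :
  (forall a u v, f (a *: u + v) = a * f u + f v) -> 0 <= C ->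
  (forall v, f v ^+ 2 <= C * h1dot v v) ->
  exists g, forall v, f v = h1dot g v.
Proof.
move=> flin C0 fC.
have [|||||g _ gP] := @Riesz_representation R (H1rad R) (@h1dot R) (@h1dotC R)
  (@h1dot_lin R) (@h1dot_ge0 R) (fun=> True) _ _ _ f C _ C0 _ => //.
- by move=> u _ /H1rad_complete[l]; exists l.
- by exists g => v; exact: gP.
Qed.

End H1rad_complete.

(** * Functions with vanishing integrals over a pi-system *)

Section density_measure.
Context d (T : measurableType d) (R : realType).
Variables (mu : {measure set T -> \bar R}) (f : T -> \bar R).
Hypotheses (mf : measurable_fun setT f) (f0 : forall x, (0 <= f x)%E).

(** The hypotheses are explicit arguments so that the measure structure can be
    inferred from the term alone. *)
Definition density_measure (mf' : measurable_fun setT f)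
  (f0' : forall x, (0 <= f x)%E) (A : set T) : \bar R := (\int[mu]_(x in A) f x)%E.

Let dm := density_measure mf f0.

Let dm0 : dm set0 = 0%E. Proof. exact: integral_set0. Qed.
Let dm_ge0 A : (0 <= dm A)%E. Proof. by apply: integral_ge0 => x _; exact: f0. Qed.
Let dm_sigma : semi_sigma_additive dm.
Proof. exact: semi_sigma_additive_nng_induced. Qed.

HB.instance Definition _ := isMeasure.Build _ _ _
  (density_measure mf f0) dm0 dm_ge0 dm_sigma.

End density_measure.

Section vanishing.
Context d (T : measurableType d) (R : realType).
Variable mu : {measure set T -> \bar R}.

(** The positive and the negative part define two finite measures that agree
    on the pi-system, hence everywhere. *)
Lemma integrable_ae0_pi_system (G : set (set T)) (f : T -> \bar R) :
  measurable = <<s G >> -> setI_closed G -> G setT ->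
  mu.-integrable setT f -> (forall A, G A -> \int[mu]_(x in A) f x = 0)%E ->
  {ae mu, forall x, f x = 0%E}.
Proof.
move=> mG GI GT fi fG.
have mf := measurable_int _ fi.
pose m1 := density_measure mu (measurable_funepos mf) (funepos_ge0 f).
pose m2 := density_measure mu (measurable_funeneg mf) (funeneg_ge0 f).
have fin1 A : measurable A -> (\int[mu]_(x in A) (f ^\+ x) \is a fin_num)%E.
  move=> mA; apply: integrable_fin_num => //; apply: integrable_funepos => //.
  exact: integrableS fi.
have fin2 A : measurable A -> (\int[mu]_(x in A) (f ^\- x) \is a fin_num)%E.
  move=> mA; apply: integrable_fin_num => //; apply: integrable_funeneg => //.
  exact: integrableS fi.
have Gm A : G A -> measurable A by move=> GA; rewrite mG; exact: sub_sigma_algebra.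
have m12 A : measurable A -> m1 A = m2 A.
  apply: (measure_unique G (fun=> setT)) => //.
  - by rewrite bigcup_const//; exists 0%N.
  - move=> X GX; have := fG X GX; rewrite integralE => /eqP.
    rewrite sube_eq ?add0e; [by move/eqP|exact: fin1 (Gm _ GX)|].
    by rewrite fin_num_adde_defl// fin2//; exact: Gm.
  - by move=> _; rewrite ltey_eq fin1.
have : ae_eq mu setT f (cst 0%E).
  apply: integral_ae_eq => // E _ mE; rewrite integral0 integralE.
  have := m12 E mE; rewrite /m1 /m2 /density_measure => ->.
  by rewrite subee// fin2.
by apply: filterS => x /(_ I).
Qed.

End vanishing.

Section R3_generators.
Variable R : realType.
Local Notation leb := (@lebesgue3 R).

(** The whole line is included so that the octants form a pi-system containing
    the whole space. *)
Definition ray_or_line : set (set R) :=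
  [set A | A = setT \/ exists a, A = `]a, +oo[%classic].

Definition octants : set (set (R3 R)) :=
  [set X | exists A B C, [/\ ray_or_line A, ray_or_line B, ray_or_line C &
     X = (A `*` B) `*` C]].

Lemma ray_or_lineI : setI_closed ray_or_line.
Proof.
move=> A B [->|[a ->]] [->|[b ->]]; rewrite ?setTI ?setIT; try by [left|right; eexists].
right; exists (Num.max a b); apply/seteqP; split => x /=; rewrite !in_itv/= !andbT gt_max.
  by move=> [-> ->].
by move/andP.
Qed.

Lemma octantsI : setI_closed octants.
Proof.
move=> _ _ [A [B [C [hA hB hC ->]]]] [A' [B' [C' [hA' hB' hC' ->]]]].
exists (A `&` A'), (B `&` B'), (C `&` C'); split; [exact: ray_or_lineI..|].
by apply/seteqP; split => -[[x y] z] /=; tauto.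
Qed.

Lemma octantsT : octants setT.
Proof.
exists setT, setT, setT; split; [by left..|].
by apply/seteqP; split.
Qed.

Lemma ray_or_line_measurable (A : set R) : ray_or_line A ->
  measurable (A : set (measurableTypeR R)).
Proof. by case=> [->|[a ->]]; [exact: measurableT|exact: measurable_itv]. Qed.

Lemma R3_measurable_octants : @measurable _ (R3 R) = <<s octants >>.
Proof.
apply/seteqP; split; last first.
  apply: smallest_sub; first exact: sigma_algebra_measurable.
  move=> _ [A [B [C [hA hB hC ->]]]].
  exact: measurableX (measurableX (ray_or_line_measurable hA)
    (ray_or_line_measurable hB)) (ray_or_line_measurable hC).
pose O := g_sigma_algebraType octants.
have proj (f : O -> measurableTypeR R) :
    (forall a, octants (f @^-1` `]a, +oo[%classic)) -> measurable_fun setT f.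
  move=> fO; apply: (measurability _ (RGenOInfty.measurableE R)).
  by move=> _ [_ [a ->] <-]; rewrite setTI; exact: sub_sigma_algebra.
have m1 : measurable_fun setT (fun x : O => (x.1.1 : measurableTypeR R)).
  apply: proj => a; exists `]a, +oo[%classic, setT, setT; split; [by right; exists a|by left..|].
  by apply/seteqP; split => x //= [[]].
have m2 : measurable_fun setT (fun x : O => (x.1.2 : measurableTypeR R)).
  apply: proj => a; exists setT, `]a, +oo[%classic, setT; split; [by left|by right; exists a|by left|].
  by apply/seteqP; split => x //= [[]].
have m3 : measurable_fun setT (fun x : O => (x.2 : measurableTypeR R)).
  apply: proj => a; exists setT, setT, `]a, +oo[%classic; split; [by left|by left|by right; exists a|].
  by apply/seteqP; split => x //= [[]].
have mid : measurable_fun setT (fun x : O => (x.1.1, x.1.2, x.2) :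
   (measurableTypeR R * measurableTypeR R * measurableTypeR R)%type).
  exact: measurable_fun_pair (measurable_fun_pair m1 m2) m3.
move=> A mA; have := mid measurableT A mA; rewrite setTI.
have -> : (fun x : O => (x.1.1, x.1.2, x.2)) = id by apply/funext => -[[]].
by rewrite preimage_id.
Qed.

End R3_generators.

(** * Changes of variables that scale a measure *)

Section measure_scaling.
Context d1 d2 (X : measurableType d1) (Y : measurableType d2) (R : realType).

Definition image_measure (mu : {measure set X -> \bar R}) (phi : X -> Y)
  (mphi : measurable_fun setT phi) : {measure set Y -> \bar R}.
Proof. by refine (pushforward mu phi); exact: mphi. Defined.

(** A copy of [m] carrying the sigma-finiteness proof as an argument, from
    which the structure required by the product measures is inferred. *)
Definition sigma_finite_copy (m : {measure set X -> \bar R})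
  (sfm : sigma_finite setT m) : set X -> \bar R := m.

Section sigma_finite_copy.
Variables (m : {measure set X -> \bar R}) (sfm : sigma_finite setT m).

Let copy := sigma_finite_copy sfm.
Let copy0 : copy set0 = 0%E. Proof. exact: measure0. Qed.
Let copy_ge0 A : (0 <= copy A)%E. Proof. exact: measure_ge0. Qed.
Let copy_sigma : semi_sigma_additive copy.
Proof. exact: measure_semi_sigma_additive. Qed.

HB.instance Definition _ := isMeasure.Build _ _ _
  (sigma_finite_copy sfm) copy0 copy_ge0 copy_sigma.
HB.instance Definition _ := Measure_isSigmaFinite.Build _ _ _
  (sigma_finite_copy sfm) sfm.
End sigma_finite_copy.

End measure_scaling.

(** Equivalently, [m] is [c] times its own image under [phi]: the form in which
    a change of variables passes to products of measures. *)
Definition scales_measure d (T : measurableType d) (R : realType)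
    (m : {measure set T -> \bar R}) (phi : T -> T) (c : R) : Prop :=
  measurable_fun setT phi /\
  forall A, measurable A -> m A = (c%:E * m (phi @^-1` A))%E.

Section scales_measure.
Context (R : realType).

Lemma scales_measure_prod d1 d2 (T1 : measurableType d1) (T2 : measurableType d2)
    (m1 : {sigma_finite_measure set T1 -> \bar R})
    (m2 : {sigma_finite_measure set T2 -> \bar R}) phi1 phi2 (c1 c2 : R) :
  0 <= c1 -> 0 <= c2 ->
  scales_measure m1 phi1 c1 -> scales_measure m2 phi2 c2 ->
  scales_measure (m1 \x m2)%E (fun x => (phi1 x.1, phi2 x.2)) (c1 * c2).
Proof.
move=> c10 c20 [mphi1 h1] [mphi2 h2].
have mphi : measurable_fun setT (fun x : T1 * T2 => (phi1 x.1, phi2 x.2)).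
  by apply: measurable_fun_pair; exact: measurableT_comp.
split => // A mA.
have c0 : 0 <= c1 * c2 by rewrite mulr_ge0.
pose m' := mscale (NngNum c0) (image_measure (m1 \x m2)%E mphi).
rewrite -[RHS]/(m' A); apply: product_measure_unique => // B C mB mC.
rewrite /m'/= /mscale/=.
have -> : image_measure (m1 \x m2)%E mphi (B `*` C) =
    (m1 \x m2)%E ((phi1 @^-1` B) `*` (phi2 @^-1` C)) by [].
have mB' : measurable (phi1 @^-1` B) by rewrite -[X in measurable X]setTI; exact: mphi1.
have mC' : measurable (phi2 @^-1` C) by rewrite -[X in measurable X]setTI; exact: mphi2.
rewrite product_measure1E// (h1 B)// (h2 C)// EFinM.
by rewrite muleACA.
Qed.

Context d (T : measurableType d) (m : {measure set T -> \bar R}).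
Variables (phi : T -> T) (c : R).
Hypotheses (c0 : 0 < c) (hphi : scales_measure m phi c).
Local Open Scope ereal_scope.

Lemma ge0_integral_scales (f : T -> \bar R) : measurable_fun setT f ->
  (forall x, 0 <= f x) -> \int[m]_x f x = c%:E * \int[m]_x f (phi x).
Proof.
move=> mf f0; case: hphi => mphi hm.
rewrite (@eq_measure_integral _ _ _ setT
  (mscale (NngNum (ltW c0)) (image_measure m mphi))); last first.
  by move=> A mA _; rewrite /mscale/=; exact: hm.
rewrite ge0_integral_mscale//; congr (_ * _).
by rewrite [LHS]ge0_integral_pushforward// preimage_setT.
Qed.

Lemma integrable_scales (f : T -> R) : m.-integrable setT (EFin \o f) ->
  m.-integrable setT (EFin \o (f \o phi)).
Proof.
case/integrableP => mf fi; apply/integrableP; split.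
  by have [mphi _] := hphi; exact: (measurableT_comp mf mphi).
move: fi; rewrite ge0_integral_scales//; last exact: measurableT_comp.
rewrite -ge0_integralZl//; last 2 first.
- by have [mphi _] := hphi; apply: measurableT_comp => //; exact: (measurableT_comp mf mphi).
- by rewrite lee_fin ltW.
rewrite ge0_integralZl//; last 2 first.
- by have [mphi _] := hphi; apply: measurableT_comp => //; exact: (measurableT_comp mf mphi).
- by rewrite lee_fin ltW.
by move: (integral _ _ _) => [r||]//=; rewrite ?ltry// gt0_muley ?lte_fin.
Qed.

Lemma Rintegral_scales (f : T -> R) : m.-integrable setT (EFin \o f) ->
  (\int[m]_x f x = c * \int[m]_x f (phi x))%R.
Proof.
move=> fi; have fi' := integrable_scales fi.
have mf := measurable_int _ fi.
rewrite /Rintegral [in LHS]integralE [in RHS]integralE.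
rewrite (ge0_integral_scales (measurable_funepos mf))//.
rewrite (ge0_integral_scales (measurable_funeneg mf))//.
rewrite (@eq_integral _ _ _ m setT (EFin \o (f \o phi))^\+); last first.
  by move=> x _; rewrite !funeposE.
rewrite (@eq_integral _ _ _ m setT (EFin \o (f \o phi))^\- (fun x => (EFin \o f)^\- (phi x))); last first.
  by move=> x _; rewrite !funenegE.
have h1 : \int[m]_x ((EFin \o (f \o phi)) ^\+ x) \is a fin_num.
  by apply: integrable_fin_num => //; exact: (integrable_funepos measurableT fi').
have h2 : \int[m]_x ((EFin \o (f \o phi)) ^\- x) \is a fin_num.
  by apply: integrable_fin_num => //; exact: (integrable_funeneg measurableT fi').
rewrite -muleN -muleDr//; last by rewrite fin_num_adde_defl// fin_numN.
by rewrite fineM// fin_numD h1 fin_numN h2.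
Qed.

Lemma ae_scales (P : T -> Prop) :
  {ae m, forall x, P x} -> {ae m, forall x, P (phi x)}.
Proof.
case=> N [mN N0 PN]; case: hphi => mphi hm.
exists (phi @^-1` N); split => //.
- by rewrite -[X in measurable X]setTI; exact: mphi.
- move: N0; rewrite hm// => /eqP; rewrite mule_eq0 => /orP[|/eqP//].
  by rewrite eqe (gt_eqF c0).
- by move=> x /= Px; exact: PN.
Qed.

End scales_measure.

(** * Dilations and balls in R3 *)

Section R3_measure.
Variable R : realType.
Local Notation leb1 := (@lebesgue_measure R).
Local Notation leb := (@lebesgue3 R).

Local Notation mR := (measurableTypeR R).
Local Notation mR2 := (measurableTypeR R * measurableTypeR R)%type.

Lemma lebesgue_measure_sigma_finite2 : sigma_finite setT (leb1 \x leb1)%E.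
Proof.
pose F n : set mR := ball (0 : R) n.+1%:R.
have mF n : measurable (F n) by rewrite /F ball_itv; exact: measurable_itv.
exists (fun n => F n `*` F n) => [|n].
  apply/esym; rewrite -subTset => -[x y] _.
  exists (Num.truncn (Num.max `|x| `|y|)) => //.
  have := truncnS_gt (Num.max `|x| `|y|); rewrite gt_max => /andP[xn yn].
  by split; rewrite /F -ball_normE/= sub0r normrN.
split; first exact: measurableX.
rewrite [X in (X < _)%E]product_measure1E//.
have fF : leb1 (F n) \is a fin_num.
  by rewrite /F ball_itv lebesgue_measure_itv/=; case: ifP.
by rewrite ltey_eq fin_numM.
Qed.

Lemma lebesgue3_sigma_finite : sigma_finite setT leb.
Proof.
exists (fun n => ball (0 : R3 R) n.+1%:R) => [|n]; last first.
  by split; [exact: R3_ball_measurable|exact: R3_ball_finite].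
apply/esym; rewrite -subTset => x _; exists (Num.truncn `|x|) => //.
by rewrite -ball_normE/= sub0r normrN truncnS_gt.
Qed.

Definition lebesgue2_sf : {sigma_finite_measure set mR2 -> \bar R} :=
  sigma_finite_copy lebesgue_measure_sigma_finite2.

Definition lebesgue3_sf : {sigma_finite_measure set (R3 R) -> \bar R} :=
  sigma_finite_copy lebesgue3_sigma_finite.

Lemma lebesgue_measure_scales (l : R) : 0 < l ->
  scales_measure leb1 (fun x => l * x : measurableTypeR R) l.
Proof.
move=> l0.
have mphi : measurable_fun setT (fun x : measurableTypeR R => l * x : measurableTypeR R).
  exact: measurable_funM.
split => // A mA.
pose m' := mscale (NngNum (ltW l0)) (image_measure leb1 mphi).
rewrite -[RHS]/(m' A); apply: lebesgue_measure_unique => // _ [[a b] _ <-]/=.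
rewrite /m'/= /mscale/=.
rewrite (_ : pushforward _ _ _ = leb1 [set` `]a / l, b / l]]); last first.
  rewrite /pushforward; congr (leb1 _); apply/seteqP; split => x /=;
  by rewrite !in_itv/= ltr_pdivrMr// ler_pdivlMr// [x * _]mulrC.
rewrite !lebesgue_measure_itv/= !lte_fin ltr_pM2r ?invr_gt0//.
case: ifP => _; last by rewrite mule0.
by rewrite -!EFinB -EFinM; congr EFin; field; rewrite gt_eqF.
Qed.

Lemma lebesgue3_scales (l : R) : 0 < l ->
  scales_measure leb (fun x => l *: x) (l ^+ 3).
Proof.
move=> l0; have h1 := lebesgue_measure_scales l0.
have h2 := scales_measure_prod (ltW l0) (ltW l0) h1 h1.
have l20 : 0 <= l * l by rewrite mulr_ge0// ltW.
have := @scales_measure_prod _ _ _ _ _ lebesgue2_sf leb1 _ _ _ _ l20 (ltW l0) h2 h1.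
by rewrite -expr2 -exprSr.
Qed.

Lemma R3_ball_volume (x : R3 R) (r : R) : 0 < r ->
  leb (ball x r) = ((2 * r) ^+ 3)%:E.
Proof.
move=> r0.
have -> : ball x r = (ball x.1.1 r `*` ball x.1.2 r) `*` ball x.2 r.
  by apply/seteqP; split.
have mb (a : R) : measurable (ball a r : set (measurableTypeR R)).
  by rewrite ball_itv; exact: measurable_itv.
have fb (a : R) : leb1 (ball a r : set (measurableTypeR R)) = (2 * r)%:E.
  rewrite ball_itv lebesgue_measure_itv/= lte_fin ifT; last lra.
  by rewrite -EFinB; congr EFin; ring.
rewrite [LHS](product_measure1E _ _ (measurableX (mb _) (mb _)) (mb _)).
rewrite [X in (X * _)%E](product_measure1E _ _ (mb _) (mb _)).
transitivity ((2 * r)%:E * (2 * r)%:E * (2 * r)%:E)%E.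
  by congr (_ * _ * _)%E; exact: fb.
by rewrite -!EFinM; congr EFin; ring.
Qed.

End R3_measure.

(** * Density of continuous functions with compact support *)

Section real_limits.
Context (R : realType) (T : Type) (F : set_system T) (FF : Filter F).
Implicit Types (f g : T -> R) (a b : R).

Lemma cvgr_max f g a b : f @ F --> a -> g @ F --> b ->
  Num.max (f t) (g t) @[t --> F] --> Num.max a b.
Proof.
move=> fa gb; rewrite maxr_absE.
have -> : (fun t => Num.max (f t) (g t)) =
    (fun t => (f t + g t + `|f t - g t|) / 2).
  by apply/funext => t; rewrite maxr_absE.
by apply: cvgMl; apply: cvgD; [exact: cvgD|apply: cvg_norm; exact: cvgB].
Qed.

Lemma cvgr_min f g a b : f @ F --> a -> g @ F --> b ->
  Num.min (f t) (g t) @[t --> F] --> Num.min a b.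
Proof.
move=> fa gb; rewrite minr_absE.
have -> : (fun t => Num.min (f t) (g t)) =
    (fun t => (f t + g t - `|f t - g t|) / 2).
  by apply/funext => t; rewrite minr_absE.
by apply: cvgMl; apply: cvgB; [exact: cvgD|apply: cvg_norm; exact: cvgB].
Qed.

End real_limits.

Section Cc_dense.
Variable R : realType.
Local Notation leb := (@lebesgue3 R).
Local Notation L2 := (@L2 _ (R3 R) R leb).

Definition Cc (phi : R3 R -> R) : Prop :=
  continuous phi /\ exists M, forall x, M <= `|x| -> phi x = 0.

Lemma R3_closed_ball_compact (M : R) : compact [set x : R3 R | `|x| <= M].
Proof.
suff -> : [set x : R3 R | `|x| <= M] =
    (`[(- M), M] `*` `[(- M), M]) `*` `[(- M), M].
  by apply: compact_setX; [apply: compact_setX|]; exact: segment_compact.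
apply/seteqP; split => -[[x y] z] /=.
  rewrite /Num.norm/= !ge_max !in_itv/= -!ler_norml => /andP[/andP[-> ->] ->].
  by [].
move=> [[]]; rewrite !in_itv/= -!ler_norml => hx hy hz.
by rewrite /Num.norm/= !ge_max hx hy hz.
Qed.

Lemma Cc_Lfun phi : Cc phi -> phi \in Lfun leb 2%:E.
Proof.
move=> [cphi [M hM]]; apply: compact_support_Lfun cphi (@R3_closed_ball_compact M) _.
by move=> x /negP; rewrite -real_ltNge ?num_real// => /ltW; exact: hM.
Qed.

(** Continuous ramps of slope [n] increase to the indicator. *)
Lemma ray_or_line_approx (A : set R) : ray_or_line A -> exists p : nat -> R -> R,
  [/\ forall n, continuous (p n), forall n s, 0 <= p n s <= 1 &
      forall s, p n s @[n --> \oo] --> (\1_A s : R)].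
Proof.
case=> [->|[a ->]].
  exists (fun _ _ => 1); split => [n||s]; [exact: cst_continuous|by move=> _ _; rewrite ler01 lexx|].
  by rewrite indicT; exact: cvg_cst.
exists (fun n s => Num.min 1 (Num.max 0 (n%:R * (s - a)))); split.
- move=> n s; apply: cvgr_min; first exact: cvg_cst.
  apply: cvgr_max; first exact: cvg_cst.
  by apply: cvgMr; apply: cvgB; [exact: cvg_id|exact: cvg_cst].
- by move=> n s; rewrite le_min ler01 le_max lexx/= ge_min lexx.
- move=> s; rewrite indicE; have [sa|sa] := leP s a.
    rewrite memNset/=; last by rewrite in_itv/= andbT; apply/negP; rewrite -leNgt.
    apply: cvg_near_cst; apply: nearW => n.
    rewrite (max_idPl _) ?(min_idPr _)// mulr_ge0_le0// subr_le0//.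
  rewrite mem_set/=; last by rewrite in_itv/= andbT.
  apply: cvg_near_cst; exists (Num.truncn (s - a)^-1).+1 => // n /= hn.
  apply/min_idPl; rewrite le_max; apply/orP; right.
  rewrite -ler_pdivrMr ?subr_gt0// mul1r ltW//.
  by apply: lt_le_trans (truncnS_gt _) _; rewrite ler_nat.
Qed.

Let tent (k : nat) (s : R) : R := Num.max 0 (k%:R - `|s|).
Let cutoff k (x : R3 R) : R := tent k x.1.1 * tent k x.1.2 * tent k x.2.

Let tent_continuous k : continuous (tent k).
Proof.
move=> s; apply: cvgr_max; first exact: cvg_cst.
by apply: cvgB; [exact: cvg_cst|exact: norm_continuous].
Qed.

Lemma continuous_tensor (p q r : R -> R) : continuous p -> continuous q ->
  continuous r -> continuous (fun x : R3 R => p x.1.1 * q x.1.2 * r x.2).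
Proof.
move=> cp cq cr x.
have c1 : (fun x : R3 R => x.1.1) @ x --> x.1.1.
  by apply: (@cvg_comp _ _ _ fst fst); [exact: cvg_fst|exact: cvg_fst].
have c2 : (fun x : R3 R => x.1.2) @ x --> x.1.2.
  by apply: (@cvg_comp _ _ _ fst snd); [exact: cvg_fst|exact: cvg_snd].
have c3 : (fun x : R3 R => x.2) @ x --> x.2 by exact: cvg_snd.
apply: cvgM; first apply: cvgM.
- exact: (cvg_comp _ _ c1 (cp _)).
- exact: (cvg_comp _ _ c2 (cq _)).
- exact: (cvg_comp _ _ c3 (cr _)).
Qed.

Let cutoff_support k x : k%:R <= `|x| -> cutoff k x = 0.
Proof.
case: x => [[x y] z]; rewrite /Num.norm/= !le_max /cutoff/tent/= => /orP[/orP[]|] h.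
- by rewrite (max_idPl _) ?mul0r// subr_le0.
- by rewrite [X in _ * X * _](max_idPl _) ?mulr0 ?mul0r// subr_le0.
- by rewrite [X in _ * X](max_idPl _) ?mulr0// subr_le0.
Qed.

Let cutoff_Cc k : Cc (cutoff k).
Proof.
by split; [exact: continuous_tensor|exists k%:R => x; exact: cutoff_support].
Qed.

Lemma Cc_mull (f phi : R3 R -> R) : continuous f -> Cc phi -> Cc (fun x => f x * phi x).
Proof.
move=> cf [cphi [M hM]]; split; last by exists M => x /hM ->; rewrite mulr0.
by move=> x; apply: cvgM; [exact: cf|exact: cphi].
Qed.

(** Testing against continuous cutoffs of octants gives the integrals over
    octants by dominated convergence, and octants form a generating
    pi-system. *)
Lemma Cc_orthogonal_ae0 (h : R3 R -> R) : h \in Lfun leb 2%:E ->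
  (forall phi, Cc phi -> \int[leb]_x (h x * phi x) = 0) ->
  {ae leb, forall x, h x = 0}.
Proof.
move=> h2 h0.
have mh := Lfun2_measurable h2.
have hk k : {ae leb, forall x, h x * cutoff k x = 0}.
  have ki := L2_integrableM h2 (Cc_Lfun (cutoff_Cc k)).
  suff : {ae leb, forall x, (h x * cutoff k x)%:E = 0%E}.
    by apply: filterS => x [].
  apply: (integrable_ae0_pi_system (R3_measurable_octants R)) => //.
  - exact: octantsI.
  - exact: octantsT.
  move=> _ [A [B [C [hA hB hC ->]]]].
  have [p [cp p01 pl]] := ray_or_line_approx hA.
  have [q [cq q01 ql]] := ray_or_line_approx hB.
  have [r [cr r01 rl]] := ray_or_line_approx hC.
  pose g n (x : R3 R) := p n x.1.1 * q n x.1.2 * r n x.2.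
  have cg n : continuous (g n) by exact: continuous_tensor.
  have gphi n := Cc_mull (cg n) (cutoff_Cc k).
  have X01 (x : R3 R) : (\1_A x.1.1 * \1_B x.1.2 * \1_C x.2 : R) =
      \1_((A `*` B) `*` C) x.
    rewrite !indicE -!natrM !mulnb; congr (_%:R); congr nat_of_bool.
    apply/idP/idP => [/andP[/andP[/set_mem Ax /set_mem Bx] /set_mem Cx]|].
      exact/mem_set.
    by move=> /set_mem[[Ax Bx] Cx]; rewrite !mem_set.
  rewrite integral_mkcond.
  have lim := @dominated_cvg _ _ _ leb setT measurableT
    (fun n x => (h x * (g n x * cutoff k x))%:E)
    (fun x => (h x * (\1_((A `*` B) `*` C) x * cutoff k x))%:E)
    (fun x => `|(h x * cutoff k x)%:E|%E).
  have mhk : measurable_fun setT (fun x => h x * cutoff k x).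
    by apply: measurable_funM => //; exact: Lfun2_measurable (Cc_Lfun (cutoff_Cc k)).
  have : (\int[leb]_x (h x * (g n x * cutoff k x))%:E @[n --> \oo] -->
      \int[leb]_x (h x * (\1_((A `*` B) `*` C) x * cutoff k x))%:E)%E.
    apply: lim.
    - move=> n; apply/measurable_EFinP; apply: measurable_funM => //.
      exact: Lfun2_measurable (Cc_Lfun (gphi n)).
    - move=> x _; apply: cvg_EFin; first exact: nearW.
      apply: cvgMr; apply: cvgMl; rewrite -X01.
      by apply: cvgM; first exact: cvgM.
    - by move=> x _.
    - exact: integrable_abse.
    - move=> n x _; rewrite /= lee_fin !normrM ler_wpM2l//.
      rewrite ler_piMl//.
      have /andP[p0 p1] := p01 n x.1.1; have /andP[q0 q1] := q01 n x.1.2.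
      have /andP[r0 r1] := r01 n x.2.
      by rewrite !ger0_norm// mulr_ile1 ?mulr_ge0// mulr_ile1.
  have -> : (fun n => \int[leb]_x (h x * (g n x * cutoff k x))%:E)%E = cst 0%E.
    apply/funext => n; rewrite -[LHS]fineK; last first.
      by apply: integrable_fin_num => //; exact: L2_integrableM (Cc_Lfun (gphi n)).
    by congr EFin; exact: h0 (gphi n).
  move/(cvg_unique _ (@cvg_cst _ _ _ _ _)) => H; rewrite [RHS]H//.
  apply: eq_integral => x _; rewrite patchE indicE.
  by case: ifPn => _; rewrite ?mul1r ?mul0r ?mulr0.
have {hk} : {ae leb, forall x, forall k, h x * cutoff k x = 0} by exact: ae_foralln.
apply: filterS => x hx; have := hx (Num.truncn `|x|).+1.
move/eqP; rewrite mulf_eq0 => /orP[/eqP//|].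
have := truncnS_gt `|x|; set k := (Num.truncn _).+1 => kx.
suff : 0 < cutoff k x by move=> /gt_eqF ->.
move: kx; clearbody k; case: x {hx} => [[x y] z].
rewrite /Num.norm/= !gt_max => /andP[/andP[hx hy] hz].
by rewrite /cutoff !mulr_gt0// /tent/= lt_max subr_gt0 ?hx ?hy ?hz orbT.
Qed.

End Cc_dense.

(** * Limits of bounded families of operators on L2 *)

Section L2_algebra.
Context d (T : measurableType d) (R : realType).
Variable mu : {measure set T -> \bar R}.
Local Notation L2 := (@L2 _ T R mu).

Definition L2dotDl := dotDl (@L2_dot_lin _ _ R mu).
Definition L2dotZl := dotZl (@L2_dot_lin _ _ R mu).
Definition L2dotNl := dotNl (@L2_dot_lin _ _ R mu).
Definition L2dotBl := dotBl (@L2_dot_lin _ _ R mu).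
Definition L2dotDr := dotDr (@L2_dotC _ _ R mu) (@L2_dot_lin _ _ R mu).
Definition L2dotZr := dotZr (@L2_dotC _ _ R mu) (@L2_dot_lin _ _ R mu).
Definition L2dotNr := dotNr (@L2_dotC _ _ R mu) (@L2_dot_lin _ _ R mu).
Definition L2dot0l := dot0l (@L2_dot_lin _ _ R mu).
Definition L2_CauchySchwarz :=
  dot_CauchySchwarz (@L2_dotC _ _ R mu) (@L2_dot_lin _ _ R mu) (@L2_dot_ge0 _ _ R mu).

Lemma L2_sqr_triangle (u v : L2) :
  L2_dot (u + v) (u + v) <= 2 * L2_dot u u + 2 * L2_dot v v.
Proof.
have := L2_dot_ge0 (u - v).
by rewrite !(L2dotDl, L2dotDr, L2dotNl, L2dotNr) (L2_dotC v u); lra.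
Qed.

End L2_algebra.

Section density_principle.
Variable R : realType.
Local Notation leb := (@lebesgue3 R).
Local Notation L2 := (@L2 _ (R3 R) R leb).

(** The vectors on which [S] tends to zero form a closed subspace; since it
    contains the continuous functions with compact support, whose orthogonal
    complement is zero, projecting on it shows that it is everything. *)
Lemma L2_cvg0_dense (I : Type) (F : set_system I) (FF : ProperFilter F)
    (S : I -> L2 -> L2) (C : R) :
  (forall i a u v, S i (a *: u + v) = a *: S i u + S i v) -> 0 <= C ->
  (forall i u, L2_dot (S i u) (S i u) <= C * L2_dot u u) ->
  (forall phi (hphi : Cc phi), L2_dot (S i (L2_mk (Cc_Lfun hphi)))
     (S i (L2_mk (Cc_Lfun hphi))) @[i --> F] --> (0 : R)) ->
  forall u, L2_dot (S i u) (S i u) @[i --> F] --> (0 : R).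
Proof.
move=> Slin C0 SC SCc u0.
pose Z u := L2_dot (S i u) (S i u) @[i --> F] --> (0 : R).
have S0 i : S i 0 = 0 by have := SC i 0; rewrite L2dot0l mulr0 => h; apply: L2_dot_eq0;
  apply/eqP; rewrite eq_le h L2_dot_ge0.
have Zle (u : L2) (f : I -> R) : f @ F --> (0 : R) ->
    (forall i, L2_dot (S i u) (S i u) <= f i) -> Z u.
  move=> f0 uf; apply: (@squeeze_cvgr _ _ _ _ (fun=> 0) f) => //.
    by apply: nearW => i; rewrite L2_dot_ge0 uf.
  exact: cvg_cst.
have Z0 : Z 0.
  by apply: (Zle _ (fun=> 0)) => [|i]; [exact: cvg_cst|rewrite S0 L2dot0l].
have Zlin a u v : Z u -> Z v -> Z (a *: u + v).
  move=> Zu Zv; apply: (Zle _ (fun i => 2 * a ^+ 2 * L2_dot (S i u) (S i u) +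
      2 * L2_dot (S i v) (S i v))) => [|i].
    have -> : 0 = 2 * a ^+ 2 * 0 + 2 * 0 :> R by rewrite !mulr0 addr0.
    by apply: cvgD; exact: cvgMr.
  rewrite Slin; apply: le_trans (L2_sqr_triangle _ _) _.
  by rewrite L2dotZl L2dotZr; lra.
have Zc (u : nat -> L2) : (forall n, Z (u n)) ->
    (forall n, L2_dot (u n.+1 - u n) (u n.+1 - u n) <= 16^-1 ^+ n) ->
    exists2 l, Z l & L2_dot (u n - l) (u n - l) @[n --> \oo] --> (0 : R).
  move=> Zu /L2_fast_cauchy_cvg[l [_ ul]]; exists l => //.
  apply/cvgrPdist_lt => e e0.
  have C1 : 0 < 4 * (C + 1) by lra.
  move/cvgrPdist_lt : ul => /(_ (e / (4 * (C + 1)))).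
  rewrite divr_gt0// => /(_ isT)[N _ /(_ N (leqnn N))] /=.
  rewrite sub0r normrN ger0_norm ?L2_dot_ge0// ltr_pdivlMr// => uN.
  have /cvgrPdist_lt/(_ (e / 4)) := Zu N.
  rewrite divr_gt0// => /(_ isT); apply: filterS => i.
  rewrite !sub0r !normrN !ger0_norm ?L2_dot_ge0// => Si.
  have -> : l = (-1) *: (u N - l) + u N by rewrite scaleN1r opprB subrK.
  rewrite Slin; apply: le_lt_trans (L2_sqr_triangle _ _) _.
  rewrite L2dotZl L2dotZr.
  by have := SC i (u N - l); have := L2_dot_ge0 (u N - l); nra.
have [|||g Zg gP] := @Riesz_representation R L2 _ (@L2_dotC _ _ R leb)
  (@L2_dot_lin _ _ R leb) (@L2_dot_ge0 _ _ R leb) Z Z0 Zlin Zc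
  (L2_dot u0) (L2_dot u0 u0) => //.
- by move=> a u v _ _; rewrite L2dotDr L2dotZr.
- exact: L2_dot_ge0.
- by move=> v _; exact: L2_CauchySchwarz.
suff : u0 - g = 0 by move/eqP; rewrite subr_eq0 => /eqP ->.
have : {ae leb, forall x, (u0 - g) x = 0}.
  apply: Cc_orthogonal_ae0; first exact: L2_Lfun.
  move=> phi hphi; rewrite -(L2_dot_mk _ (Cc_Lfun hphi)) L2dotBl gP ?subrr//.
  exact: SCc.
move=> h; apply: L2_ext; apply: filter_app (L20 leb).
by apply: filterS h => x h1 h2; rewrite h2; exact: h1.
Qed.

(** Dominated convergence, the dominating function being a multiple of the
    indicator of a ball. *)
Lemma Cc_dominated_cvg0 (psi : nat -> R3 R -> R) (K M : R) :
  (forall n, measurable_fun setT (psi n)) ->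
  (forall n x, `|psi n x| <= K) -> (forall n x, M <= `|x| -> psi n x = 0) ->
  (forall x, psi n x @[n --> \oo] --> (0 : R)) ->
  (\int[leb]_x (psi n x ^+ 2)%:E @[n --> \oo] --> 0)%E.
Proof.
move=> mpsi psiK psiM psi0.
pose B : set (R3 R) := ball (0 : R3 R) (`|M| + 1).
have mB : measurable B by exact: R3_ball_measurable.
have := @dominated_cvg _ _ _ leb setT measurableT
  (fun n x => (psi n x ^+ 2)%:E) (cst 0%E) (fun x => (K ^+ 2 * \1_B x)%:E).
rewrite integral0; apply.
- by move=> n; apply/measurable_EFinP; exact: measurable_funX.
- move=> x _; rewrite -[0%E]/((0 : R)%:E); apply: cvg_EFin; first exact: nearW.
  rewrite -[X in _ --> X](mulr0 0); under eq_fun do rewrite expr2.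
  exact: cvgM.
- by [].
- have iB : leb.-integrable setT (fun x => (\1_B x)%:E).
    apply/integrableP; split; first exact/measurable_EFinP.
    under eq_integral => x _ do rewrite /= ger0_norm//.
    by rewrite integral_indic// setIT; exact: R3_ball_finite.
  exact: (integrableZl measurableT (K ^+ 2) iB).
- move=> n x _ /=; rewrite lee_fin normrX indicE.
  have K0 : 0 <= K by apply: le_trans (psiK 0%N 0).
  have [xB|] := boolP (x \in B).
    by rewrite mulr1 ler_pXn2r// nnegrE.
  rewrite notin_setE /B -ball_normE/= sub0r normrN => /negP; rewrite -leNgt => xM.
  rewrite psiM ?normr0 ?expr0n/= ?mulr0//.
  by apply: le_trans xM; apply: le_trans (ler_norm M) _; rewrite lerDl.
Qed.

End density_principle.

(** Reduces a limit over the reals to sequences, for which dominated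
    convergence is available. *)
Lemma cvg_at_seq (R : realType) (f : R -> R) (p l : R) :
  (forall u : nat -> R, u n @[n --> \oo] --> p -> f (u n) @[n --> \oo] --> l) ->
  f x @[x --> p] --> l.
Proof.
move=> fu; apply/cvgrPdist_lt => e e0; apply: contrapT => nf.
have /choice[u uP] n : exists x, `|p - x| < n.+1%:R^-1 /\ e <= `|l - f x|.
  apply: contrapT => /forallNP h; apply: nf.
  exists n.+1%:R^-1; first by rewrite /= invr_gt0.
  move=> x /= px; rewrite real_ltNge ?num_real//; apply/negP => le.
  by apply: (h x); split.
have up : u n @[n --> \oo] --> p.
  apply/cvgrPdist_lt => d d0; exists (Num.truncn d^-1) => // n /= dn.
  have [h _] := uP n; apply: lt_trans h _.
  rewrite invf_plt ?posrE//; apply: lt_le_trans (truncnS_gt _) _.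
  by rewrite ler_nat ltnS.
have /cvgrPdist_lt/(_ e e0)[N _ /(_ N (leqnn N))/=] := fu u up.
by have [_ h] := uP N; rewrite real_ltNge ?num_real// h.
Qed.

(** * Mass preserving dilations of L2 *)

Section L2_dilation.
Variable R : realType.
Local Notation leb := (@lebesgue3 R).
Local Notation L2 := (@L2 _ (R3 R) R leb).

(** The factor [l ^ (3/2)] makes this an isometry of [L^2] for [l > 0]; the
    square root vanishes for [l <= 0], which makes the family total. *)
Definition dil_fun (l : R) (f : R3 R -> R) (x : R3 R) : R :=
  Num.sqrt (l ^+ 3) * f (l *: x).

Lemma dil_fun_le0 l f : l <= 0 -> dil_fun l f = fun=> 0.
Proof.
move=> l0; apply/funext => x; rewrite /dil_fun ler0_sqrtr ?mul0r//.
by rewrite exprS mulr_le0_ge0// sqr_ge0.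
Qed.

Lemma measurable_dil_fun l f : 0 < l -> measurable_fun setT f ->
  measurable_fun setT (dil_fun l f).
Proof.
move=> l0 mf; have [ml _] := lebesgue3_scales l0.
by apply: measurable_funM => //; exact: (measurableT_comp mf ml).
Qed.

Lemma dil_Lfun l f : f \in Lfun leb 2%:E -> dil_fun l f \in Lfun leb 2%:E.
Proof.
move=> f2; have [l0|l0] := leP l 0; first by rewrite dil_fun_le0//; exact: Lfun2_0.
have /Lfun2P[mf f2i] := f2.
apply/Lfun2P; split; first exact: measurable_dil_fun.
have l30 : 0 < l ^+ 3 by rewrite exprn_gt0.
have := integrableZl measurableT (l ^+ 3) (integrable_scales l30 (lebesgue3_scales l0) f2i).
by apply: eq_integrable => // x _; rewrite /= /dil_fun exprMn sqr_sqrtr ?(ltW l30)// EFinM.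
Qed.

Definition L2_dil l (u : L2) : L2 := L2_mk (dil_Lfun l (L2_Lfun u)).

Lemma L2_dilE l u : {ae leb, forall x, L2_dil l u x = dil_fun l u x}.
Proof. exact: L2_mkE. Qed.

Lemma L2_dil_le0 l u : l <= 0 -> L2_dil l u = 0.
Proof.
move=> l0; apply: L2_ext; apply: filter_app (L2_dilE l u); apply: filter_app (L20 leb).
by apply: filterE => x -> ->; rewrite dil_fun_le0.
Qed.

Lemma L2_dil_ae l (u : L2) f : 0 < l -> {ae leb, forall x, u x = f x} ->
  {ae leb, forall x, L2_dil l u x = dil_fun l f x}.
Proof.
move=> l0 uf; have l30 : 0 < l ^+ 3 by rewrite exprn_gt0.
apply: filter_app (L2_dilE l u).
apply: filterS (ae_scales l30 (lebesgue3_scales l0) uf) => x h ->.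
by rewrite /dil_fun h.
Qed.

Lemma L2_dil_lin l a u v : L2_dil l (a *: u + v) = a *: L2_dil l u + L2_dil l v.
Proof.
have [l0|l0] := leP l 0; first by rewrite !L2_dil_le0// scaler0 addr0.
have h : {ae leb, forall x, (a *: u + v : L2) x = a * u x + v x}.
  by apply: filter_app (L2D (a *: u) v); apply: filterS (L2Z a u) => x -> ->.
apply: L2_ext; apply: filter_app (L2_dil_ae l0 h).
apply: filter_app (L2D (a *: L2_dil l u) (L2_dil l v)).
apply: filter_app (L2Z a (L2_dil l u)); apply: filter_app (L2_dilE l u).
by apply: filterS (L2_dilE l v) => x h1 h2 -> -> ->; rewrite h1 h2 /dil_fun mulrDr mulrCA.
Qed.

Lemma L2_dot_dil l u v : 0 < l -> L2_dot (L2_dil l u) (L2_dil l v) = L2_dot u v.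
Proof.
move=> l0; have l30 : 0 < l ^+ 3 by rewrite exprn_gt0.
rewrite (L2_dotE _ _ (L2_dilE l u) (L2_dilE l v)); last 2 first.
- by apply: measurable_dil_fun => //; exact: L2_measurable.
- by apply: measurable_dil_fun => //; exact: L2_measurable.
have uv := L2_integrableM (L2_Lfun u) (L2_Lfun v).
rewrite /L2_dot [RHS](Rintegral_scales l30 (lebesgue3_scales l0))//.
rewrite -RintegralZl//; last exact: (integrable_scales l30 (lebesgue3_scales l0) uv).
apply: eq_Rintegral => x _; rewrite /dil_fun.
by rewrite -[in RHS](sqr_sqrtr (ltW l30)); ring.
Qed.

Lemma L2_dil_bound l u : L2_dot (L2_dil l u) (L2_dil l u) <= L2_dot u u.
Proof.
have [l0|l0] := leP l 0; last by rewrite L2_dot_dil.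
by rewrite L2_dil_le0// L2dot0l L2_dot_ge0.
Qed.

Lemma L2_dil1 u : L2_dil 1 u = u.
Proof.
apply: L2_ext; apply: filterS (L2_dilE 1 u) => x ->.
by rewrite /dil_fun expr1n sqrtr1 mul1r scale1r.
Qed.

(** For continuous functions with compact support this is dominated convergence;
    the general case follows by density, as the dilations are contractions. *)
Lemma L2_dil_continuous (l0 : R) u : 0 < l0 ->
  L2_dot (L2_dil l u - L2_dil l0 u) (L2_dil l u - L2_dil l0 u) @[l --> l0] --> (0 : R).
Proof.
move=> l0_gt0; move: u; apply: (@L2_cvg0_dense _ _ (nbhs l0) _ (fun l u => L2_dil l u - L2_dil l0 u) 4) => //.
- by move=> l a u v; rewrite !L2_dil_lin scalerBr opprD addrACA.
- move=> l u; apply: le_trans (L2_sqr_triangle _ _) _.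
  rewrite L2dotNl L2dotNr opprK.
  by have := L2_dil_bound l u; have := L2_dil_bound l0 u; lra.
move=> phi hphi; have [cphi [M hM]] := hphi.
apply: cvg_at_seq => u ul0.
have mphi : measurable_fun setT phi by exact: R3_continuous_measurable.
have [N [_ /(_ (`|N| + 1)) hN]] := compact_bounded (continuous_compact
  (continuous_subspaceT cphi) (@R3_closed_ball_compact R M)).
have {}hN x : `|phi x| <= `|N| + 1.
  have [xM|/ltW xM] := leP `|x| M; last by rewrite hM// normr0 addr_ge0.
  by apply: hN; [rewrite ltr_pwDr// ler_norm|exists x].
have [n0 _ hn0] : \forall n \near \oo, `|l0 - u n| < l0 / 2.
  by move/cvgrPdist_lt : ul0; apply; rewrite divr_gt0.
pose v n := u (n + n0)%N.
have vl n : l0 / 2 <= v n <= 2 * l0.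
  have := hn0 (n + n0)%N (leq_addl _ _); rewrite ltr_distl => /andP[h1 h2].
  by rewrite /v; apply/andP; split; lra.
have vl0 : v n @[n --> \oo] --> l0 by move: ul0; rewrite -(cvg_shiftn n0).
suff H : L2_dot (L2_dil (v n) (L2_mk (Cc_Lfun hphi)) - L2_dil l0 (L2_mk (Cc_Lfun hphi)))
    (L2_dil (v n) (L2_mk (Cc_Lfun hphi)) - L2_dil l0 (L2_mk (Cc_Lfun hphi)))
    @[n --> \oo] --> (0 : R) by rewrite -(cvg_shiftn n0); exact: H.
have v0 n : 0 < v n by have /andP[? _] := vl n; apply: lt_le_trans; last eassumption; rewrite divr_gt0.
pose psi n x := dil_fun (v n) phi x - dil_fun l0 phi x.
have mpsi n : measurable_fun setT (psi n).
  by apply: measurable_funB; exact: measurable_dil_fun.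
have psiE n : {ae leb, forall x, (L2_dil (v n) (L2_mk (Cc_Lfun hphi)) -
    L2_dil l0 (L2_mk (Cc_Lfun hphi)) : L2) x = psi n x}.
  apply: filter_app (L2B (L2_dil (v n) (L2_mk (Cc_Lfun hphi))) (L2_dil l0 (L2_mk (Cc_Lfun hphi)))).
  apply: filter_app (L2_dil_ae (v0 n) (L2_mkE (Cc_Lfun hphi))).
  apply: filterS (L2_dil_ae l0_gt0 (L2_mkE (Cc_Lfun hphi))) => x h1 h2 ->.
  by rewrite h1 h2.
have : (\int[leb]_x (psi n x ^+ 2)%:E @[n --> \oo] --> 0)%E.
  apply: (@Cc_dominated_cvg0 _ _ (2 * Num.sqrt ((2 * l0) ^+ 3) * (`|N| + 1))
    (2 * `|M| / l0)) => //.
  - have dK l x : 0 < l <= 2 * l0 ->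
        `|dil_fun l phi x| <= Num.sqrt ((2 * l0) ^+ 3) * (`|N| + 1).
      move=> /andP[l1 l2]; rewrite /dil_fun normrM ler_pM//.
      rewrite ger0_norm ?sqrtr_ge0// ler_sqrt ?exprn_ge0 ?mulr_ge0 ?(ltW l0_gt0)//.
      by rewrite ler_pXn2r// nnegrE; lra.
    move=> n x; apply: le_trans (ler_normB _ _) _.
    rewrite -mulrA mulr_natl mulr2n lerD ?dK//.
      by rewrite v0; have /andP[_ ->] := vl n.
    by rewrite l0_gt0/=; lra.
  - move=> n x xM.
    have Mx l : l0 / 2 <= l -> M <= `|l *: x|.
      move=> ll; rewrite normrZ; apply: le_trans (ler_norm M) _.
      have l_ge0 : 0 <= l by apply: le_trans ll; rewrite divr_ge0// ltW.
      rewrite (ger0_norm l_ge0).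
      have : l0 / 2 * (2 * `|M| / l0) <= l * `|x|.
        apply: ler_pM => //; first by rewrite divr_ge0// ltW.
        by rewrite divr_ge0 ?mulr_ge0// ltW.
      by have -> : l0 / 2 * (2 * `|M| / l0) = `|M| by field; rewrite gt_eqF.
    rewrite /psi /dil_fun !hM ?mulr0 ?subrr//; apply: Mx; first lra.
    by have /andP[] := vl n.
  - move=> x; rewrite -(subrr (dil_fun l0 phi x)); apply: cvgB; last exact: cvg_cst.
    apply: cvgM.
      apply: continuous_cvg; first exact: sqrt_continuous.
      have : v n * (v n * v n) @[n --> \oo] --> l0 * (l0 * l0).
        by apply: cvgM => //; exact: cvgM.
      have -> : (fun n => v n ^+ 3) = (fun n => v n * (v n * v n)).
        by apply/funext => n; rewrite !exprS expr0 mulr1.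
      by rewrite !exprS expr0 mulr1.
    apply: continuous_cvg; first exact: cphi.
    by apply: cvgZr_tmp.
under eq_fun do rewrite (L2_dot_sqr (mpsi _) (psiE _)).
by move/fine_cvg.
Qed.

End L2_dilation.

(** * Smooth cutoffs on the line *)

Section smooth.
Variable R : realType.
Implicit Types f g : R -> R.

Fixpoint smooth_upto (k : nat) (f : R -> R) : Prop :=
  if k is k'.+1 then
    exists f' : R -> R, (forall x : R, is_derive x 1 f (f' x)) /\ smooth_upto k' f'
  else continuous f.

Definition smooth f := forall k, smooth_upto k f.

Lemma is_derive_cast f (x d d' : R) : is_derive x 1 f d -> d = d' -> is_derive x 1 f d'.
Proof. by move=> h <-. Qed.

Lemma is_derive_continuous f (f' : R -> R) : (forall x : R, is_derive x 1 f (f' x)) -> continuous f.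
Proof.
by move=> ff' x; apply/differentiable_continuous/derivable1_diffP; case: (ff' x).
Qed.

Lemma smooth_uptoW k f : smooth_upto k.+1 f -> smooth_upto k f.
Proof.
elim: k f => [|k IH] f [f' [ff' sf']]; first exact: is_derive_continuous ff'.
by exists f'; split => //; exact: IH.
Qed.

Lemma smooth_continuous f : smooth f -> continuous f.
Proof. by move/(_ 0%N). Qed.

Lemma smooth_is_derive f (x : R) : smooth f -> is_derive x 1 f (derive1 f x).
Proof.
by move=> /(_ 1%N)[f' [/(_ x) [dfx _] _]]; apply: DeriveDef => //; rewrite derive1E.
Qed.

Lemma smooth_derive1 f : smooth f -> smooth (derive1 f).
Proof.
move=> sf k; have [f' [ff' sf']] := sf k.+1.
suff -> : (derive1 f) = f' by [].
by apply/funext => x; rewrite derive1E; case: (ff' x).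
Qed.

Lemma smooth_upto_cst k c : smooth_upto k (fun=> c).
Proof.
elim: k c => [|k IH] c; first by move=> x; exact: cst_continuous.
by exists (fun=> 0); split => // x; exact: is_derive_cst.
Qed.

Lemma smooth_uptoD k f g : smooth_upto k f -> smooth_upto k g ->
  smooth_upto k (fun x => f x + g x).
Proof.
elim: k f g => [|k IH] f g; first by move=> cf cg x; apply: cvgD; [exact: cf|exact: cg].
move=> [f' [ff' sf']] [g' [gg' sg']]; exists (fun x => f' x + g' x).
by split => [x|]; [exact: is_deriveD|exact: IH].
Qed.

Lemma smooth_uptoM k f g : smooth_upto k f -> smooth_upto k g ->
  smooth_upto k (fun x => f x * g x).
Proof.
elim: k f g => [|k IH] f g; first by move=> cf cg x; apply: cvgM; [exact: cf|exact: cg].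
move=> sf sg; have [f' [ff' sf']] := sf; have [g' [gg' sg']] := sg.
exists (fun x => f x * g' x + g x * f' x); split => [x|].
  have -> : f x * g' x + g x * f' x = f x *: g' x + g x *: f' x by [].
  exact: is_deriveM.
by apply: smooth_uptoD; apply: IH => //; exact: smooth_uptoW.
Qed.

Lemma smooth_uptoV k f : (forall x, f x != 0) -> smooth_upto k f ->
  smooth_upto k (fun x => (f x)^-1).
Proof.
move=> f0; elim: k => [|k IH]; first by move=> cf x; apply: cvgV; [exact: f0|exact: cf].
move=> sf; have [f' [ff' sf']] := sf; have IHf := IH (smooth_uptoW sf).
exists (fun x => -1 * ((f x)^-1 * (f x)^-1) * f' x); split => [x|].
  apply: is_derive_cast (is_deriveV (f0 x) (ff' x)) _.
  by rewrite /GRing.scale/= mulN1r expr2 invfM.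
apply: smooth_uptoM => //; apply: smooth_uptoM; first exact: smooth_upto_cst.
exact: smooth_uptoM.
Qed.

Lemma is_derive_affine (a b x : R) : is_derive x 1 (fun x : R => a * x + b : R) a.
Proof.
have h : is_derive x 1 ((a \*: (id : R -> R^o)) + cst b) (a *: 1 + 0) by exact: is_deriveD.
by apply: is_derive_cast h _; rewrite /GRing.scale/= mulr1 addr0.
Qed.

Lemma smooth_upto_affine k f (a b : R) : smooth_upto k f ->
  smooth_upto k (fun x => f (a * x + b)).
Proof.
elim: k f => [|k IH] f /=.
  move=> cf x; apply: continuous_comp; last exact: cf.
  exact: is_derive_continuous (is_derive_affine a b) x.
move=> [f' [ff' sf']]; exists (fun x => a * f' (a * x + b)); split => [x|].
  rewrite mulrC.
  exact: (@is_derive1_comp _ f (fun x => a * x + b) x _ _ (ff' (a * x + b))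
    (is_derive_affine a b x)).
by apply: smooth_uptoM; [exact: smooth_upto_cst|exact: IH].
Qed.

(** [x ^- n * exp (- 1 / x)] on the positive half-line, extended by zero: the
    family is stable by differentiation. *)
Definition flat (n : nat) (x : R) : R :=
  if 0 < x then x ^- n * expR (- x^-1) else 0.

Lemma flat_bound n (x : R) : 0 < x -> x ^- n * expR (- x^-1) <= n.+1`!%:R * x.
Proof.
move=> x0; have xV0 : 0 < x^-1 by rewrite invr_gt0.
have N0 : 0 < n.+1`!%:R :> R by rewrite ltr0n fact_gt0.
rewrite -exprVn expRN ler_pdivrMr ?expR_gt0// -ler_pdivrMl ?mulr_gt0//.
have := expR_ge1Dxn n (ltW xV0); apply: le_trans.
by rewrite invfM -mulrA -exprS mulrC -[leLHS]add0r lerD2r ler01.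
Qed.

(** At the origin the difference quotient is controlled by [flat_bound]. *)
Lemma is_derive_flat n (x : R) :
  is_derive x 1 (flat n) ((- n%:R) * flat n.+1 x + flat n.+2 x).
Proof.
have [x0|x0|->] := ltgtP x 0.
- have -> : - n%:R * flat n.+1 x + flat n.+2 x = 0.
    by rewrite /flat ltNge (ltW x0)/= mulr0 addr0.
  apply: (@near_eq_is_derive _ _ _ (cst (0 : R))).
  near=> y; rewrite /flat ltNge (_ : y <= 0)//=; near: y.
  by apply: filterS (lt_nbhsl x0) => y /ltW.
- have -> : - n%:R * flat n.+1 x + flat n.+2 x =
      x^-1 ^+ n *: (expR (- x^-1) * (- (- x ^- 2 *: 1))) +
      expR (- x^-1) *: ((n%:R * x^-1 ^+ n.-1) *: (- x ^- 2 *: 1)).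
    rewrite /flat x0 /GRing.scale/= !mulr1 opprK.
    have -> : n%:R * x^-1 ^+ n.-1 * - x ^- 2 = - n%:R * x ^- n.+1.
      case: n => [|n]; first by rewrite oppr0 !mul0r.
      by rewrite -!exprVn mulrN mulNr -mulrA -exprD addn2.
    by rewrite -!exprVn !exprSr; ring.
  apply: (@near_eq_is_derive _ _ _ ((fun y : R => y^-1) ^+ n *
      (expR \o (- (fun y : R => y^-1))))).
    near=> y; rewrite /flat (_ : 0 < y)//; last by near: y; exact: lt_nbhsr.
    by rewrite !fctE /= exprVn.
  have dV : is_derive x 1 (fun y : R => y^-1) (- x ^- 2 *: 1).
    exact: (@is_deriveV _ id x 1 1 (lt0r_neq0 x0) (is_derive_id x 1)).
  have dN := @is_deriveN _ _ _ _ _ _ _ dV.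
  have dE := @is_derive1_comp _ expR (- (fun y : R => y^-1)) x _ _ (is_derive_expR _) dN.
  have dX := @is_deriveX _ _ (fun y : R => y^-1) n _ _ _ dV.
  by have := @is_deriveM _ _ _ _ _ _ _ _ dX dE; rewrite !fctE.
- have -> : - n%:R * flat n.+1 0 + flat n.+2 0 = 0.
    by rewrite /flat ltxx mulr0 addr0.
  have h : h^-1 *: ((flat n \o shift 0) (h *: 1) - flat n 0) @[h --> 0^'] --> (0 : R).
    apply: (@squeeze_cvgr _ _ _ _ (fun=> 0) (fun h => n.+2`!%:R * `|h|)).
    - near=> h; rewrite /flat ltxx subr0 /= addr0 /GRing.scale/= mulr1.
      case: ifPn => [h0|_]; last by rewrite mulr0 lexx mulr_ge0.
      have -> : h^-1 * (h ^- n * expR (- h^-1)) = h ^- n.+1 * expR (- h^-1).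
        by rewrite mulrA exprS invfM.
      rewrite (ger0_norm (ltW h0)) flat_bound// andbT.
      by rewrite mulr_ge0 ?expR_ge0// invr_ge0 exprn_ge0// ltW.
    - exact: cvg_cst.
    - rewrite -[X in _ --> X](mulr0 n.+2`!%:R); apply: cvgMr.
      rewrite -[X in _ --> X](normr0 R); apply: cvg_within_filter.
      exact: norm_continuous.
  apply: DeriveDef; first by apply/cvg_ex; exists 0.
  exact: (cvg_lim _ h).
Unshelve. all: by end_near. Qed.

Lemma smooth_flat n : smooth (flat n).
Proof.
move=> k; elim: k n => [|k IH] n; first exact: is_derive_continuous (is_derive_flat n).
exists (fun x => - n%:R * flat n.+1 x + flat n.+2 x); split => [x|].
  exact: is_derive_flat.
by apply: smooth_uptoD => //; apply: smooth_uptoM => //; exact: smooth_upto_cst.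
Qed.

Lemma flat0_gt0 x : 0 < x -> 0 < flat 0 x.
Proof. by move=> x0; rewrite /flat x0 expr0 invr1 mul1r expR_gt0. Qed.

Lemma flat0_le0 x : x <= 0 -> flat 0 x = 0.
Proof. by rewrite /flat leNgt => /negbTE ->. Qed.

Lemma flat0_ge0 x : 0 <= flat 0 x.
Proof. by have [/flat0_le0 ->//|/flat0_gt0/ltW] := leP x 0. Qed.

(** A smooth transition from [0] on the left of [0] to [1] on the right of
    [1]. *)
Definition step (x : R) : R := flat 0 x * (flat 0 x + flat 0 (-1 * x + 1))^-1.

Let step_den x : flat 0 x + flat 0 (-1 * x + 1) != 0.
Proof.
rewrite gt_eqF//; have [x0|x0] := ltP 0 x.
  by rewrite ltr_pwDl// ?flat0_gt0 ?flat0_ge0.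
by rewrite ltr_wpDl ?flat0_ge0// flat0_gt0//; lra.
Qed.

Lemma smooth_step : smooth step.
Proof.
move=> k; apply: smooth_uptoM; first exact: smooth_flat.
apply: smooth_uptoV => //; apply: smooth_uptoD; first exact: smooth_flat.
by apply: smooth_upto_affine; exact: smooth_flat.
Qed.

Lemma step_le0 x : x <= 0 -> step x = 0.
Proof. by move=> x0; rewrite /step flat0_le0// mul0r. Qed.

Lemma step_ge1 x : 1 <= x -> step x = 1.
Proof.
move=> x1; have := step_den x; rewrite /step (@flat0_le0 (-1 * x + 1)); last lra.
by rewrite addr0 => h; rewrite divff.
Qed.

End smooth.

(** * Test functions of product form *)

Section tensor_test_functions.
Variable R : realType.

Definition tensor (p q r : R -> R) (x : R3 R) : R := p x.1.1 * q x.1.2 * r x.2.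

Definition bounded_support (p : R -> R) : Prop :=
  exists M, forall s, M <= `|s| -> p s = 0.

Lemma is_derive_tensor (i : 'I_3) (p q r p' q' r' : R -> R) (x : R3 R) :
  (forall s : R, is_derive s 1 p (p' s)) -> (forall s : R, is_derive s 1 q (q' s)) ->
  (forall s : R, is_derive s 1 r (r' s)) ->
  is_derive x (basis3 R i) (tensor p q r)
    (tensor (if i == 0%N :> nat then p' else p) (if i == 1%N :> nat then q' else q)
       (if i == 2%N :> nat then r' else r) x).
Proof.
move=> pp' qq' rr'.
have quot (f f' : R -> R) (s : R) : (forall s : R, is_derive s 1 f (f' s)) ->
    h^-1 * (f (h + s) - f s) @[h --> 0^'] --> f' s.
  move=> ff'; have [/cvg_ex[l fl] fE] := ff' s.
  have -> : f' s = l by rewrite -fE; apply: (cvg_lim _ fl).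
  apply: cvg_trans fl; apply: near_eq_cvg; apply: nearW => h.
  by rewrite /= /GRing.scale/= mulr1.
suff h : h^-1 *: ((tensor p q r \o shift x) (h *: basis3 R i) - tensor p q r x)
    @[h --> 0^'] --> tensor (if i == 0%N :> nat then p' else p)
      (if i == 1%N :> nat then q' else q) (if i == 2%N :> nat then r' else r) x.
  by apply: DeriveDef; [apply/cvg_ex; eexists; exact: h|exact: (cvg_lim _ h)].
case: i => [[|[|[|//]]] i3]; rewrite /tensor/=.
- have hq := quot p p' x.1.1 pp'.
  have H : h^-1 * (p (h + x.1.1) - p x.1.1) * q x.1.2 * r x.2 @[h --> 0^'] -->
      p' x.1.1 * q x.1.2 * r x.2 by do 2!apply: cvgMl.
  apply: cvg_trans H.
  apply: near_eq_cvg; apply: nearW => h.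
  by rewrite /= /GRing.scale/= !mulr1 !mulr0 !add0r; ring.
- have hq := quot q q' x.1.2 qq'.
  have H : p x.1.1 * (h^-1 * (q (h + x.1.2) - q x.1.2)) * r x.2 @[h --> 0^'] -->
      p x.1.1 * q' x.1.2 * r x.2 by apply: cvgMl; apply: cvgMr.
  apply: cvg_trans H.
  apply: near_eq_cvg; apply: nearW => h.
  by rewrite /= /GRing.scale/= !mulr1 !mulr0 !add0r; ring.
- have hq := quot r r' x.2 rr'.
  have H : p x.1.1 * q x.1.2 * (h^-1 * (r (h + x.2) - r x.2)) @[h --> 0^'] -->
      p x.1.1 * q x.1.2 * r' x.2 by apply: cvgMr.
  apply: cvg_trans H.
  apply: near_eq_cvg; apply: nearW => h.
  by rewrite /= /GRing.scale/= !mulr1 !mulr0 !add0r; ring.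
Qed.

Lemma Ck_tensor k p q r : smooth p -> smooth q -> smooth r -> Ck k (tensor p q r).
Proof.
elim: k p q r => [|k IH] p q r sp sq sr; first by split => //; apply: continuous_tensor; exact: smooth_continuous.
split; first by apply: continuous_tensor; exact: smooth_continuous.
move=> i; have d x := is_derive_tensor i x (fun s => smooth_is_derive s sp)
  (fun s => smooth_is_derive s sq) (fun s => smooth_is_derive s sr).
split => [x|]; first by case: (d x).
rewrite (_ : (fun x => 'D_(basis3 R i) _ x) = tensor
  (if i == 0%N :> nat then derive1 p else p) (if i == 1%N :> nat then derive1 q else q)
       (if i == 2%N :> nat then derive1 r else r)); last first.
  by apply/funext => x; case: (d x).
by apply: IH; case: ifP => _ //; exact: smooth_derive1.
Qed.

Lemma tensor_support p q r : bounded_support p -> bounded_support q ->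
  bounded_support r -> exists M, forall x, M <= `|x| -> tensor p q r x = 0.
Proof.
move=> [M1 h1] [M2 h2] [M3 h3]; exists (Num.max (Num.max M1 M2) M3) => -[[x y] z].
rewrite /Num.norm/= !le_max !ge_max /tensor/=.
move=> /orP[/orP[]|] /andP[/andP[k1 k2] k3].
- by rewrite h1// !mul0r.
- by rewrite h2// mulr0 mul0r.
- by rewrite h3// mulr0.
Qed.

Lemma test_function_tensor p q r : smooth p -> smooth q -> smooth r ->
  bounded_support p -> bounded_support q -> bounded_support r ->
  test_function (tensor p q r).
Proof.
move=> sp sq sr bp bq br; split => [k|]; first exact: Ck_tensor.
have [M hM] := tensor_support bp bq br.
apply: (subclosed_compact _ (@R3_closed_ball_compact R M)).
  exact: closed_closure.
apply: subset_trans (_ : closure [set x : R3 R | `|x| <= M] `<=` _).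
  apply: closure_subset => x /= /eqP px; rewrite leNgt; apply/negP => /ltW.
  by move/hM.
suff /closure_id <- : closed [set x : R3 R | `|x| <= M] by [].
exact: (compact_closed (@norm_hausdorff _ _) (@R3_closed_ball_compact R M)).
Qed.

End tensor_test_functions.

(** * Convolution with bounded kernels *)

Section convolution.
Variable R : realType.
Local Notation leb := (@lebesgue3 R).
Local Notation L2 := (@L2 _ (R3 R) R leb).

Definition conv (h K : R3 R -> R) (x : R3 R) : R := \int[leb]_y (h y * K (x - y)).

Definition bounded_kernel (K : R3 R -> R) (M r : R) : Prop :=
  [/\ measurable_fun setT K, 0 < r, forall z, `|K z| <= M &
      forall z, r <= `|z| -> K z = 0].

Lemma measurable_R3_sub :
  measurable_fun setT (fun z : R3 R * R3 R => z.1 - z.2).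
Proof.
have p1 : measurable_fun setT (fun z : R3 R * R3 R => z.1) by exact: measurable_fst.
have p2 : measurable_fun setT (fun z : R3 R * R3 R => z.2) by exact: measurable_snd.
have f12 : measurable_fun setT (fun z : R3 R => z.1).
  exact: (@measurable_fst _ _ (measurableTypeR R * measurableTypeR R)%type (measurableTypeR R)).
have f2 : measurable_fun setT (fun z : R3 R => z.2 : measurableTypeR R).
  exact: (@measurable_snd _ _ (measurableTypeR R * measurableTypeR R)%type (measurableTypeR R)).
have f11 : measurable_fun setT (fun z : R3 R => z.1.1 : measurableTypeR R).
  exact: measurableT_comp (@measurable_fst _ _ (measurableTypeR R) (measurableTypeR R)) f12.
have f1b : measurable_fun setT (fun z : R3 R => z.1.2 : measurableTypeR R).
  exact: measurableT_comp (@measurable_snd _ _ (measurableTypeR R) (measurableTypeR R)) f12.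
have sub (f : R3 R -> measurableTypeR R) : measurable_fun setT f ->
    measurable_fun setT (fun z : R3 R * R3 R => (f z.1 : R) - f z.2 : measurableTypeR R).
  move=> mf; apply: measurable_funB; first exact: measurableT_comp mf p1.
  exact: measurableT_comp mf p2.
exact: measurable_fun_pair (measurable_fun_pair (sub _ f11) (sub _ f1b)) (sub _ f2).
Qed.

Lemma measurable_kernel_fun (K : R3 R -> R) : measurable_fun setT K ->
  measurable_fun setT (fun z : R3 R * R3 R => K (z.1 - z.2)).
Proof. by move=> mK; exact: measurableT_comp mK measurable_R3_sub. Qed.

Lemma measurable_kernel_sec (K : R3 R -> R) (x : R3 R) : measurable_fun setT K ->
  measurable_fun setT (fun y : R3 R => K (x - y)).
Proof.
by move=> /measurable_kernel_fun mK; exact: (measurableT_comp mK (measurable_pair1 x)).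
Qed.

Lemma measurable_conv (h K : R3 R -> R) : measurable_fun setT h ->
  measurable_fun setT K -> measurable_fun setT (conv h K).
Proof.
move=> mh mK; pose f (z : R3 R * R3 R) : \bar R := (h z.2 * K (z.1 - z.2))%:E.
have mf : measurable_fun setT f.
  apply/measurable_EFinP; apply: measurable_funM; last exact: measurable_kernel_fun.
  exact: measurableT_comp mh measurable_snd.
have := @measurable_fun_fubini_tonelli_F _ _ (R3 R) (R3 R) R (lebesgue3_sf R) _
  (measurable_funepos mf) (funepos_ge0 f).
have := @measurable_fun_fubini_tonelli_F _ _ (R3 R) (R3 R) R (lebesgue3_sf R) _
  (measurable_funeneg mf) (funeneg_ge0 f).
rewrite /fubini_F => mn mp.
apply: (measurableT_comp (fine_measurable measurableT)).
have := emeasurable_funB mp mn; congr (measurable_fun _ _).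
apply/funext => x; rewrite [RHS]integralE; congr (_ - _)%E; apply: eq_integral => y _.
- by rewrite !funeposE.
- by rewrite !funenegE.
Qed.

Lemma R3_ball_normE (x y : R3 R) r : ball x r y = (`|x - y| < r) :> Prop.
Proof. by rewrite -ball_normE. Qed.

Lemma bounded_kernel_sqr K M r x : bounded_kernel K M r ->
  (\int[leb]_y (K (x - y) ^+ 2)%:E <= (M ^+ 2 * (2 * r) ^+ 3)%:E)%E.
Proof.
move=> [mK r0 KM Kr].
have M0 : 0 <= M by apply: le_trans (KM 0).
have mB : measurable (ball x r : set (R3 R)) by exact: R3_ball_measurable.
apply: (@le_trans _ _ (\int[leb]_y (M ^+ 2 * \1_(ball x r : set (R3 R)) y)%:E)%E).
  apply: ge0_le_integral => //.
  - by move=> y _; rewrite lee_fin sqr_ge0.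
  - by apply/measurable_EFinP; apply: measurable_funX; exact: measurable_kernel_sec.
  - by apply/measurable_EFinP; apply: measurable_funM.
  - move=> y _; rewrite lee_fin indicE; have [xy|] := boolP (_ \in _).
      by rewrite mulr1 -real_normK ?num_real// ler_pXn2r ?nnegrE.
    rewrite notin_setE R3_ball_normE => /negP; rewrite -leNgt => /Kr ->.
    by rewrite expr0n/= mulr0.
under eq_integral => y _ do rewrite EFinM.
rewrite ge0_integralZl//; last 2 first.
- by apply/measurable_EFinP.
- by rewrite lee_fin sqr_ge0.
rewrite integral_indic// setIT R3_ball_volume// -EFinM//.
Qed.

Lemma bounded_kernel_Lfun K M r x : bounded_kernel K M r ->
  (fun y : R3 R => K (x - y)) \in Lfun leb 2%:E.
Proof.
move=> bK; apply: Lfun2_dominated; first by case: bK => mK *; exact: measurable_kernel_sec.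
by apply: le_lt_trans (bounded_kernel_sqr x bK) _; rewrite ltry.
Qed.

(** This is the integral of [h ^ 2] over the ball of radius [r] around [x].
    Written with an indicator of the difference, it is jointly measurable and
    its integral in [x] is computed by exchanging the integrals. *)
Definition local_mass (h : R3 R -> R) (r : R) (x : R3 R) : \bar R :=
  (\int[leb]_y (h y ^+ 2 * \1_(ball (0 : R3 R) r : set (R3 R)) (x - y))%:E)%E.

Let mball r : measurable_fun setT (\1_(ball (0 : R3 R) r : set (R3 R)) : R3 R -> R).
Proof. by apply: measurable_indic; exact: R3_ball_measurable. Qed.

Lemma local_mass_ge0 h r x : (0 <= local_mass h r x)%E.
Proof. by apply: integral_ge0 => y _; rewrite lee_fin mulr_ge0// sqr_ge0. Qed.

Let mlocal_mass_fun (h : R3 R -> R) (r : R) : measurable_fun setT h -> measurable_fun setT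
  (fun z : R3 R * R3 R => (h z.2 ^+ 2 * \1_(ball (0 : R3 R) r : set (R3 R)) (z.1 - z.2))%:E).
Proof.
move=> mh; apply/measurable_EFinP; apply: measurable_funM.
  by apply: measurable_funX; exact: measurableT_comp mh measurable_snd.
exact: measurable_kernel_fun (mball r).
Qed.

Lemma measurable_local_mass (h : R3 R -> R) (r : R) : measurable_fun setT h ->
  measurable_fun setT (local_mass h r).
Proof.
move=> mh; apply: (@measurable_fun_fubini_tonelli_F _ _ (R3 R) (R3 R) R (lebesgue3_sf R) _
  (mlocal_mass_fun r mh)).
by move=> z; rewrite lee_fin mulr_ge0// sqr_ge0.
Qed.

Lemma integral_local_mass (h : R3 R -> R) (r : R) : measurable_fun setT h -> 0 < r ->
  (\int[leb]_x local_mass h r x = ((2 * r) ^+ 3)%:E * \int[leb]_y (h y ^+ 2)%:E)%E.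
Proof.
move=> mh r0.
have f0 (z : R3 R * R3 R) :
  (0 <= (h z.2 ^+ 2 * \1_(ball (0 : R3 R) r : set (R3 R)) (z.1 - z.2))%:E)%E.
  by rewrite lee_fin mulr_ge0// sqr_ge0.
transitivity (\int[leb]_y \int[leb]_x
    (h y ^+ 2 * \1_(ball (0 : R3 R) r : set (R3 R)) (x - y))%:E)%E.
  exact: (@fubini_tonelli _ _ (R3 R) (R3 R) R (lebesgue3_sf R) (lebesgue3_sf R) _
    (mlocal_mass_fun r mh) f0).
rewrite -ge0_integralZl//; last 3 first.
- by apply/measurable_EFinP; exact: measurable_funX.
- by move=> y _; rewrite lee_fin sqr_ge0.
- by rewrite lee_fin exprn_ge0// mulr_ge0// ltW.
apply: eq_integral => y _.
under eq_integral => x _ do rewrite EFinM.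
rewrite ge0_integralZl//; last 2 first.
- apply/measurable_EFinP.
  exact: (measurableT_comp (measurable_kernel_fun (mball r)) (measurable_pair2 y)).
- by rewrite lee_fin sqr_ge0.
rewrite muleC; congr (_ * _)%E.
transitivity (\int[leb]_x (\1_(ball y r : set (R3 R)) x)%:E)%E; last first.
  by rewrite integral_indic ?setIT ?R3_ball_volume//; exact: R3_ball_measurable.
apply: eq_integral => x _; rewrite !indicE; congr (_%:R)%:E; congr nat_of_bool.
by apply/idP/idP; rewrite !inE !R3_ball_normE sub0r opprB // distrC.
Qed.

Lemma conv_lin a (u v : L2) K M r : bounded_kernel K M r ->
  conv (a *: u + v : L2) K = (fun x => a * conv u K x + conv v K x).
Proof.
by move=> bK; apply/funext => x; exact: L2_int_lin (bounded_kernel_Lfun x bK).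
Qed.

Lemma conv_ext (u : L2) (f K : R3 R -> R) x : measurable_fun setT f ->
  measurable_fun setT K -> {ae leb, forall y, u y = f y} -> conv u K x = conv f K x.
Proof.
move=> mf mK uf; apply: ae_eq_Rintegral.
- by apply: measurable_funM; [exact: L2_measurable|exact: measurable_kernel_sec].
- by apply: measurable_funM => //; exact: measurable_kernel_sec.
- by apply: filterS uf => y ->.
Qed.

(** Cauchy-Schwarz on the ball that supports the kernel. *)
Lemma conv_sqr_le (h K : R3 R -> R) M r x : h \in Lfun leb 2%:E -> bounded_kernel K M r ->
  ((conv h K x ^+ 2)%:E <= (M ^+ 2 * (2 * r) ^+ 3)%:E * local_mass h r x)%E.
Proof.
move=> h2 bK; have [mK r0 KM Kr] := bK.
have mh := Lfun2_measurable h2.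
pose hB y := h y * \1_(ball (0 : R3 R) r : set (R3 R)) (x - y).
have mhB : measurable_fun setT hB.
  by apply: measurable_funM => //; exact: measurable_kernel_sec (mball r).
have hBE : local_mass h r x = (\int[leb]_y (hB y ^+ 2)%:E)%E.
  apply: eq_integral => y _; rewrite /hB exprMn indicE.
  by case: (_ \in _); rewrite ?mulr1 ?mulr0 ?expr1n ?expr0n/= ?mulr1 ?mulr0.
have hB2 : hB \in Lfun leb 2%:E.
  apply: Lfun2_dominated => //.
  apply: le_lt_trans (_ : _ <= \int[leb]_y (h y ^+ 2)%:E)%E _.
    apply: ge0_le_integral => //.
    - by move=> y _; rewrite lee_fin sqr_ge0.
    - by apply/measurable_EFinP; exact: measurable_funX.
    - by apply/measurable_EFinP; exact: measurable_funX.
    - move=> y _; rewrite lee_fin /hB indicE.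
      by case: (_ \in _); rewrite ?mulr1// mulr0 expr0n/= sqr_ge0.
  have /Lfun2P[_ /integrableP[_]] := h2; apply: le_lt_trans.
  by apply: ge0_le_integral => //; [move=> y _; rewrite lee_fin sqr_ge0|apply/measurable_EFinP; exact: measurable_funX|apply/measurable_EFinP; apply: measurableT_comp => //; exact: measurable_funX|move=> y _; rewrite lee_fin ler_norm].
have K2 := bounded_kernel_Lfun x bK.
have -> : conv h K x = L2_dot (L2_mk hB2) (L2_mk K2).
  rewrite (L2_dotE mhB _ (L2_mkE hB2) (L2_mkE K2)); last exact: measurable_kernel_sec.
  apply: eq_Rintegral => y _; rewrite /hB indicE.
  have [|] := boolP (_ \in _); first by rewrite mulr1.
  rewrite notin_setE R3_ball_normE sub0r normrN => /negP; rewrite -leNgt => /Kr ->.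
  by rewrite !mulr0.
rewrite hBE (L2_dot_sqr mhB (L2_mkE hB2)) -EFinM lee_fin.
apply: le_trans (L2_CauchySchwarz _ _) _; rewrite mulrC ler_wpM2r ?L2_dot_ge0//.
apply: (L2_dot_le_sqr _ (L2_mkE K2)); first exact: measurable_kernel_sec.
exact: bounded_kernel_sqr bK.
Qed.

Lemma local_mass_le (u : L2) r x : (local_mass u r x <= (L2_dot u u)%:E)%E.
Proof.
have mu := L2_measurable u.
rewrite -(L2_dot_sqr mu); last exact: aeW.
apply: ge0_le_integral => //.
- by move=> y _; rewrite lee_fin mulr_ge0// sqr_ge0.
- apply/measurable_EFinP; apply: measurable_funM; first exact: measurable_funX.
  exact: measurable_kernel_sec (mball r).
- by apply/measurable_EFinP; exact: measurable_funX.
- by move=> y _; rewrite lee_fin ler_piMr ?sqr_ge0// indicE; case: (_ \in _).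
Qed.

Lemma conv_L2_bound (u : L2) K M r : bounded_kernel K M r ->
  (\int[leb]_x (conv u K x ^+ 2)%:E <=
   (M ^+ 2 * (2 * r) ^+ 3 * (2 * r) ^+ 3 * L2_dot u u)%:E)%E.
Proof.
move=> bK; have [mK r0 KM Kr] := bK; have mu := L2_measurable u.
have C0 : 0 <= M ^+ 2 * (2 * r) ^+ 3.
  by rewrite mulr_ge0 ?sqr_ge0// exprn_ge0// mulr_ge0// ltW.
apply: (@le_trans _ _ (\int[leb]_x ((M ^+ 2 * (2 * r) ^+ 3)%:E * local_mass u r x))%E).
  apply: ge0_le_integral => //.
  - by move=> y _; rewrite lee_fin sqr_ge0.
  - by apply/measurable_EFinP; apply: measurable_funX; exact: measurable_conv.
  - by apply: measurable_funeM; exact: measurable_local_mass.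
  - by move=> x _; exact: conv_sqr_le (L2_Lfun u) bK.
rewrite ge0_integralZl//; last 2 first.
- exact: measurable_local_mass.
- by move=> x _; exact: local_mass_ge0.
- by rewrite integral_local_mass// (L2_dot_sqr mu (aeW _ (fun=> erefl))) -!EFinM mulrA.
Qed.

(** One factor of the squared convolution is bounded by the whole mass of
    [u], the other one is integrated: this trades the fourth power for a square. *)
Lemma conv_L4_bound (u : L2) K M r : bounded_kernel K M r ->
  (\int[leb]_x (conv u K x ^+ 4)%:E <=
   (M ^+ 4 * ((2 * r) ^+ 3) ^+ 3 * L2_dot u u ^+ 2)%:E)%E.
Proof.
move=> bK; have [mK r0 KM Kr] := bK; have mu := L2_measurable u.
set V := (2 * r) ^+ 3; have V0 : 0 <= V by rewrite exprn_ge0// mulr_ge0// ltW.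
have C0 : 0 <= M ^+ 2 * V by rewrite mulr_ge0 ?sqr_ge0.
have D0 := L2_dot_ge0 u.
have fin x : local_mass u r x \is a fin_num.
  by rewrite ge0_fin_numE ?local_mass_ge0// (le_lt_trans (local_mass_le u r x)) ?ltry.
have E0 : 0 <= (M ^+ 2 * V) ^+ 2 * L2_dot u u by rewrite mulr_ge0 ?sqr_ge0.
apply: (@le_trans _ _ (\int[leb]_x (((M ^+ 2 * V) ^+ 2 * L2_dot u u)%:E *
    local_mass u r x))%E).
  apply: ge0_le_integral => //.
  - by move=> y _; rewrite lee_fin exprn_even_ge0.
  - by apply/measurable_EFinP; apply: measurable_funX; exact: measurable_conv.
  - by apply: measurable_funeM; exact: measurable_local_mass.
  - move=> x _; have := conv_sqr_le x (L2_Lfun u) bK; have := local_mass_le u r x.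
    rewrite -/V -(fineK (fin x)) -!EFinM !lee_fin.
    have : 0 <= fine (local_mass u r x) by rewrite fine_ge0 ?local_mass_ge0.
    move: (fine _) => W W0 WD h.
    have -> : conv u K x ^+ 4 = (conv u K x ^+ 2) ^+ 2 by rewrite -exprM.
    apply: (@le_trans _ _ ((M ^+ 2 * V * W) ^+ 2)).
      by apply: lerXn2r => //; rewrite nnegrE ?sqr_ge0//; exact: mulr_ge0.
    by rewrite [leLHS]exprMn -[leRHS]mulrA ler_wpM2l ?sqr_ge0// expr2 ler_wpM2r.
rewrite ge0_integralZl//; last 2 first.
- exact: measurable_local_mass.
- by move=> x _; exact: local_mass_ge0.
- rewrite integral_local_mass// (L2_dot_sqr mu (aeW _ (fun=> erefl))) -!EFinM lee_fin.
  by rewrite -/V le_eqVlt; apply/orP; left; apply/eqP; ring.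
Qed.

End convolution.

(** * Integrals of products *)

Section tensor_integral.
Context (R : realType).
Local Notation leb1 := (@lebesgue_measure R).
Local Notation leb := (@lebesgue3 R).

Lemma Rintegral_prod d1 d2 (T1 : measurableType d1) (T2 : measurableType d2)
    (m1 : {sigma_finite_measure set T1 -> \bar R})
    (m2 : {sigma_finite_measure set T2 -> \bar R}) (p : T1 -> R) (q : T2 -> R) :
  m1.-integrable setT (EFin \o p) -> m2.-integrable setT (EFin \o q) ->
  (m1 \x m2)%E.-integrable setT (fun z => (p z.1 * q z.2)%:E) /\
  \int[(m1 \x m2)%E]_z (p z.1 * q z.2) = (\int[m1]_x p x) * (\int[m2]_y q y).
Proof.
move=> ip iq.
have mp : measurable_fun setT p by apply/measurable_EFinP; exact: measurable_int ip.
have mq : measurable_fun setT q by apply/measurable_EFinP; exact: measurable_int iq.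
have ipq : (m1 \x m2)%E.-integrable setT (fun z => (p z.1 * q z.2)%:E).
  apply/integrable12ltyP.
    apply/measurable_EFinP; apply: measurable_funM.
      exact: measurableT_comp mp measurable_fst.
    exact: measurableT_comp mq measurable_snd.
  have /integrableP[_ qfin] := iq; have /integrableP[_ pfin] := ip.
  under eq_integral => x _.
    under eq_integral => y _ do rewrite /= normrM EFinM.
    rewrite ge0_integralZl//; last first.
      by apply/measurable_EFinP; exact: measurableT_comp.
    over.
  rewrite ge0_integralZr//.
  - by rewrite lte_mul_pinfty ?integral_ge0// ge0_fin_numE ?integral_ge0.
  - by apply/measurable_EFinP; exact: measurableT_comp.
  - by apply: integral_ge0.
split => //.
have iqf : (\int[m2]_y (q y)%:E)%E \is a fin_num by exact: integrable_fin_num.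
have ipf : (\int[m1]_x (p x)%:E)%E \is a fin_num by exact: integrable_fin_num.
rewrite /Rintegral -fineM//; congr fine; rewrite -(fubini1 ipq).
rewrite [LHS](eq_integral (fun x => (p x)%:E * \int[m2]_y (q y)%:E)%E); last first.
  move=> x _; rewrite /fubini_F.
  by rewrite -integralZl//; apply: eq_integral => y _; rewrite -EFinM.
by rewrite -(fineK iqf) integralZr.
Qed.

Lemma Rintegral_tensor (p q r : R -> R) :
  leb1.-integrable setT (EFin \o p) -> leb1.-integrable setT (EFin \o q) ->
  leb1.-integrable setT (EFin \o r) ->
  \int[leb]_x tensor p q r x =
  (\int[leb1]_s p s) * (\int[leb1]_s q s) * (\int[leb1]_s r s).
Proof.
move=> ip iq ir; have [ipq Ipq] := Rintegral_prod ip iq.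
rewrite -Ipq.
have [_ <-] := @Rintegral_prod _ _ _ _ (lebesgue2_sf R) leb1 _ _ ipq ir.
by [].
Qed.

End tensor_integral.

(** * Mollifiers *)

Section mollifier.
Variable R : realType.
Local Notation leb1 := (@lebesgue_measure R).
Local Notation leb := (@lebesgue3 R).

(** A profile of integral one, supported to the right of the origin: its
    primitive [step] makes the integral explicit. *)
Definition bump (s : R) : R := derive1 (@step R) s.

(** A primitive with compact support of the difference of the profiles at two
    consecutive scales: both profiles have integral one. *)
Definition step_diff (s : R) : R := step s - step (2 * s).

Lemma smooth_bump : smooth bump.
Proof. exact/smooth_derive1/smooth_step. Qed.

Lemma bump_outside s : s < 0 \/ 1 < s -> bump s = 0.
Proof.
case=> hs; rewrite /bump derive1E.
- rewrite (@near_eq_derive _ _ _ _ (cst 0)) ?derive_cst//.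
  near=> y; rewrite step_le0//; near: y.
  by apply: filterS (lt_nbhsl hs) => y /ltW.
- rewrite (@near_eq_derive _ _ _ _ (cst (1 : R) : R -> R)) ?derive_cst//.
  near=> y; rewrite step_ge1//; near: y.
  by apply: filterS (lt_nbhsr hs) => y /ltW.
Unshelve. all: by end_near. Qed.

Lemma smooth_step_diff : smooth step_diff.
Proof.
move=> k; rewrite /step_diff.
have -> : (fun s : R => step s - step (2 * s)) =
    (fun s => step s + -1 * (fun t => step (2 * t + 0)) s).
  by apply/funext => s; rewrite addr0 mulN1r.
apply: smooth_uptoD; first exact: smooth_step.
apply: smooth_uptoM; first exact: smooth_upto_cst.
by apply: smooth_upto_affine; exact: smooth_step.
Qed.

Lemma is_derive_step_diff (s : R) : is_derive s 1 step_diff (bump s - 2 * bump (2 * s)).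
Proof.
have d1 := smooth_is_derive s (@smooth_step R).
have d2 := @is_derive1_comp _ (@step R) (fun x => 2 * x + 0) s _ _
  (smooth_is_derive (2 * s + 0) (@smooth_step R)) (is_derive_affine 2 0 s).
have -> : step_diff = @step R - (@step R \o (fun x => 2 * x + 0)).
  by apply/funext => t; rewrite /step_diff !fctE /= addr0.
have := @is_deriveB _ _ _ _ _ _ _ _ _ d1 d2.
by rewrite addr0 (mulrC _ 2).
Qed.

Lemma step_diff_outside s : s < 0 \/ 1 < s -> step_diff s = 0.
Proof.
case=> hs; rewrite /step_diff; first by rewrite !step_le0 ?subrr//; lra.
by rewrite !step_ge1 ?subrr//; lra.
Qed.

Lemma bump_step_diff_bounded : exists M, 1 <= M /\
  forall s, `|bump s| <= M /\ `|step_diff s| <= M.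
Proof.
have bd (f : R -> R) : continuous f -> (forall s, s < 0 \/ 1 < s -> f s = 0) ->
    exists M, forall s, `|f s| <= M.
  move=> cf f0.
  have [M [_ /(_ (`|M| + 1)) hM]] := compact_bounded (continuous_compact
    (continuous_subspaceT cf) (@segment_compact _ 0 1)).
  exists (`|M| + 1) => s.
  have [s0|s0] := ltP s 0; first by rewrite f0 ?normr0 ?addr_ge0//; left.
  have [s1|s1] := ltP 1 s; first by rewrite f0 ?normr0 ?addr_ge0//; right.
  apply: hM; first by rewrite ltr_pwDr// ler_norm.
  by exists s => //=; rewrite in_itv/= s0 s1.
have [M1 h1] := bd _ (smooth_continuous smooth_bump) bump_outside.
have [M2 h2] := bd _ (smooth_continuous smooth_step_diff) step_diff_outside.
exists (1 + `|M1| + `|M2|); split; first by rewrite -addrA lerDl addr_ge0.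
move=> s; split; [apply: le_trans (h1 s) _|apply: le_trans (h2 s) _].
  by have := ler_norm M1; have := normr_ge0 M2; lra.
by have := ler_norm M2; have := normr_ge0 M1; lra.
Qed.

Definition bumpN (N s : R) : R := N * bump (N * s).

(** The step is a primitive of the profile and increases from 0 to 1. *)
Lemma Rintegral_bumpN (N c : R) : 0 < N ->
  leb1.-integrable setT (EFin \o (fun s => bumpN N (c - s))) /\
  \int[leb1]_s bumpN N (c - s) = 1.
Proof.
move=> N0; pose f s := bumpN N (c - s); pose F (s : R) : R := - (@step R) (- N * s + N * c).
have dF (s : R) : is_derive s 1 F (f s).
  have d2 := @is_derive1_comp _ (@step R) (fun x => - N * x + N * c) s _ _
    (smooth_is_derive (- N * s + N * c) (@smooth_step R)) (is_derive_affine (- N) (N * c) s).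
  have := @is_deriveN _ _ _ _ _ _ _ d2.
  congr (is_derive _ _ _ _); rewrite /f /bumpN /bump mulrN opprK mulrC.
  by have -> : - N * s + N * c = N * (c - s) by ring.
have cf : continuous f.
  move=> s; have -> : f = (fun s => N * (fun t => bump (- N * t + N * c)) s).
    by apply/funext => t; rewrite /f /bumpN; congr (_ * bump _); ring.
  apply: cvgMr; apply: (smooth_upto_affine (k := 0)).
  exact: smooth_continuous smooth_bump.
pose a := c - N^-1; have ac : a < c by rewrite ltrBlDr ltrDl invr_gt0.
have f0 s : s \notin `[a, c] -> f s = 0.
  rewrite in_itv/= negb_and -!ltNge => /orP[] h; rewrite /f /bumpN bump_outside ?mulr0//.
    right; rewrite mulrC -ltr_pdivrMr// mul1r.
    by move: h; rewrite /a; lra.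
  by left; rewrite pmulr_rlt0// subr_lt0.
have fE : EFin \o f = (EFin \o f) \_ `[a, c].
  apply/funext => s; rewrite patchE; case: ifPn => //= h.
  by rewrite f0//; apply: contra h => h; rewrite inE.
have iab : leb1.-integrable `[a, c] (EFin \o f).
  apply: continuous_compact_integrable; first exact: segment_compact.
  exact: continuous_subspaceT.
have mab : measurable (`[a, c]%classic : set (measurableTypeR R)) by exact: measurable_itv.
split; first by rewrite fE; apply/(integrable_mkcond _ mab).
rewrite /Rintegral (_ : (fun x => _) = (EFin \o f) \_ `[a, c]) -?fE//.
rewrite fE -integral_mkcond (@continuous_FTC2 _ f F)//.
- rewrite /F /= opprK.
  have -> : - N * c + N * c = 0 by ring.
  have -> : - N * a + N * c = 1 by rewrite /a; field; rewrite gt_eqF.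
  by rewrite step_le0// step_ge1// oppr0 add0r.
- exact: continuous_subspaceT.
- split.
  + by move=> s _; case: (dF s).
  + by apply: cvg_at_right_filter; exact: is_derive_continuous dF a.
  + by apply: cvg_at_left_filter; exact: is_derive_continuous dF c.
- by move=> s _; rewrite derive1E; case: (dF s).
Qed.

End mollifier.

Section mollification.
Variable R : realType.
Local Notation leb1 := (@lebesgue_measure R).
Local Notation leb := (@lebesgue3 R).
Local Notation L2 := (@L2 _ (R3 R) R leb).

Lemma bounded_kernel_tensor (p q r : R -> R) (A B C rho : R) :
  continuous p -> continuous q -> continuous r -> 0 < rho ->
  (forall s, `|p s| <= A) -> (forall s, `|q s| <= B) -> (forall s, `|r s| <= C) ->
  (forall s, rho <= `|s| -> p s = 0) -> (forall s, rho <= `|s| -> q s = 0) ->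
  (forall s, rho <= `|s| -> r s = 0) ->
  bounded_kernel (tensor p q r) (A * B * C) rho.
Proof.
move=> cp cq cr rho0 pA qB rC p0 q0 r0; split => //.
- by apply: R3_continuous_measurable; exact: continuous_tensor.
- move=> z; rewrite /tensor !normrM ler_pM ?mulr_ge0//.
  by rewrite ler_pM.
- move=> [[x y] z]; rewrite /Num.norm/= !le_max /tensor/=.
  move=> /orP[/orP[]|] h.
  + by rewrite p0// !mul0r.
  + by rewrite q0// mulr0 mul0r.
  + by rewrite r0// mulr0.
Qed.

Definition mollifier (N : R) : R3 R -> R := tensor (bumpN N) (bumpN N) (bumpN N).

Variable M : R.
Hypothesis M1 : 1 <= M.
Hypothesis bumpM : forall s : R, `|bump s| <= M /\ `|step_diff s| <= M.

Lemma bumpN_outside (N s : R) : 0 < N -> 2 / N <= `|s| -> bumpN N s = 0.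
Proof.
move=> N0; rewrite ler_pdivrMr// => h; rewrite /bumpN bump_outside ?mulr0//.
have [s0|s0] := leP 0 s; [right|left].
  by rewrite ger0_norm// in h; rewrite mulrC; lra.
by rewrite pmulr_rlt0.
Qed.

Lemma bumpN_bound (N s : R) : 0 < N -> `|bumpN N s| <= N * M.
Proof.
move=> N0; rewrite /bumpN normrM gtr0_norm// ler_pM2l//.
by have [] := bumpM (N * s).
Qed.

Lemma bumpN_continuous (N : R) : continuous (@bumpN R N).
Proof.
move=> s; have -> : @bumpN R N = (fun s => N * (fun t => bump (N * t + 0)) s).
  by apply/funext => t; rewrite /bumpN addr0.
apply: cvgMr; apply: (smooth_upto_affine (k := 0)).
exact: smooth_continuous (@smooth_bump R).
Qed.

Lemma mollifier_kernel (N : R) : 0 < N ->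
  bounded_kernel (mollifier N) (N * M * (N * M) * (N * M)) (2 / N).
Proof.
move=> N0; have b s := @bumpN_bound N s N0; have o s := @bumpN_outside N s N0.
by apply: bounded_kernel_tensor; rewrite ?divr_gt0//; exact: bumpN_continuous.
Qed.

(** The bound does not depend on the scale: the sup of the kernel squared
    compensates the squared volume of its support. *)
Lemma mollifier_L2_bound (u : L2) N : 0 < N ->
  (\int[leb]_x (conv u (mollifier N) x ^+ 2)%:E <= (64 ^+ 2 * M ^+ 6 * L2_dot u u)%:E)%E.
Proof.
move=> N0; apply: le_trans (conv_L2_bound u (mollifier_kernel N0)) _.
rewrite lee_fin le_eqVlt; apply/orP; left; apply/eqP; field.
by rewrite gt_eqF.
Qed.

Lemma Rintegral_mollifier N (x : R3 R) : 0 < N ->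
  \int[leb]_y mollifier N (x - y) = 1.
Proof.
case: x => [[x1 x2] x3] N0.
pose b c (s : R) := bumpN N (c - s).
have [i1 e1] := Rintegral_bumpN x1 N0; have [i2 e2] := Rintegral_bumpN x2 N0.
have [i3 e3] := Rintegral_bumpN x3 N0.
have prod1 (I a1 a2 a3 : R) : I = a1 * a2 * a3 -> a1 = 1 -> a2 = 1 -> a3 = 1 -> I = 1.
  by move=> -> -> -> ->; rewrite !mulr1.
exact: (prod1 _ _ _ _ (@Rintegral_tensor R (b x1) (b x2) (b x3) i1 i2 i3) e1 e2 e3).
Qed.

Lemma integral_ball_bound (f : R3 R -> R) (x : R3 R) (C r : R) :
  measurable_fun setT f -> 0 < r -> 0 <= C -> (forall y, `|f y| <= C) ->
  (forall y, r <= `|x - y| -> f y = 0) ->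
  leb.-integrable setT (EFin \o f) /\ `|\int[leb]_y f y| <= C * (2 * r) ^+ 3.
Proof.
move=> mf r0 C0 fC f0.
have mB : measurable (ball x r : set (R3 R)) by exact: R3_ball_measurable.
have le_f : (\int[leb]_y `|(f y)%:E| <= (C * (2 * r) ^+ 3)%:E)%E.
  apply: (@le_trans _ _ (\int[leb]_y (C * \1_(ball x r : set (R3 R)) y)%:E)%E).
    apply: ge0_le_integral => //.
    - by apply: measurableT_comp => //; exact/measurable_EFinP.
    - by apply/measurable_EFinP; exact: measurable_funM.
    - move=> y _; rewrite /= lee_fin indicE; have [_|] := boolP (_ \in _).
        by rewrite mulr1.
      rewrite notin_setE R3_ball_normE => /negP; rewrite -leNgt => /f0 ->.
      by rewrite normr0 mulr0.
  under eq_integral => y _ do rewrite EFinM.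
  rewrite ge0_integralZl//; last by apply/measurable_EFinP.
  by rewrite integral_indic// setIT R3_ball_volume// -EFinM.
have fi : leb.-integrable setT (EFin \o f).
  apply/integrableP; split; first exact/measurable_EFinP.
  by apply: le_lt_trans le_f _; rewrite ltry.
split => //; rewrite -lee_fin EFin_normr_Rintegral//; apply: le_trans le_f.
by apply: le_abse_integral => //; exact: measurable_int fi.
Qed.

(** Uniform boundedness and a common compact support leave only pointwise
    convergence, which is the continuity of [phi]. *)
Lemma mollifier_Cc_cvg phi (hphi : Cc phi) (u : nat -> R) :
  (forall n, 1 <= u n) -> (u n)^-1 @[n --> \oo] --> (0 : R) ->
  (\int[leb]_x ((conv phi (mollifier (u n)) x - phi x) ^+ 2)%:E @[n --> \oo] --> 0)%E.
Proof.
move=> u1 u0; have [cphi [S hS]] := hphi.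
have ugt0 n : 0 < u n by apply: lt_le_trans (u1 n).
have mphi : measurable_fun setT phi by exact: R3_continuous_measurable.
have [L [_ /(_ (`|L| + 1)) hL]] := compact_bounded (continuous_compact
  (continuous_subspaceT cphi) (@R3_closed_ball_compact R S)).
have {}hL x : `|phi x| <= `|L| + 1.
  have [xS|/ltW xS] := leP `|x| S; last by rewrite hS// normr0 addr_ge0.
  by apply: hL; [rewrite ltr_pwDr// ler_norm|exists x].
have L0 : 0 <= `|L| + 1 by rewrite addr_ge0.
have Kb n z : `|mollifier (u n) z| <= (u n * M) ^+ 3.
  have [_ _ h _] := mollifier_kernel (ugt0 n); apply: le_trans (h z) _.
  by have -> : u n * M * (u n * M) * (u n * M) = (u n * M) ^+ 3 by ring.
have M0 : 0 < M by apply: lt_le_trans M1.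
have K0 n : 0 <= (u n * M) ^+ 3 by rewrite exprn_ge0// mulr_ge0// ltW.
have cancel n c : c * (u n * M) ^+ 3 * (2 * (2 / u n)) ^+ 3 = c * (64 * M ^+ 3).
  by field; rewrite gt_eqF.
have convb n x : `|conv phi (mollifier (u n)) x| <= (`|L| + 1) * (64 * M ^+ 3).
  rewrite -(cancel n).
  have [mK r0 _ Kr] := mollifier_kernel (ugt0 n).
  have mf := measurable_funM mphi (measurable_kernel_sec x mK).
  have [|||//] := @integral_ball_bound (fun y => phi y * mollifier (u n) (x - y)) x
    ((`|L| + 1) * (u n * M) ^+ 3) (2 / u n) mf r0.
  - by rewrite mulr_ge0.
  - by move=> y; rewrite normrM ler_pM.
  - by move=> y /Kr ->; rewrite mulr0.
apply: (@Cc_dominated_cvg0 _ _ ((`|L| + 1) * (64 * M ^+ 3) + (`|L| + 1)) (S + 2)).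
- move=> n; apply: measurable_funB => //; apply: measurable_conv => //.
  by case: (mollifier_kernel (ugt0 n)).
- by move=> n x; apply: le_trans (ler_normB _ _) _; rewrite lerD.
- move=> n x xS; rewrite hS; last by apply: le_trans xS; rewrite lerDl.
  rewrite subr0 /conv; have [mK r0 _ Kr] := mollifier_kernel (ugt0 n).
  have h y : phi y * mollifier (u n) (x - y) = 0.
    have [yS|yS] := leP S `|y|; first by rewrite hS// mul0r.
    rewrite Kr ?mulr0//; have := lerB_dist x y.
    suff : 2 / u n <= 2 by lra.
    by rewrite ler_pdivrMr// ler_peMr.
  by rewrite /Rintegral integral0_eq// => y _; rewrite h.
- move=> x; apply/cvgrPdist_lt => e e0.
  have M3 : 0 < 64 * M ^+ 3 + 1 by rewrite ltr_pwDr// mulr_ge0// exprn_ge0// ltW.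
  have e'0 : 0 < e / (64 * M ^+ 3 + 1) by rewrite divr_gt0.
  have /cvgrPdist_lt/(_ _ e'0) := cphi x.
  move=> /nbhs_ballP[d /= d0 hd].
  move/cvgrPdist_lt : u0 => /(_ (d / 2)); rewrite divr_gt0// => /(_ isT).
  apply: filterS => n; rewrite sub0r normrN gtr0_norm ?invr_gt0// => un.
  rewrite sub0r normrN.
  have [mK r0 _ Kr] := mollifier_kernel (ugt0 n).
  have -> : conv phi (mollifier (u n)) x - phi x =
      \int[leb]_y ((phi y - phi x) * mollifier (u n) (x - y)).
    have K2 := bounded_kernel_Lfun x (mollifier_kernel (ugt0 n)).
    have i1 : leb.-integrable setT (fun y => (phi y * mollifier (u n) (x - y))%:E).
      exact: L2_integrableM (Cc_Lfun hphi) K2.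
    have i0 : leb.-integrable setT (EFin \o (fun y => mollifier (u n) (x - y))).
      exact: (@integral_ball_bound _ x _ _ (measurable_kernel_sec x mK) r0 (K0 n)
        (fun y => Kb n (x - y)) (fun y => Kr (x - y))).1.
    have i2 : leb.-integrable setT (EFin \o (fun y => phi x * mollifier (u n) (x - y))).
      exact: (integrableZl measurableT (phi x) i0).
    under [RHS]eq_Rintegral => y _ do rewrite mulrBl.
    rewrite (RintegralB measurableT i1 i2) RintegralZl// Rintegral_mollifier//.
    by rewrite mulr1.
  apply: (@le_lt_trans _ _ (e / (64 * M ^+ 3 + 1) * (64 * M ^+ 3))); last first.
    by rewrite mulrAC ltr_pdivrMr// ltr_pM2l// ltrDl.
  rewrite -(cancel n).
  have mf := measurable_funM (measurable_funB mphi (measurable_cst (phi x)))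
    (measurable_kernel_sec x mK).
  have [|||//] := @integral_ball_bound (fun y => (phi y - phi x) * mollifier (u n) (x - y))
    x (e / (64 * M ^+ 3 + 1) * (u n * M) ^+ 3) (2 / u n) mf r0.
  + by rewrite mulr_ge0// ltW.
  + move=> y; have [h|h] := leP (2 / u n) `|x - y|.
      by rewrite Kr// mulr0 normr0 mulr_ge0// ltW.
    rewrite normrM ler_pM// distrC ltW// hd// -ball_normE/= (lt_le_trans h)//.
    by rewrite -ler_pdivlMl// mulrC ltW.
  + by move=> y /Kr ->; rewrite mulr0.
Qed.

End mollification.

Opaque step step_diff bump.

Section L4_embedding.
Variable R : realType.
Local Notation leb := (@lebesgue3 R).
Local Notation L2 := (@L2 _ (R3 R) R leb).

Lemma conv_Lfun (u : L2) K M r : bounded_kernel K M r -> conv u K \in Lfun leb 2%:E.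
Proof.
move=> bK; have [mK _ _ _] := bK; apply: Lfun2_dominated.
  by apply: measurable_conv => //; exact: L2_measurable.
by apply: le_lt_trans (conv_L2_bound u bK) _; rewrite ltry.
Qed.

Variable M : R.
Hypothesis M1 : 1 <= M.
Hypothesis bumpM : forall s : R, `|bump s| <= M /\ `|step_diff s| <= M.

Let M0 : 0 <= M. Proof. by apply: le_trans M1. Qed.

Let two_gt0 n : 0 < 2 ^+ n :> R. Proof. by rewrite exprn_gt0. Qed.

Definition dyadic_mollification n (u : L2) : L2 :=
  L2_mk (conv_Lfun u (mollifier_kernel bumpM (two_gt0 n))).

Lemma dyadic_mollificationE n u :
  {ae leb, forall x, dyadic_mollification n u x = conv u (mollifier (2 ^+ n)) x}.
Proof. exact: L2_mkE. Qed.

(** Uniform boundedness and convergence on a dense set. *)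
Lemma dyadic_mollification_cvg (u : L2) :
  L2_dot (dyadic_mollification n u - u) (dyadic_mollification n u - u)
    @[n --> \oo] --> (0 : R).
Proof.
have mK n : measurable_fun setT (mollifier (2 ^+ n : R)).
  by case: (mollifier_kernel bumpM (two_gt0 n)).
have mc n (v : L2) : measurable_fun setT (conv v (mollifier (2 ^+ n))).
  by apply: measurable_conv => //; exact: L2_measurable.
move: u; apply: (@L2_cvg0_dense R nat \oo _
  (fun n u => dyadic_mollification n u - u) (2 * (64 ^+ 2 * M ^+ 6) + 2)).
- move=> n a u v; suff -> : dyadic_mollification n (a *: u + v) =
      a *: dyadic_mollification n u + dyadic_mollification n v.
    by rewrite scalerBr opprD addrACA.
  apply: L2_ext; apply: filter_app (dyadic_mollificationE n (a *: u + v)).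
  apply: filter_app (L2D (a *: dyadic_mollification n u) (dyadic_mollification n v)).
  apply: filter_app (L2Z a (dyadic_mollification n u)).
  apply: filter_app (dyadic_mollificationE n u).
  apply: filterS (dyadic_mollificationE n v).
  move=> x h1 h2 -> -> ->; rewrite h1 h2.
  by rewrite (conv_lin a u v (mollifier_kernel bumpM (two_gt0 n))).
- by rewrite addr_ge0// !mulr_ge0// exprn_ge0.
- move=> n u; apply: le_trans (L2_sqr_triangle _ _) _; rewrite L2dotNl L2dotNr opprK.
  have := L2_dot_le_sqr (mc n u) (dyadic_mollificationE n u) (mollifier_L2_bound bumpM u (two_gt0 n)).
  by move: (64 ^+ 2 * M ^+ 6) (L2_dot u u) (L2_dot _ _) => Q r l h; lra.
- move=> phi hphi.
  have mphi : measurable_fun setT phi by exact: Lfun2_measurable (Cc_Lfun hphi).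
  pose f n x := conv phi (mollifier (2 ^+ n)) x - phi x.
  have mf n : measurable_fun setT (f n).
    by apply: measurable_funB => //; exact: measurable_conv.
  have E n : {ae leb, forall x, (dyadic_mollification n (L2_mk (Cc_Lfun hphi)) -
      L2_mk (Cc_Lfun hphi) : L2) x = f n x}.
    apply: filter_app (L2B (dyadic_mollification n (L2_mk (Cc_Lfun hphi)))
      (L2_mk (Cc_Lfun hphi))).
    apply: filter_app (dyadic_mollificationE n (L2_mk (Cc_Lfun hphi))).
    apply: filterS (L2_mkE (Cc_Lfun hphi)) => x h1 h2 ->; rewrite h1 h2.
    by rewrite (conv_ext x mphi (mK n) (L2_mkE (Cc_Lfun hphi))).
  have := mollifier_Cc_cvg M1 bumpM hphi (u := fun n => 2 ^+ n).
  move=> /(_ (fun n => _)) H.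
  have {H} := H (fun n => exprn_ege1 n (ler1n R 2)).
  have inv0 : (2 ^+ n : R)^-1 @[n --> \oo] --> (0 : R).
    under eq_fun do rewrite -exprVn.
    by apply: cvg_expr; rewrite ger0_norm ?invr_ge0 ?invf_lt1 ?ltr1n.
  move=> /(_ inv0).
  under eq_fun do rewrite (L2_dot_sqr (mf _) (E _)).
  by move/fine_cvg.
Qed.

Section kernel_difference.
Variables (N : R) (N0 : 0 < N).

Definition diffN (s : R) : R := step_diff (N * s).

(** The difference of the mollifiers at scales [1 / (2 N)] and [1 / N] is the
    divergence of [corrector / N]: both have integral one, and telescoping
    over the coordinates reduces this to dimension one. *)
Definition corrector (i : 'I_3) : R3 R -> R :=
  tensor (if i == 0%N :> nat then diffN else bumpN N)
         (if i == 0%N :> nat then bumpN (2 * N) else if i == 1%N :> nat then diffN else bumpN N)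
         (if i == 2%N :> nat then diffN else bumpN (2 * N)).

Lemma smooth_reflect (f : R -> R) (c : R) : smooth f -> smooth (fun s => f (N * (c - s))).
Proof.
move=> sf k; have -> : (fun s => f (N * (c - s))) = (fun s => f (- N * s + N * c)).
  by apply/funext => s; congr f; ring.
exact: smooth_upto_affine.
Qed.

Lemma smooth_bumpN_reflect (L c : R) : smooth (fun s => bumpN L (c - s)).
Proof.
move=> k; apply: smooth_uptoM; first exact: smooth_upto_cst.
have -> : (fun s => bump (L * (c - s))) = (fun s => bump (- L * s + L * c)).
  by apply/funext => s; congr bump; ring.
by apply: smooth_upto_affine; exact: smooth_bump.
Qed.

Lemma diffN_outside s : 2 / N <= `|s| -> diffN s = 0.
Proof.
rewrite ler_pdivrMr// => h; apply: step_diff_outside.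
have [s0|s0] := leP 0 s; [right|left].
  by rewrite ger0_norm// in h; rewrite mulrC; lra.
by rewrite pmulr_rlt0.
Qed.

Lemma bounded_support_reflect (f : R -> R) (c rho : R) :
  (forall s, rho <= `|s| -> f s = 0) -> bounded_support (fun s => f (c - s)).
Proof.
move=> f0; exists (`|c| + rho) => s h; apply: f0.
by have := lerB_dist s c; rewrite distrC; lra.
Qed.

Lemma bumpN2_outside s : 2 / N <= `|s| -> bumpN (2 * N) s = 0.
Proof.
move=> h; apply: bumpN_outside; first by rewrite mulr_gt0.
apply: le_trans h; rewrite ler_pM2l// lef_pV2 ?posrE ?mulr_gt0//.
by rewrite ler_peMl ?ler1n// ltW.
Qed.

Lemma is_derive_diffN_reflect (c s : R) :
  is_derive s 1 (fun s => diffN (c - s)) (bumpN (2 * N) (c - s) - bumpN N (c - s)).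
Proof.
have -> : (fun s => diffN (c - s)) = @step_diff R \o (fun s => - N * s + N * c).
  by apply/funext => t; rewrite /diffN /=; congr step_diff; ring.
apply: is_derive_cast (@is_derive1_comp _ (@step_diff R) (fun s => - N * s + N * c) s _ _
  (is_derive_step_diff (- N * s + N * c)) (is_derive_affine (- N) (N * c) s)) _.
have -> : - N * s + N * c = N * (c - s) by ring.
rewrite /bumpN mulrA; move: (bump _) (bump _) => b1 b2; ring.
Qed.

(** Compared with a mollifier at scale [1 / N], one power of [N] is missing:
    this gain makes the dyadic differences summable in [L^4]. *)
Lemma corrector_kernel i : bounded_kernel (corrector i) (4 * N ^+ 2 * M ^+ 3) (2 / N).
Proof.
have cb L : continuous (@bumpN R L) by exact: bumpN_continuous.
have cd : continuous diffN.
  have -> : diffN = (fun s => step_diff (N * s + 0)) by apply/funext => s; rewrite addr0.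
  by apply: (smooth_upto_affine (k := 0)); exact: smooth_step_diff.
have N20 : 0 < 2 * N by rewrite mulr_gt0.
have b1 s := bumpN_bound bumpM s N0; have b2 s := bumpN_bound bumpM s N20.
have b1' s : `|bumpN N s| <= 2 * N * M.
  by apply: le_trans (b1 s) _; rewrite -mulrA ler_peMl ?ler1n// mulr_ge0// ltW.
have d1 s : `|diffN s| <= M by have [] := bumpM (N * s).
have o1 s := @bumpN_outside R N s N0.
have -> : 4 * N ^+ 2 * M ^+ 3 = M * (2 * N * M) * (2 * N * M) by ring.
have rho0 : 0 < 2 / N by rewrite divr_gt0.
have d2 := diffN_outside; have o2 := bumpN2_outside.
have c1 := cb N; have c2 := cb (2 * N); move: cd c1 c2 b1 b2 b1' d1 o1 d2 o2.
rewrite /corrector; move: diffN (bumpN N) (bumpN (2 * N)) => e a b *.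
case: i => [[|[|[|//]]] i3]; rewrite /corrector/=.
- by apply: bounded_kernel_tensor => //.
- have -> : M * (2 * N * M) * (2 * N * M) = 2 * N * M * M * (2 * N * M) by ring.
  by apply: bounded_kernel_tensor => //.
- have -> : M * (2 * N * M) * (2 * N * M) = 2 * N * M * (2 * N * M) * M by ring.
  by apply: bounded_kernel_tensor => //.
Qed.

(** The difference of the kernels is a divergence, and the reflected correctors
    are test functions: this is where the weak gradient enters. *)
Lemma conv_mollifier_diff (u : H1rad R) x :
  conv u (mollifier (2 * N)) x - conv u (mollifier N) x =
  - \sum_i conv (partial i u) (corrector i) x.
Proof.
have [wu _] : (forall i, weak_partial i (h1pair u).1 ((h1pair u).2 i)) /\
    radial (h1pair u).1 by apply/asboolP; exact: h1pairP.
pose a c (s : R) := bumpN N (c - s); pose b c (s : R) := bumpN (2 * N) (c - s).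
pose e c (s : R) := diffN (c - s).
have N20 : 0 < 2 * N by rewrite mulr_gt0.
have sa c : smooth (a c) := smooth_bumpN_reflect N c.
have sb c : smooth (b c) := smooth_bumpN_reflect (2 * N) c.
have se c : smooth (e c) := smooth_reflect c (@smooth_step_diff R).
have ba c : bounded_support (a c).
  by apply: bounded_support_reflect => s; exact: bumpN_outside.
have bb c : bounded_support (b c) := bounded_support_reflect c bumpN2_outside.
have be c : bounded_support (e c) := bounded_support_reflect c diffN_outside.
pose phi (i : 'I_3) : R3 R -> R :=
  tensor (if i == 0%N :> nat then e x.1.1 else a x.1.1)
    (if i == 0%N :> nat then b x.1.2 else if i == 1%N :> nat then e x.1.2 else a x.1.2)
    (if i == 2%N :> nat then e x.2 else b x.2).
have tphi i : test_function (phi i).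
  rewrite /phi; move: (sa x.1.1) (sa x.1.2) (sb x.1.2) (sb x.2) (se x.1.1) (se x.1.2) (se x.2).
  move: (ba x.1.1) (ba x.1.2) (bb x.1.2) (bb x.2) (be x.1.1) (be x.1.2) (be x.2).
  move: (a x.1.1) (a x.1.2) (b x.1.2) (b x.2) (e x.1.1) (e x.1.2) (e x.2).
  move=> *; apply: test_function_tensor; by do ?case: ifP => _.
have phiE i y : phi i y = corrector i (x - y).
  by rewrite /phi /corrector /tensor; case: i => [[|[|[|//]]] i3].
pose D (i : 'I_3) (y : R3 R) : R := if i == 0%N :> nat then
    (b x.1.1 y.1.1 - a x.1.1 y.1.1) * b x.1.2 y.1.2 * b x.2 y.2
  else if i == 1%N :> nat then
    a x.1.1 y.1.1 * (b x.1.2 y.1.2 - a x.1.2 y.1.2) * b x.2 y.2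
  else a x.1.1 y.1.1 * a x.1.2 y.1.2 * (b x.2 y.2 - a x.2 y.2).
have DE i y : 'D_(basis3 R i) (phi i) y = D i y.
  have da c s := smooth_is_derive s (sa c); have db c s := smooth_is_derive s (sb c).
  have de c s := is_derive_diffN_reflect c s.
  case: i => [[|[|[|//]]] i3].
  - by case: (is_derive_tensor (Ordinal i3) y (de x.1.1) (db x.1.2) (db x.2)).
  - by case: (is_derive_tensor (Ordinal i3) y (da x.1.1) (de x.1.2) (db x.2)).
  - by case: (is_derive_tensor (Ordinal i3) y (da x.1.1) (da x.1.2) (de x.2)).
have u2 := L2_Lfun (h1pair u).1.
have iD i : leb.-integrable setT (EFin \o (fun y => u y * D i y)).
  have := L2_integrableM u2 (test_partial_Lfun i (tphi i)).
  by apply: eq_integrable => // y _ /=; rewrite DE.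
have K1 := bounded_kernel_Lfun x (mollifier_kernel bumpM N0).
have K2 := bounded_kernel_Lfun x (mollifier_kernel bumpM N20).
have iK1 := L2_integrableM u2 K1; have iK2 := L2_integrableM u2 K2.
have eD i : - conv (partial i u) (corrector i) x = \int[leb]_y (u y * D i y).
  have := wu i (phi i) (tphi i); rewrite /conv.
  under eq_Rintegral => y _ do rewrite DE.
  move=> ->; congr (- _); apply: eq_Rintegral => y _; rewrite -phiE.
  by [].
rewrite -sumrN (eq_bigr _ (fun i _ => eD i)) !big_ord_recl big_ord0 addr0.
rewrite /conv -(RintegralB measurableT iK2 iK1).
rewrite -(RintegralD measurableT (iD _) (iD _)).
have iD2 : leb.-integrable setT (EFin \o (fun y => u y * D (lift ord0 ord0) y +
    u y * D (lift ord0 (lift ord0 ord0)) y)).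
  exact: (integrableD measurableT (iD _) (iD _)).
rewrite -(RintegralD measurableT (iD _) iD2).
apply: eq_Rintegral => y _; rewrite /D /mollifier /tensor.
have -> : (x - y).1.1 = x.1.1 - y.1.1 by [].
have -> : (x - y).1.2 = x.1.2 - y.1.2 by [].
have -> : (x - y).2 = x.2 - y.2 by [].
rewrite -!/(a _ _) -!/(b _ _) /= /h1fun.
move: (a x.1.1 y.1.1) (a x.1.2 y.1.2) (a x.2 y.2) => a1 a2 a3.
move: (b x.1.1 y.1.1) (b x.1.2 y.1.2) (b x.2 y.2) => b1 b2 b3.
by ring.
Qed.

End kernel_difference.

End L4_embedding.

(** * The Sobolev embedding in L4 *)

Section fourth_power.
Variable R : realType.
Local Notation leb := (@lebesgue3 R).

(** The convexity inequality with conjugate weights [1 / a] and [1 / b]. *)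
Lemma sqrD_le (x y a b : R) : 0 < a -> 0 < b -> a^-1 + b^-1 <= 1 ->
  (x + y) ^+ 2 <= a * x ^+ 2 + b * y ^+ 2.
Proof.
move=> a0 b0 ab.
have ab1 : 0 <= a * b - a - b.
  rewrite -(pmulr_rge0 _ (_ : 0 < (a * b)^-1)) ?invr_gt0 ?mulr_gt0//.
  have -> : (a * b)^-1 * (a * b - a - b) = 1 - (a^-1 + b^-1).
    by field; rewrite !gt_eqF.
  by rewrite subr_ge0.
have a1 : 1 <= a.
  have b1 : 0 < b^-1 by rewrite invr_gt0.
  by rewrite -invf_le1//; lra.
have [a1'|a1'] := eqVneq a 1.
  have b1 : 0 < b^-1 by rewrite invr_gt0.
  by move: ab; rewrite a1' invr1; lra.
have {}a1 : 0 < a - 1 by rewrite subr_gt0 lt_neqAle eq_sym a1'.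
rewrite -(ler_pM2l a1).
have := sqr_ge0 ((a - 1) * x - y); have := sqr_ge0 y; nra.
Qed.

Variable c : R.
Hypothesis c_ge : 1000 <= c.

Let c_ge0 : 0 <= c. Proof. by move: c_ge; lra. Qed.

(** The factor [3 / 2] is less than 2, so that iterating the inequality along
    dyadic scales still converges. *)
Lemma pow4D_le (x y : R) : (x + y) ^+ 4 <= 3 / 2 * x ^+ 4 + c * y ^+ 4.
Proof.
have h1 : (x + y) ^+ 2 <= 6 / 5 * x ^+ 2 + 6 * y ^+ 2 by apply: sqrD_le; lra.
have h2 : (6 / 5 * x ^+ 2 + 6 * y ^+ 2) ^+ 2 <=
    26 / 25 * (6 / 5 * x ^+ 2) ^+ 2 + 26 * (6 * y ^+ 2) ^+ 2 by apply: sqrD_le; lra.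
have h3 : (x + y) ^+ 4 <= (6 / 5 * x ^+ 2 + 6 * y ^+ 2) ^+ 2.
  have -> : (x + y) ^+ 4 = ((x + y) ^+ 2) ^+ 2 by rewrite -exprM.
  by apply: lerXn2r => //; rewrite nnegrE ?sqr_ge0//; apply: le_trans h1; exact: sqr_ge0.
have x4 : 0 <= x ^+ 4 by rewrite exprn_even_ge0.
have y4 : 0 <= y ^+ 4 by rewrite exprn_even_ge0.
have ex : (6 / 5 * x ^+ 2) ^+ 2 = 36 / 25 * x ^+ 4 by field.
have ey : (6 * y ^+ 2) ^+ 2 = 36 * y ^+ 4 by ring.
have : 1000 * y ^+ 4 <= c * y ^+ 4 by rewrite ler_wpM2r.
by move: h2; rewrite ex ey; lra.
Qed.

(** The [L^4] bounds are kept as bounds on integrals of nonnegative functions,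
    so that no integrability has to be known in advance. *)
Definition int4_le (f : R3 R -> R) (A : R) : Prop :=
  measurable_fun setT f /\ (\int[leb]_x (f x ^+ 4)%:E <= A%:E)%E.

Lemma int4_leD f g A B : int4_le f A -> int4_le g B ->
  int4_le (fun x => f x + g x) (3 / 2 * A + c * B).
Proof.
move=> [mf fA] [mg gB]; split; first exact: measurable_funD.
have mf4 : measurable_fun setT (fun x => (f x ^+ 4)%:E).
  by apply/measurable_EFinP; exact: measurable_funX.
have mg4 : measurable_fun setT (fun x => (g x ^+ 4)%:E).
  by apply/measurable_EFinP; exact: measurable_funX.
have pos (h : R3 R -> R) x : (0 <= (h x ^+ 4)%:E)%E by rewrite lee_fin exprn_even_ge0.
have c0 : (0 <= (3 / 2 : R)%:E)%E by rewrite lee_fin; lra.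
apply: (@le_trans _ _ (\int[leb]_x ((3 / 2)%:E * (f x ^+ 4)%:E + c%:E * (g x ^+ 4)%:E))%E).
  apply: ge0_le_integral => //.
  - by move=> x _; rewrite lee_fin exprn_even_ge0.
  - by apply/measurable_EFinP; apply: measurable_funX; exact: measurable_funD.
  - by apply: emeasurable_funD; exact: measurable_funeM.
  - by move=> x _; rewrite -!EFinM -EFinD lee_fin pow4D_le.
rewrite ge0_integralD//; last 4 first.
- by move=> x _; rewrite mule_ge0.
- exact: measurable_funeM.
- by move=> x _; rewrite mule_ge0// lee_fin.
- exact: measurable_funeM.
rewrite ge0_integralZl// ge0_integralZl//.
by rewrite EFinD; apply: leeD; rewrite [leRHS]EFinM; apply: lee_wpmul2l.
Qed.

Lemma int4_leW f A B : A <= B -> int4_le f A -> int4_le f B.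
Proof. by move=> AB [mf fA]; split => //; apply: le_trans fA _; rewrite lee_fin. Qed.

Lemma int4_le_ext f g A : f =1 g -> int4_le f A -> int4_le g A.
Proof. by move=> /funext ->. Qed.

Lemma int4_leN f A : int4_le f A -> int4_le (fun x => - f x) A.
Proof.
move=> [mf fA]; split; first exact: measurableT_comp.
by under eq_integral => x _ do rewrite -[- f x]mulN1r exprMn -signr_odd expr0 mul1r.
Qed.

End fourth_power.

Section L4_estimate.
Variable R : realType.
Local Notation leb := (@lebesgue3 R).
Local Notation L2 := (@L2 _ (R3 R) R leb).
Variable M : R.
Variable c : R.
Hypothesis c_ge : 1000 <= c.
Hypothesis M1 : 1 <= M.
Hypothesis bumpM : forall s : R, `|bump s| <= M /\ `|step_diff s| <= M.

Let M0 : 0 <= M. Proof. by apply: le_trans M1. Qed.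
Let two_gt0 n : 0 < 2 ^+ n :> R. Proof. by rewrite exprn_gt0. Qed.

Lemma L2_dot_le_h1dot (u : H1rad R) :
  L2_dot (h1pair u).1 (h1pair u).1 <= h1dot u u.
Proof.
rewrite L2_dot_h1dot lerDl; apply: sumr_ge0 => i _; exact: L2_dot_ge0.
Qed.

Lemma L2_dot_partial_le_h1dot i (u : H1rad R) :
  L2_dot ((h1pair u).2 i) ((h1pair u).2 i) <= h1dot u u.
Proof.
rewrite L2_dot_h1dot (bigD1 i)//= addrCA lerDl addr_ge0 ?L2_dot_ge0//.
by apply: sumr_ge0 => j _; exact: L2_dot_ge0.
Qed.

Lemma int4_le_conv (v : L2) K A r : bounded_kernel K A r ->
  int4_le (conv v K) (A ^+ 4 * ((2 * r) ^+ 3) ^+ 3 * L2_dot v v ^+ 2).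
Proof.
move=> bK; split; last exact: conv_L4_bound bK.
by case: bK => mK _ _ _; apply: measurable_conv => //; exact: L2_measurable.
Qed.

Let C0 : R := 4 ^+ 13 * M ^+ 12.
Let C0_ge0 : 0 <= C0. Proof. by rewrite mulr_ge0// exprn_ge0. Qed.

(** The decay [1 / N] comes from [(N ^ 2) ^ 4] for the kernel against
    [(1 / N ^ 3) ^ 3] for the volumes. *)
Lemma int4_le_scale_diff (u : H1rad R) (N : R) : 0 < N ->
  int4_le (fun x => conv u (mollifier (2 * N)) x - conv u (mollifier N) x)
    ((2 * c + c ^+ 2) * C0 * h1dot u u ^+ 2 / N).
Proof.
move=> N0.
have h i : int4_le (conv (partial i u) (corrector N i)) (C0 * h1dot u u ^+ 2 / N).
  have := int4_le_conv ((h1pair u).2 i) (corrector_kernel M1 bumpM N0 i).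
  apply: int4_leW.
  have -> : (4 * N ^+ 2 * M ^+ 3) ^+ 4 * ((2 * (2 / N)) ^+ 3) ^+ 3 = C0 / N.
    by rewrite /C0; field; rewrite gt_eqF.
  rewrite [leRHS]mulrAC; apply: ler_wpM2l; first by rewrite divr_ge0// ltW.
  by apply: lerXn2r; rewrite ?nnegrE ?L2_dot_ge0 ?h1dot_ge0// L2_dot_partial_le_h1dot.
have H := int4_leN (int4_leD c_ge (h ord0)
  (int4_leD c_ge (h (lift ord0 ord0)) (h (lift ord0 (lift ord0 ord0))))).
apply: int4_le_ext (int4_leW _ H) => [x|].
  rewrite (conv_mollifier_diff bumpM N0) !big_ord_recl big_ord0 addr0.
  by [].
have : 0 <= C0 * h1dot u u ^+ 2 / N.
  by rewrite mulr_ge0 ?invr_ge0 ?(ltW N0)// mulr_ge0// sqr_ge0.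
rewrite -[_ * C0 * _]mulrA -[_ * (C0 * _) / N]mulrA.
by move: (C0 * _ / N) => X X0; move: c_ge => h1; nra.
Qed.

(** Telescoping from fine to coarse scales: each step costs a factor [3 / 2]
    and gains a factor [1 / 2], whence a bound independent of [n]. *)
Lemma int4_le_dyadic_diff (u : H1rad R) n j :
  int4_le (fun x => conv u (mollifier (2 ^+ (n + j))) x - conv u (mollifier (2 ^+ j)) x)
    (4 * c * (2 * c + c ^+ 2) * C0 * h1dot u u ^+ 2 / 2 ^+ j).
Proof.
have c0 : 0 <= c by move: c_ge; lra.
have E0 : 0 <= h1dot u u ^+ 2 by rewrite sqr_ge0.
have B0 : 0 <= (2 * c + c ^+ 2) * C0 * h1dot u u ^+ 2.
  by rewrite mulr_ge0// mulr_ge0// addr_ge0 ?sqr_ge0// mulr_ge0.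
have split_const i : 4 * c * (2 * c + c ^+ 2) * C0 * h1dot u u ^+ 2 / 2 ^+ i =
    4 * c * ((2 * c + c ^+ 2) * C0 * h1dot u u ^+ 2 / 2 ^+ i) by rewrite !mulrA.
have p0 i : 0 <= (2 * c + c ^+ 2) * C0 * h1dot u u ^+ 2 / 2 ^+ i.
  by rewrite mulr_ge0 ?invr_ge0 ?exprn_ge0.
elim: n j => [|n IH] j.
  split.
    apply: measurable_funB; apply: measurable_conv; try exact: L2_measurable.
    - by case: (mollifier_kernel bumpM (two_gt0 (0 + j))).
    - by case: (mollifier_kernel bumpM (two_gt0 j)).
  rewrite integral0_eq => [|x _]; last by rewrite subrr expr0n.
  by rewrite lee_fin split_const mulr_ge0// mulr_ge0.
have h := int4_leD c_ge (IH j.+1) (int4_le_scale_diff u (two_gt0 j)).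
apply: int4_le_ext (int4_leW _ h) => [x|].
  by rewrite addnS addSn -exprS addrA subrK.
have -> : 4 * c * (2 * c + c ^+ 2) * C0 * h1dot u u ^+ 2 / 2 ^+ j.+1 =
    2 * c * ((2 * c + c ^+ 2) * C0 * h1dot u u ^+ 2 / 2 ^+ j).
  rewrite split_const (exprS 2 j); move: (_ * _ ^+ 2) (two_gt0 j) => X /gt_eqF h2.
  by field; rewrite h2.
rewrite split_const.
move: (_ / 2 ^+ j) (p0 j) => X X0; have : 0 <= c * X by rewrite mulr_ge0.
by lra.
Qed.

Definition L4_constant : R := 3 / 2 * (4 * c * (2 * c + c ^+ 2) * C0) + c * (M ^+ 12 * 64 ^+ 3).

Lemma int4_le_dyadic (u : H1rad R) n :
  int4_le (conv u (mollifier (2 ^+ n))) (L4_constant * h1dot u u ^+ 2).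
Proof.
have h0 : int4_le (conv u (mollifier (2 ^+ 0))) (M ^+ 12 * 64 ^+ 3 * h1dot u u ^+ 2).
  apply: int4_leW (int4_le_conv (h1pair u).1 (mollifier_kernel bumpM (two_gt0 0))).
  rewrite expr0 (_ : (1 * M * (1 * M) * (1 * M)) ^+ 4 * ((2 * (2 / 1)) ^+ 3) ^+ 3 =
    M ^+ 12 * 64 ^+ 3); last by field.
  apply: ler_wpM2l; first by rewrite mulr_ge0// exprn_ge0.
  by apply: lerXn2r; rewrite ?nnegrE ?L2_dot_ge0 ?h1dot_ge0// L2_dot_le_h1dot.
have h := int4_leD c_ge (int4_le_dyadic_diff u n 0) h0.
apply: int4_le_ext (int4_leW _ h) => [x|]; first by rewrite addn0 subrK.
rewrite expr0 divr1 /L4_constant.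
move: (4 * c * (2 * c + c ^+ 2) * C0) (M ^+ 12 * 64 ^+ 3) (h1dot u u ^+ 2) => X Y Z.
by rewrite le_eqVlt; apply/orP; left; apply/eqP; ring.
Qed.

(** The embedding of [H^1] into [L^4]: a subsequence of the dyadic
    mollifications converges almost everywhere, and Fatou's lemma transfers
    their uniform bound. *)
Lemma int4_le_H1rad (u : H1rad R) : int4_le u (L4_constant * h1dot u u ^+ 2).
Proof.
split; first exact: L2_measurable.
pose v := (h1pair u).1.
have cv := dyadic_mollification_cvg M1 bumpM v.
have /choice[k kP] m : exists n, L2_dot (dyadic_mollification bumpM n v - v)
    (dyadic_mollification bumpM n v - v) <= 16^-1 ^+ m / 4.
  have /cvgrPdist_le/(_ (16^-1 ^+ m / 4)) := cv.
  rewrite divr_gt0 ?exprn_gt0// => /(_ isT)[N _ /(_ N (leqnn N))] /=.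
  by rewrite sub0r normrN ger0_norm ?L2_dot_ge0//; exists N.
pose w m := dyadic_mollification bumpM (k m) v.
have [|l [wl wL]] := @L2_fast_cauchy_cvg _ _ _ leb w.
  move=> m; have -> : w m.+1 - w m = (w m.+1 - v) + (v - w m) by rewrite addrA subrK.
  apply: le_trans (L2_sqr_triangle _ _) _.
  rewrite -(opprB (w m)) L2dotNl L2dotNr opprK.
  have h1 := kP m; have h2 := kP m.+1.
  have h3 : (16^-1 : R) ^+ m.+1 <= 16^-1 ^+ m.
    by rewrite ler_wiXn2l ?invr_ge0 ?invf_le1 ?ler1n.
  by rewrite -!/(w _) in h1 h2; lra.
have lv : l = v.
  apply/eqP; rewrite -subr_eq0; apply/eqP/L2_dot_eq0.
  have lim0 : 2 * L2_dot (w m - l) (w m - l) + 2 * (16^-1 ^+ m / 4) @[m --> \oo] --> (0 : R).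
    rewrite -[X in _ --> X](addr0 0); apply: cvgD.
      by rewrite -[X in _ --> X](mulr0 2); exact: cvgMr.
    rewrite -[X in _ --> X](mulr0 2); apply: cvgMr.
    rewrite -[X in _ --> X](mul0r 4^-1); apply: cvgMl; apply: cvg_expr.
    by rewrite ger0_norm ?invr_ge0 ?invf_lt1 ?ltr1n.
  apply/eqP; rewrite eq_le L2_dot_ge0 andbT.
  apply: (cvgr_to_ge lim0); apply: nearW => m.
  have -> : l - v = (w m - v) + (l - w m) by rewrite [RHS]addrC addrA subrK.
  apply: le_trans (L2_sqr_triangle _ _) _.
  rewrite -(opprB (w m) l) L2dotNl L2dotNr opprK; have := kP m; rewrite -/(w m); lra.
pose f m x := ((conv u (mollifier (2 ^+ (k m))) x) ^+ 4)%:E.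
have mf m : measurable_fun setT (f m).
  have [mc _] := int4_le_dyadic u (k m).
  by apply/measurable_EFinP; exact: measurable_funX.
have f0 m x : (0 <= f m x)%E by rewrite lee_fin exprn_even_ge0.
have fl : {ae leb, forall x, (u x ^+ 4)%:E = limn_einf (f^~ x)}.
  have wE : {ae leb, forall x, forall m, w m x = conv u (mollifier (2 ^+ (k m))) x}.
    by apply: ae_foralln => m; exact: dyadic_mollificationE.
  apply: filter_app wl; apply: filterS wE => x wx wlx.
  rewrite lv in wlx.
  have cx : f m x @[m --> \oo] --> (u x ^+ 4)%:E.
    apply: cvg_EFin; first exact: nearW.
    have c1 : conv u (mollifier (2 ^+ (k m))) x @[m --> \oo] --> u x.
      by apply: cvg_trans wlx; apply: near_eq_cvg; apply: nearW => m; rewrite wx.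
    exact: (cvg_comp _ _ c1 (@exprn_continuous R 4 (u x))).
  by have [<- _] := cvg_limn_einf_sup cx.
have mu4 : measurable_fun setT (fun x => (u x ^+ 4)%:E).
  by apply/measurable_EFinP; apply: measurable_funX; exact: L2_measurable.
rewrite (@ae_eq_integral _ _ _ leb setT (fun x => limn_einf (f^~ x))) //; last 2 first.
- by apply: measurableT_comp => //; apply: measurable_fun_limn_esup => m; exact: measurableT_comp.
- by apply: filterS fl => x h _.
apply: (le_trans (fatou leb measurableT mf (fun m x _ => f0 m x))).
rewrite limn_einf_lim; apply: lime_le; first exact: is_cvg_einfs.
apply: nearW => m; apply: (@le_trans _ _ (\int[leb]_x f m x)%E).
  by apply: ereal_inf_lbound; exists m => //=.
by have [] := int4_le_dyadic u (k m).
Qed.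

End L4_estimate.

Lemma H1rad_L4 (R : realType) : exists2 C : R, 0 <= C & forall u : H1rad R,
  (@lebesgue3 R).-integrable setT (fun x => (u x ^+ 4)%:E) /\
  \int[@lebesgue3 R]_x (u x ^+ 4) <= C * h1dot u u ^+ 2.
Proof.
have [M [M1 bM]] := bump_step_diff_bounded R.
exists `|L4_constant M 1000| => // u; move: (lexx (1000 : R)); move: {-1}(1000 : R) => c c1.
have := int4_le_H1rad c1 M1 bM u.
move/(int4_leW (ler_wpM2r (sqr_ge0 (h1dot u u)) (ler_norm _))) => [mu4 u4].
have i4 : (@lebesgue3 R).-integrable setT (fun x => (u x ^+ 4)%:E).
  apply/integrableP; split; first by apply/measurable_EFinP; exact: measurable_funX.
  under eq_integral => x _ do rewrite /= ger0_norm ?exprn_even_ge0//.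
  exact: le_lt_trans u4 (ltry _).
split => //; rewrite -lee_fin fineK//.
exact: integrable_fin_num.
Qed.

(** * Dilations of the radial Sobolev space *)

Section scaled_test_functions.
Variable R : realType.

Lemma dnbhs0_scale (m : R) : 0 < m -> m * h @[h --> 0^'] --> 0^'.
Proof.
move=> m0 A /nbhs_ballP[e /= e0 eA]; apply/nbhs_ballP; exists (e / m); first exact: divr_gt0.
move=> h /=; rewrite -ball_normE/= sub0r normrN ltr_pdivlMr// => hm h0.
apply: eA; last by rewrite mulf_neq0// gt_eqF.
by rewrite -ball_normE/= sub0r normrN normrM (gtr0_norm m0) mulrC.
Qed.

(** Only derivability in the direction [v] is assumed, so the chain rule is
    checked on the difference quotients. *)
Lemma is_derive_scale (f : R3 R -> R) (v x : R3 R) (m : R) : 0 < m ->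
  derivable f (m *: x) v ->
  is_derive x v (fun x => f (m *: x)) (m * 'D_v f (m *: x)).
Proof.
move=> m0 dv.
suff h : h^-1 *: (((fun x => f (m *: x)) \o shift x) (h *: v) - f (m *: x))
    @[h --> 0^'] --> m * 'D_v f (m *: x).
  by apply: DeriveDef; [apply/cvg_ex; eexists; exact: h|exact: (cvg_lim _ h)].
have H : m * ((m * h)^-1 *: ((f \o shift (m *: x)) ((m * h) *: v) - f (m *: x)))
    @[h --> 0^'] --> m * 'D_v f (m *: x).
  by apply: cvgMr; exact: (cvg_comp _ _ (dnbhs0_scale m0) dv).
apply: cvg_trans H; apply: near_eq_cvg; apply: nearW => h /=.
rewrite [m *: (_ + _)]scalerDr [m *: (h *: v)]scalerA.
rewrite -[_ *: (_ - _)]/(_ * _) -[h^-1 *: _]/(_ * _).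
by rewrite invfM !mulrA mulfV ?gt_eqF// mul1r.
Qed.

Lemma Ck_scale k (f : R3 R -> R) (m : R) : 0 < m -> Ck k f -> Ck k (fun x => f (m *: x)).
Proof.
have cs (g : R3 R -> R) : continuous g -> continuous (fun x => g (m *: x)).
  move=> cg x; have h : m *: y @[y --> x] --> m *: x by exact: (@scaler_continuous _ (R3 R) m x).
  exact: (cvg_comp _ g h (cg _)).
move=> m0; elim: k f => [|k IH] f; first by move=> [cf _]; split => //; exact: cs.
move=> [cf df]; split; first exact: cs.
move=> i; have [df1 df2] := df i; split.
  by move=> x; case: (is_derive_scale m0 (df1 (m *: x))).
rewrite (_ : (fun x => 'D_(basis3 R i) _ x) = fun x => m * 'D_(basis3 R i) f (m *: x)).
  have Ckm j g : Ck j g -> Ck j (fun x => m * g x).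
    elim: j g => [|j IHj] g [cg dg].
      by split => // x; apply: cvgMr; exact: cg.
    split; first by move=> x; apply: cvgMr; exact: cg.
    move=> l; have [dg1 dg2] := dg l; split.
      by move=> x; exact: (derivableZ (dg1 x)).
    rewrite (_ : (fun x => _) = fun x => m * 'D_(basis3 R l) g x); first exact: (IHj _ dg2).
    by apply/funext => x; exact: (deriveZ m (dg1 x)).
  exact: Ckm (IH _ df2).
by apply/funext => x; case: (is_derive_scale m0 (df1 (m *: x))).
Qed.

Lemma test_function_scale (f : R3 R -> R) (m : R) : 0 < m ->
  test_function f -> test_function (fun x => f (m *: x)).
Proof.
move=> m0 [kf cf]; split => [k|]; first exact: Ck_scale.
have [M [_ /(_ (`|M| + 1)) hM]] := compact_bounded cf.
have {}hM x : f x != 0 -> `|x| <= `|M| + 1.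
  by move=> fx; apply: hM; [rewrite ltr_pwDr// ler_norm|exact: subset_closure].
apply: (subclosed_compact _ (@R3_closed_ball_compact R ((`|M| + 1) / m))).
  exact: closed_closure.
apply: subset_trans (_ : closure [set x : R3 R | `|x| <= (`|M| + 1) / m] `<=` _).
  apply: closure_subset => x /= /hM; rewrite normrZ (gtr0_norm m0).
  by rewrite ler_pdivlMr// mulrC.
suff /closure_id <- : closed [set x : R3 R | `|x| <= (`|M| + 1) / m] by [].
exact: (compact_closed (@norm_hausdorff _ _) (@R3_closed_ball_compact R _)).
Qed.

End scaled_test_functions.

Section H1_dilation.
Variable R : realType.
Local Notation leb := (@lebesgue3 R).
Local Notation L2 := (@L2 _ (R3 R) R leb).

Lemma Lfun2_comp_scale l (k : R3 R -> R) : 0 < l -> k \in Lfun leb 2%:E ->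
  (fun x : R3 R => k (l *: x)) \in Lfun leb 2%:E.
Proof.
move=> l0 k2; have s0 : 0 < Num.sqrt (l ^+ 3) by rewrite sqrtr_gt0 exprn_gt0.
have := Lfun2_lin (Num.sqrt (l ^+ 3))^-1 (dil_Lfun l k2) (Lfun2_0 leb).
rewrite (_ : (fun x : R3 R => k (l *: x)) =
  fun x => (Num.sqrt (l ^+ 3))^-1 * dil_fun l k x + 0)//.
by apply/funext => x; rewrite addr0 /dil_fun mulKf// gt_eqF.
Qed.

Lemma L2_dil_int l (u : L2) (k : R3 R -> R) : 0 < l -> k \in Lfun leb 2%:E ->
  \int[leb]_x (L2_dil l u x * k (l *: x)) =
  (Num.sqrt (l ^+ 3))^-1 * \int[leb]_x (u x * k x).
Proof.
move=> l0 k2; have s0 : 0 < Num.sqrt (l ^+ 3) by rewrite sqrtr_gt0 exprn_gt0.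
have k2' := Lfun2_comp_scale l0 k2.
rewrite -(L2_dot_mk u k2) -(L2_dot_dil u _ l0) -(L2_dot_mk _ k2').
rewrite -L2dotZr; apply: congr1; apply: L2_ext.
apply: filter_app (L2_mkE k2'); apply: filter_app (L2_dil_ae l0 (L2_mkE k2)).
apply: filterS (L2Z (Num.sqrt (l ^+ 3))^-1 (L2_dil l (L2_mk k2))) => x -> -> ->.
by rewrite /dil_fun mulKf// gt_eqF.
Qed.

(** Testing against [phi] amounts to testing the original function against
    [phi (x / l)]; differentiating the latter produces the factor [l]. *)
Lemma weak_partial_dil i l (u g : L2) : 0 < l -> weak_partial i u g ->
  weak_partial i (L2_dil l u) (l *: L2_dil l g).
Proof.
move=> l0 ug phi tphi.
have l'0 : 0 < l^-1 by rewrite invr_gt0.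
pose psi x := phi (l^-1 *: x); have tpsi : test_function psi by exact: test_function_scale.
have lK x : l^-1 *: (l *: x) = x by rewrite scalerA mulVf ?gt_eqF// scale1r.
have dE x : 'D_(basis3 R i) phi x = l * 'D_(basis3 R i) psi (l *: x).
  have d1 : derivable phi (l^-1 *: (l *: x)) (basis3 R i).
    by have [/(_ 1%N)[_ /(_ i)[d _]] _] := tphi.
  have [_ ->] := is_derive_scale l'0 d1.
  by rewrite lK mulrA mulfV ?gt_eqF// mul1r.
have d2 := test_partial_Lfun i tpsi; have p2 := test_function_Lfun tpsi.
have -> : \int[leb]_x (L2_dil l u x * 'D_(basis3 R i) phi x) =
    l * \int[leb]_x (L2_dil l u x * 'D_(basis3 R i) psi (l *: x)).
  rewrite -RintegralZl//; last first.
    exact: L2_integrableM (L2_Lfun _) (Lfun2_comp_scale l0 d2).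
  by apply: eq_Rintegral => x _; rewrite dE mulrCA.
rewrite (L2_dil_int u l0 d2) ug//.
rewrite -(L2_dot_mk (l *: _) (test_function_Lfun tphi)) L2dotZl L2_dot_mk.
have -> : \int[leb]_x (L2_dil l g x * phi x) = \int[leb]_x (L2_dil l g x * psi (l *: x)).
  by apply: eq_Rintegral => x _; rewrite /psi lK.
by rewrite (L2_dil_int g l0 p2) !mulrN.
Qed.

Lemma radial_dil l (u : L2) : 0 < l -> radial u -> radial (L2_dil l u).
Proof.
move=> l0 [g ug]; exists (fun r => Num.sqrt (l ^+ 3) * g (l * r)).
apply: filterS (L2_dil_ae l0 ug) => x ->; rewrite /dil_fun; congr (_ * g _).
have -> : l * euclid x = `|l| * euclid x by rewrite gtr0_norm.
rewrite /euclid -sqrtr_sqr -sqrtrM ?sqr_ge0//.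
by congr Num.sqrt; rewrite /= /GRing.scale/=; ring.
Qed.

Definition H1dil_pair (l : R) (u : H1rad R) : L2 * {ffun 'I_3 -> L2} :=
  (L2_dil l (h1pair u).1, [ffun i => l *: L2_dil l ((h1pair u).2 i)]).

(** For [l <= 0] the pair is zero, hence the definition is total. *)
Lemma H1dil_subproof l u : H1dil_pair l u \in @H1rad_mem R.
Proof.
have [l0|l0] := leP l 0.
  suff -> : H1dil_pair l u = 0 by have [] := @H1rad_submod_closed R.
  rewrite /H1dil_pair L2_dil_le0//; congr pair; apply/ffunP => i.
  by rewrite !ffunE L2_dil_le0// scaler0.
have /asboolP[wu ru] := h1pairP u.
apply/asboolP; split => [i|]; last exact: radial_dil.
by rewrite ffunE; exact: weak_partial_dil.
Qed.

Definition H1dil l u : H1rad R := MkH1rad (H1dil_subproof l u).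

Lemma H1dil_lin l a u v : H1dil l (a *: u + v) = a *: H1dil l u + H1dil l v.
Proof.
apply: val_inj; rewrite [LHS]/(H1dil_pair _ _) [RHS](h1pair_lin a (H1dil l u) (H1dil l v)).
rewrite /H1dil_pair !h1pair_lin; congr pair; first exact: L2_dil_lin.
by apply/ffunP => i; rewrite !ffunE L2_dil_lin scalerDr !scalerA mulrC.
Qed.

Lemma H1dil1 u : H1dil 1 u = u.
Proof.
apply: val_inj; rewrite [LHS]/(H1dil_pair _ _) /H1dil_pair L2_dil1.
case: u => [[u g] ug] /=; congr pair; apply/ffunP => i.
by rewrite ffunE scale1r L2_dil1.
Qed.

Lemma h1dot_H1dil_le l u : h1dot (H1dil l u) (H1dil l u) <= (1 + l ^+ 2) * h1dot u u.
Proof.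
rewrite !L2_dot_h1dot mulrDr; apply: lerD.
  apply: le_trans (L2_dil_bound _ _) _; rewrite ler_peMl ?L2_dot_ge0//.
  by rewrite lerDl sqr_ge0.
rewrite mulr_sumr; apply: ler_sum => i _; rewrite ffunE L2dotZl L2dotZr mulrA -expr2.
apply: le_trans (ler_wpM2l (sqr_ge0 l) (L2_dil_bound _ _)) _.
by rewrite ler_wpM2r ?L2_dot_ge0// lerDr.
Qed.

(** The gradient part is [l] times a strongly continuous family. *)
Lemma H1dil_continuous (l0 : R) u : 0 < l0 ->
  h1dot (H1dil l u - H1dil l0 u) (H1dil l u - H1dil l0 u) @[l --> l0] --> (0 : R).
Proof.
move=> l0_gt0.
have part (v : L2) : 2 * (l ^+ 2 * L2_dot (L2_dil l v - L2_dil l0 v) (L2_dil l v - L2_dil l0 v)) +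
    2 * ((l - l0) ^+ 2 * L2_dot (L2_dil l0 v) (L2_dil l0 v)) @[l --> l0] --> (0 : R).
  rewrite -[X in _ --> X](addr0 0); apply: cvgD.
    rewrite -[X in _ --> X](mulr0 2); apply: cvgMr; rewrite -[X in _ --> X](mulr0 (l0 ^+ 2)); apply: cvgM.
      exact: exprn_continuous.
    exact: L2_dil_continuous.
  rewrite -[X in _ --> X](mulr0 2); apply: cvgMr; rewrite -[X in _ --> X](mul0r (L2_dot (L2_dil l0 v) (L2_dil l0 v))); apply: cvgMl.
  have h : (l - l0) @[l --> l0] --> (0 : R).
    by rewrite -[X in _ --> X](subrr l0); apply: cvgB => //; exact: cvg_cst.
  have := (cvg_comp _ _ h (@exprn_continuous R 2 0)).
  by rewrite expr0n/=.
have := cvgD (L2_dil_continuous (h1pair u).1 l0_gt0) (cvgD (part ((h1pair u).2 ord0))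
  (cvgD (part ((h1pair u).2 (lift ord0 ord0))) (part ((h1pair u).2 (lift ord0 (lift ord0 ord0)))))).
rewrite !addr0 => H.
have {}H := H (nbhs_filter _) (nbhs_filter _) (nbhs_filter _).
apply: (@squeeze_cvgr _ _ _ _ (fun=> 0) _ _ _ 0 _ H); last exact: cvg_cst.
apply: nearW => l.
rewrite h1dot_ge0/= L2_dot_h1dot h1pairB/=; apply: lerD; first by [].
rewrite !big_ord_recl big_ord0 addr0.
have part_le (v : L2) : L2_dot (l *: L2_dil l v - l0 *: L2_dil l0 v) (l *: L2_dil l v - l0 *: L2_dil l0 v) <=
    2 * (l ^+ 2 * L2_dot (L2_dil l v - L2_dil l0 v) (L2_dil l v - L2_dil l0 v)) +
    2 * ((l - l0) ^+ 2 * L2_dot (L2_dil l0 v) (L2_dil l0 v)).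
  have -> : l *: L2_dil l v - l0 *: L2_dil l0 v =
      l *: (L2_dil l v - L2_dil l0 v) + (l - l0) *: L2_dil l0 v.
    by rewrite scalerBr scalerBl addrA subrK.
  apply: le_trans (L2_sqr_triangle _ _) _.
  have dotZZ (a : R) (w : L2) : L2_dot (a *: w) (a *: w) = a ^+ 2 * L2_dot w w.
    by rewrite L2dotZl L2dotZr mulrA.
  by rewrite !dotZZ.
by rewrite !ffunE; apply: lerD; [|apply: lerD]; exact: part_le.
Qed.

End H1_dilation.

(** * The quartic term as a 4-linear form *)

Section quadrilinear_form.
Variable R : realType.
Local Notation leb := (@lebesgue3 R).
Local Notation H := (H1rad R).
Implicit Types a b c d u v : H.

Definition h1dotZl := dotZl (@h1dot_lin R).
Definition h1dotBl := dotBl (@h1dot_lin R).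
Definition h1dotZr := dotZr (@h1dotC R) (@h1dot_lin R).
Definition h1dotBr := dotBr (@h1dotC R) (@h1dot_lin R).

Lemma h1norm_sqr u : h1norm u ^+ 2 = h1dot u u.
Proof. by rewrite sqr_sqrtr ?h1dot_ge0. Qed.

Lemma h1norm_ge0 u : 0 <= h1norm u. Proof. exact: sqrtr_ge0. Qed.

Lemma h1fun_measurable u : measurable_fun setT u.
Proof. exact: L2_measurable. Qed.

Lemma h1fun_lin (k : R) u v : {ae leb, forall x, (k *: u + v : H) x = k * u x + v x}.
Proof.
rewrite /h1fun h1pair_lin; apply: filter_app (L2D (k *: (h1pair u).1) (h1pair v).1).
by apply: filterS (L2Z k (h1pair u).1) => x -> ->.
Qed.

(** By the [L^4] embedding, as [2 (u v) ^ 2 <= u ^ 4 + v ^ 4]. *)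
Lemma H1_mul_Lfun u v : (fun x => u x * v x) \in Lfun leb 2%:E.
Proof.
have [C _ L4] := H1rad_L4 R; have [u4 _] := L4 u; have [v4 _] := L4 v.
apply/Lfun2P; split; first by apply: measurable_funM; exact: h1fun_measurable.
apply: le_integrable (integrableD measurableT u4 v4) => //.
  apply/measurable_EFinP; apply: measurable_funX.
  by apply: measurable_funM; exact: h1fun_measurable.
move=> x _; rewrite /= lee_fin.
rewrite ger0_norm ?sqr_ge0// ger0_norm ?addr_ge0 ?exprn_even_ge0//.
by have := sqr_ge0 (u x ^+ 2 - v x ^+ 2); have := sqr_ge0 (u x ^+ 2); have := sqr_ge0 (v x ^+ 2); nra.
Qed.

Definition quad a b c d : R := \int[leb]_x (a x * b x * c x * d x).

Lemma quad_integrable a b c d :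
  leb.-integrable setT (EFin \o (fun x => a x * b x * c x * d x)).
Proof.
have := L2_integrableM (H1_mul_Lfun a b) (H1_mul_Lfun c d).
by apply: eq_integrable => // x _; rewrite /= mulrA.
Qed.

Lemma quadC12 a b c d : quad a b c d = quad b a c d.
Proof. by apply: eq_Rintegral => x _; ring. Qed.

Lemma quadC23 a b c d : quad a b c d = quad a c b d.
Proof. by apply: eq_Rintegral => x _; ring. Qed.

Lemma quadC34 a b c d : quad a b c d = quad a b d c.
Proof. by apply: eq_Rintegral => x _; ring. Qed.

Let mquad a b c d : measurable_fun setT (fun x => a x * b x * c x * d x).
Proof. by have /integrableP[/measurable_EFinP] := quad_integrable a b c d. Qed.

Lemma quad_lin k u v b c d :
  quad (k *: u + v) b c d = k * quad u b c d + quad v b c d.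
Proof.
rewrite /quad -RintegralZl//; last exact: quad_integrable.
rewrite -RintegralD//; last 2 first.
- exact: (integrableZl measurableT k (quad_integrable u b c d)).
- exact: quad_integrable.
apply: ae_eq_Rintegral => //.
- by apply: measurable_funD => //; exact: measurable_funM.
- by apply: filterS (h1fun_lin k u v) => x ->; ring.
Qed.

(** Two applications of Cauchy-Schwarz and the [L^4] embedding. *)
Lemma quad_bound : exists2 C : R, 0 <= C & forall a b c d,
  `|quad a b c d| <= C * (h1norm a * h1norm b * (h1norm c * h1norm d)).
Proof.
have [C C0 L4] := H1rad_L4 R; exists C => // a b c d.
pose m u v := L2_mk (H1_mul_Lfun u v).
have mE u v u' v' : L2_dot (m u v) (m u' v') = quad u v u' v'.
  rewrite (L2_dotE _ _ (L2_mkE _) (L2_mkE _)).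
  - by apply: eq_Rintegral => x _; rewrite mulrA.
  - by apply: measurable_funM; exact: h1fun_measurable.
  - by apply: measurable_funM; exact: h1fun_measurable.
have q4 u : 0 <= quad u u u u <= C * (h1norm u ^+ 2) ^+ 2.
  rewrite -mE L2_dot_ge0 mE h1norm_sqr; have [_ ] := L4 u.
  by congr (_ <= _); apply: eq_Rintegral => x _; ring.
have q22 u v : 0 <= quad u v u v <= C * (h1norm u * h1norm v) ^+ 2.
  rewrite -mE L2_dot_ge0 mE/=.
  have h : 0 <= quad u v u v by rewrite -mE L2_dot_ge0.
  have r0 : 0 <= C * (h1norm u * h1norm v) ^+ 2 by rewrite mulr_ge0 ?sqr_ge0.
  rewrite -(ler_pXn2r (_ : 0 < 2)%N)//.
  have -> : quad u v u v = L2_dot (m u u) (m v v) by rewrite mE quadC23.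
  apply: le_trans (L2_CauchySchwarz _ _) _; rewrite !mE.
  have -> : (C * (h1norm u * h1norm v) ^+ 2) ^+ 2 =
    (C * (h1norm u ^+ 2) ^+ 2) * (C * (h1norm v ^+ 2) ^+ 2) by ring.
  have /andP[u1 u2] := q4 u; have /andP[v1 v2] := q4 v.
  exact: ler_pM.
have n0 := h1norm_ge0.
rewrite -(ler_pXn2r (_ : 0 < 2)%N) ?nnegrE//; last by rewrite !mulr_ge0.
rewrite real_normK ?num_real// -mE; apply: le_trans (L2_CauchySchwarz _ _) _.
have -> : (C * (h1norm a * h1norm b * (h1norm c * h1norm d))) ^+ 2 =
  (C * (h1norm a * h1norm b) ^+ 2) * (C * (h1norm c * h1norm d) ^+ 2) by ring.
rewrite !mE; have /andP[u1 u2] := q22 a b; have /andP[v1 v2] := q22 c d.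
exact: ler_pM.
Qed.

Lemma h1fun_dil l u : {ae leb, forall x, H1dil l u x = dil_fun l u x}.
Proof. exact: L2_dilE. Qed.

(** Four factors [l ^ (3/2)] against the Jacobian [l ^ 3]. *)
Lemma quad_dil (l : R) a b c d : 0 < l ->
  quad (H1dil l a) (H1dil l b) (H1dil l c) (H1dil l d) = l ^+ 3 * quad a b c d.
Proof.
move=> l0; have l30 : 0 < l ^+ 3 by rewrite exprn_gt0.
have qi := quad_integrable a b c d.
have qs := integrable_scales l30 (lebesgue3_scales l0) qi.
have mdil u : measurable_fun setT (dil_fun l u).
  by apply: measurable_dil_fun => //; exact: h1fun_measurable.
rewrite /quad [in RHS](Rintegral_scales l30 (lebesgue3_scales l0) qi).
rewrite -!RintegralZl//; last 1 first.
  exact: (integrableZl measurableT (l ^+ 3) qs).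
apply: ae_eq_Rintegral => //.
  have [ml _] := lebesgue3_scales l0.
  do 2!apply: measurable_funM => //.
  exact: (measurableT_comp (mquad a b c d) ml).
apply: filter_app (h1fun_dil l d); apply: filter_app (h1fun_dil l c).
apply: filter_app (h1fun_dil l b); apply: filterS (h1fun_dil l a) => x -> -> -> ->.
have key (s t A B C D : R) : s ^+ 2 = t ->
    s * A * (s * B) * (s * C) * (s * D) = t * (t * (A * B * C * D)).
  by move=> <-; ring.
exact: (key _ _ _ _ _ _ (sqr_sqrtr (ltW l30))).
Qed.

Definition mass u v : R := L2_dot (h1pair u).1 (h1pair v).1.

Lemma mass_sqr u : mass u u = \int[leb]_x (u x ^+ 2).
Proof. by apply: eq_Rintegral => x _; rewrite expr2. Qed.

Lemma massC u v : mass u v = mass v u. Proof. exact: L2_dotC. Qed.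

Lemma mass_lin k u v w : mass (k *: u + v) w = k * mass u w + mass v w.
Proof. by rewrite /mass h1pair_lin L2_dot_lin. Qed.

Lemma mass_ge0 u : 0 <= mass u u. Proof. exact: L2_dot_ge0. Qed.

Lemma mass_dil (l : R) u v : 0 < l -> mass (H1dil l u) (H1dil l v) = mass u v.
Proof. exact: L2_dot_dil. Qed.

Definition dirichlet u v : R := \sum_i L2_dot ((h1pair u).2 i) ((h1pair v).2 i).

Lemma h1dotE u v : h1dot u v = mass u v + dirichlet u v.
Proof. by []. Qed.

Lemma dirichlet_ge0 u : 0 <= dirichlet u u.
Proof. by apply: sumr_ge0 => i _; exact: L2_dot_ge0. Qed.

Lemma mass_le u : mass u u <= h1dot u u.
Proof. by rewrite h1dotE lerDl dirichlet_ge0. Qed.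

Lemma dirichlet_le u : dirichlet u u <= h1dot u u.
Proof. by rewrite h1dotE lerDr mass_ge0. Qed.

Lemma dirichletC u v : dirichlet u v = dirichlet v u.
Proof. by apply: eq_bigr => i _; exact: L2_dotC. Qed.

Lemma dirichlet_lin k u v w : dirichlet (k *: u + v) w = k * dirichlet u w + dirichlet v w.
Proof.
by have := h1dot_lin k u v w; rewrite !h1dotE mass_lin; lra.
Qed.

(** Each of the two gradients contributes a factor [l]. *)
Lemma dirichlet_dil (l : R) u v : 0 < l ->
  dirichlet (H1dil l u) (H1dil l v) = l ^+ 2 * dirichlet u v.
Proof.
move=> l0; rewrite mulr_sumr; apply: eq_bigr => i _.
by rewrite !ffunE L2dotZl L2dotZr L2_dot_dil// mulrA.
Qed.

Lemma partial_sqr_integrable i u :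
  leb.-integrable setT (EFin \o (fun x => partial i u x ^+ 2)).
Proof. by apply: L2_integrableM; exact: L2_Lfun. Qed.

Lemma grad_sqrE u : grad_sqr u = fun x => partial ord0 u x ^+ 2 +
  (partial (lift ord0 ord0) u x ^+ 2 + partial (lift ord0 (lift ord0 ord0)) u x ^+ 2).
Proof. by apply/funext => x; rewrite /grad_sqr !big_ord_recl big_ord0 addr0. Qed.

Lemma grad_sqr_integrable u : leb.-integrable setT (EFin \o grad_sqr u).
Proof.
have pi := partial_sqr_integrable^~ u; rewrite grad_sqrE.
exact: (integrableD measurableT (pi _) (integrableD measurableT (pi _) (pi _))).
Qed.

Lemma dirichlet_sqr u : dirichlet u u = \int[leb]_x grad_sqr u x.
Proof.
have pi := partial_sqr_integrable^~ u.
rewrite /dirichlet grad_sqrE RintegralD//; last exact: (integrableD measurableT (pi _) (pi _)).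
by rewrite RintegralD// !big_ord_recl big_ord0 addr0.
Qed.

End quadrilinear_form.

Section forms_on_pairs.
Variable R : realType.
Local Notation leb := (@lebesgue3 R).
Local Notation E := (H1rad R * H1rad R)%type.
Implicit Types w z h : E.

Definition kin w z : R := dirichlet w.1 z.1 + dirichlet w.2 z.2.

Lemma kineticE w : kinetic w = kin w w.
Proof.
rewrite /kin !dirichlet_sqr /kinetic RintegralD//; exact: grad_sqr_integrable.
Qed.

Variables mu beta : R.

(** The polarization of the quartic part of the energy: full symmetry in the
    four arguments is what makes its Taylor expansion short. *)
Definition quad2 (w1 w2 w3 w4 : E) : R :=
  mu * (quad w1.1 w2.1 w3.1 w4.1 + quad w1.2 w2.2 w3.2 w4.2) +
  beta / 3 * (quad w1.1 w2.1 w3.2 w4.2 + quad w1.1 w2.2 w3.1 w4.2 +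
   quad w1.1 w2.2 w3.2 w4.1 + quad w1.2 w2.1 w3.1 w4.2 +
   quad w1.2 w2.1 w3.2 w4.1 + quad w1.2 w2.2 w3.1 w4.1).

Lemma quarticE w : quartic mu mu beta w = quad2 w w w w.
Proof.
have i4 (a : H1rad R) := quad_integrable a a a a.
have i22 := quad_integrable w.1 w.1 w.2 w.2.
have -> : quartic mu mu beta w = \int[leb]_x (mu * (w.1 x * w.1 x * w.1 x * w.1 x) +
  (2 * beta * (w.1 x * w.1 x * w.2 x * w.2 x) + mu * (w.2 x * w.2 x * w.2 x * w.2 x))).
  by apply: eq_Rintegral => x _; ring.
rewrite RintegralD//; last 2 first.
- exact: (integrableZl measurableT mu (i4 _)).
- exact: (integrableD measurableT (integrableZl measurableT (2 * beta) i22)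
    (integrableZl measurableT mu (i4 _))).
rewrite RintegralD//; last 2 first.
- exact: (integrableZl measurableT (2 * beta) i22).
- exact: (integrableZl measurableT mu (i4 _)).
rewrite !RintegralZl// -!/(quad _ _ _ _) /quad2.
rewrite (quadC23 w.1 w.2 w.1 w.2) (quadC12 w.2 w.1 w.1 w.2) (quadC23 w.1 w.2 w.1 w.2).
rewrite (quadC34 w.1 w.2 w.2 w.1) (quadC23 w.1 w.2 w.1 w.2).
rewrite (quadC12 w.2 w.1 w.2 w.1) (quadC34 w.1 w.2 w.2 w.1) (quadC23 w.1 w.2 w.1 w.2).
rewrite (quadC23 w.2 w.2 w.1 w.1) (quadC12 w.2 w.1 w.2 w.1) (quadC34 w.1 w.2 w.2 w.1) (quadC23 w.1 w.2 w.1 w.2).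
by move: (quad _ _ _ _) (quad _ _ _ _) (quad _ _ _ _) => x y z; field.
Qed.

Lemma quad2C12 w1 w2 w3 w4 : quad2 w1 w2 w3 w4 = quad2 w2 w1 w3 w4.
Proof. 
rewrite /quad2 !(quadC12 w2.1) !(quadC12 w2.2).
by congr (_ * _ + _ * _); do ?[move: (quad _ _ _ _) => ?]; ring.
Qed.

Lemma quad2C23 w1 w2 w3 w4 : quad2 w1 w2 w3 w4 = quad2 w1 w3 w2 w4.
Proof.
rewrite /quad2 !(quadC23 _ w3.1) !(quadC23 _ w3.2).
by congr (_ * _ + _ * _); do ?[move: (quad _ _ _ _) => ?]; ring.
Qed.

Lemma quad2C34 w1 w2 w3 w4 : quad2 w1 w2 w3 w4 = quad2 w1 w2 w4 w3.
Proof.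
rewrite /quad2 !(quadC34 _ _ w4.1) !(quadC34 _ _ w4.2).
by congr (_ * _ + _ * _); do ?[move: (quad _ _ _ _) => ?]; ring.
Qed.

Lemma quad2_lin k w w' w2 w3 w4 :
  quad2 (k *: w + w') w2 w3 w4 = k * quad2 w w2 w3 w4 + quad2 w' w2 w3 w4.
Proof. by rewrite /quad2 /= !quad_lin; do ?[move: (quad _ _ _ _) => ?]; ring. Qed.

Lemma quad2_sigma w1 w2 w3 w4 :
  quad2 (sigma w1) (sigma w2) (sigma w3) (sigma w4) = quad2 w1 w2 w3 w4.
Proof. by rewrite /quad2 /sigma /=; do ?[move: (quad _ _ _ _) => ?]; ring. Qed.

Lemma kin_sigma w z : kin (sigma w) (sigma z) = kin w z.
Proof. by rewrite /kin /sigma/= addrC. Qed.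

Lemma h1dot2_sigma w z : h1dot2 (sigma w) (sigma z) = h1dot2 w z.
Proof. by rewrite /h1dot2 /sigma/= addrC. Qed.

Lemma h1dot2C w z : h1dot2 w z = h1dot2 z w.
Proof. by rewrite /h1dot2 !(h1dotC w.1) !(h1dotC w.2). Qed.

Lemma h1dot2_lin k w w' z : h1dot2 (k *: w + w') z = k * h1dot2 w z + h1dot2 w' z.
Proof. by rewrite /h1dot2 /= !h1dot_lin; ring. Qed.

Lemma h1dot2_ge0 w : 0 <= h1dot2 w w.
Proof. by rewrite addr_ge0 ?h1dot_ge0. Qed.

Lemma kinC w z : kin w z = kin z w.
Proof. by rewrite /kin !(dirichletC w.1) !(dirichletC w.2). Qed.

Lemma kin_lin k w w' z : kin (k *: w + w') z = k * kin w z + kin w' z.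
Proof. by rewrite /kin /= !dirichlet_lin; ring. Qed.

Lemma kin_ge0 w : 0 <= kin w w.
Proof. by rewrite addr_ge0 ?dirichlet_ge0. Qed.

Lemma kin_le w : kin w w <= h1dot2 w w.
Proof. by apply: lerD; exact: dirichlet_le. Qed.

Lemma h1norm2_ge0 w : 0 <= h1norm2 w. Proof. exact: sqrtr_ge0. Qed.

Lemma h1norm2_sqr w : h1norm2 w ^+ 2 = h1dot2 w w.
Proof. by rewrite sqr_sqrtr ?h1dot2_ge0. Qed.

Lemma h1dot2_le w z : `|h1dot2 w z| <= h1norm2 w * h1norm2 z.
Proof.
rewrite -(ler_pXn2r (_ : 0 < 2)%N) ?nnegrE ?mulr_ge0 ?h1norm2_ge0//.
rewrite real_normK ?num_real// exprMn !h1norm2_sqr.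
exact: (dot_CauchySchwarz h1dot2C h1dot2_lin h1dot2_ge0).
Qed.

Lemma kin_bound w z : `|kin w z| <= h1norm2 w * h1norm2 z.
Proof.
rewrite -(ler_pXn2r (_ : 0 < 2)%N) ?nnegrE ?mulr_ge0 ?h1norm2_ge0//.
rewrite real_normK ?num_real// exprMn !h1norm2_sqr.
apply: le_trans (dot_CauchySchwarz kinC kin_lin kin_ge0 _ _) _.
by apply: ler_pM; rewrite ?kin_ge0 ?kin_le.
Qed.

Lemma h1norm2Z k w : h1norm2 (k *: w) = `|k| * h1norm2 w.
Proof.
rewrite /h1norm2 (dotZl h1dot2_lin) (dotZr h1dot2C h1dot2_lin) mulrA -expr2.
by rewrite sqrtrM ?sqr_ge0// sqrtr_sqr.
Qed.

Lemma h1norm2D w z : h1norm2 (w + z) <= h1norm2 w + h1norm2 z.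
Proof.
rewrite -(ler_pXn2r (_ : 0 < 2)%N) ?nnegrE ?addr_ge0 ?h1norm2_ge0//.
rewrite sqrrD !h1norm2_sqr (dotDl h1dot2_lin) !(dotDr h1dot2C h1dot2_lin) (h1dot2C z w).
by have := h1dot2_le w z; have := ler_norm (h1dot2 w z); lra.
Qed.

Lemma h1norm2N w : h1norm2 (- w) = h1norm2 w.
Proof. by rewrite -scaleN1r h1norm2Z normrN1 mul1r. Qed.

Lemma h1norm_fst w : h1norm w.1 <= h1norm2 w.
Proof. by rewrite ler_sqrt ?h1dot2_ge0// lerDl h1dot_ge0. Qed.

Lemma h1norm_snd w : h1norm w.2 <= h1norm2 w.
Proof. by rewrite ler_sqrt ?h1dot2_ge0// lerDr h1dot_ge0. Qed.

Lemma norm_le_h1norm2 w : `|w| <= h1norm2 w.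
Proof. by rewrite /Num.norm/= ge_max h1norm_fst h1norm_snd. Qed.

Lemma h1norm2_le_norm w : h1norm2 w <= 2 * `|w|.
Proof.
rewrite -(ler_pXn2r (_ : 0 < 2)%N) ?nnegrE ?h1norm2_ge0 ?mulr_ge0//.
have n1 : h1norm w.1 <= `|w| by rewrite /Num.norm/= le_max lexx.
have n2 : h1norm w.2 <= `|w| by rewrite /Num.norm/= le_max lexx orbT.
rewrite h1norm2_sqr /h1dot2 -!h1norm_sqr.
move: n1 n2 (h1norm_ge0 w.1) (h1norm_ge0 w.2); move: (h1norm _) (h1norm _) `|w| => x y z.
by move=> ? ? ? ?; nra.
Qed.

Lemma quad2_bound : exists2 C : R, 0 <= C & forall w1 w2 w3 w4,
  `|quad2 w1 w2 w3 w4| <= C * (h1norm2 w1 * h1norm2 w2 * (h1norm2 w3 * h1norm2 w4)).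
Proof.
have key2 (z x y : R) : x <= z -> y <= z -> x + y <= 2 * z by lra.
have key6 (z x1 x2 x3 x4 x5 x6 : R) : x1 <= z -> x2 <= z -> x3 <= z -> x4 <= z ->
  x5 <= z -> x6 <= z -> x1 + x2 + x3 + x4 + x5 + x6 <= 6 * z by lra.
have key3 (z x : R) : x <= 6 * z -> x * 3^-1 <= 2 * z by lra.
have [C C0 hC] := quad_bound R; exists (2 * (`|mu| + `|beta|) * C).
  by rewrite !mulr_ge0 ?addr_ge0.
move=> w1 w2 w3 w4.
set N := h1norm2 w1 * _ * _.
have N0 : 0 <= N by rewrite !mulr_ge0 ?h1norm2_ge0.
have q a b c d : h1norm a <= h1norm2 w1 -> h1norm b <= h1norm2 w2 ->
    h1norm c <= h1norm2 w3 -> h1norm d <= h1norm2 w4 -> `|quad a b c d| <= C * N.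
  move=> aw bw cw dw; apply: le_trans (hC _ _ _ _) _.
  apply: ler_wpM2l => //; apply: ler_pM; rewrite ?mulr_ge0 ?h1norm_ge0//.
    by apply: ler_pM; rewrite ?h1norm_ge0.
  by apply: ler_pM; rewrite ?h1norm_ge0.
have f1 := h1norm_fst w1; have f2 := h1norm_fst w2; have f3 := h1norm_fst w3; have f4 := h1norm_fst w4.
have s1 := h1norm_snd w1; have s2 := h1norm_snd w2; have s3 := h1norm_snd w3; have s4 := h1norm_snd w4.
have tri (x y : R) : `|x + y| <= `|x| + `|y| by exact: ler_normD.
apply: le_trans (tri _ _) _.
rewrite !normrM.
have -> : 2 * (`|mu| + `|beta|) * C * N = `|mu| * (2 * (C * N)) + `|beta| * (2 * (C * N)) by ring.
apply: lerD.
  apply: ler_wpM2l => //; apply: le_trans (tri _ _) _.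
  exact: key2 (q _ _ _ _ f1 f2 f3 f4) (q _ _ _ _ s1 s2 s3 s4).
rewrite -mulrA; apply: ler_wpM2l => //.
rewrite (ger0_norm (_ : 0 <= 3^-1)) ?invr_ge0//.
rewrite mulrC; apply: key3.
apply: le_trans (key6 _ _ _ _ _ _ _ (q _ _ _ _ f1 f2 s3 s4) (q _ _ _ _ f1 s2 f3 s4)
  (q _ _ _ _ f1 s2 s3 f4) (q _ _ _ _ s1 f2 f3 s4) (q _ _ _ _ s1 f2 s3 f4)
  (q _ _ _ _ s1 s2 f3 f4)).
by do 5!(apply: le_trans (tri _ _) _; apply: lerD => //).
Qed.

Definition dil2 (l : R) w : E := (H1dil l w.1, H1dil l w.2).

Lemma kin_dil (l : R) w : 0 < l -> kin (dil2 l w) (dil2 l w) = l ^+ 2 * kin w w.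
Proof. by move=> l0; rewrite /kin !dirichlet_dil// mulrDr. Qed.

Lemma quad2_dil (l : R) w : 0 < l ->
  quad2 (dil2 l w) (dil2 l w) (dil2 l w) (dil2 l w) = l ^+ 3 * quad2 w w w w.
Proof. by move=> l0; rewrite /quad2 !quad_dil//; do ?[move: (quad _ _ _ _) => ?]; ring. Qed.

End forms_on_pairs.

(** * Second order expansions of the energy *)

Section quartic_expansion.
Context (R : realType) (E : lmodType R).
Variables (nrm : E -> R) (dot : E -> E -> R) (A : E -> E -> E -> E -> R) (C : R).
Hypothesis nrm_ge0 : forall w, 0 <= nrm w.
Hypothesis dotC : forall w z, dot w z = dot z w.
Hypothesis dot_lin : forall k w w' z, dot (k *: w + w') z = k * dot w z + dot w' z.
Hypothesis dot_le : forall w z, `|dot w z| <= nrm w * nrm z.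
Hypothesis AC12 : forall x y z t, A x y z t = A y x z t.
Hypothesis AC23 : forall x y z t, A x y z t = A x z y t.
Hypothesis AC34 : forall x y z t, A x y z t = A x y t z.
Hypothesis A_lin : forall k w w' x y z, A (k *: w + w') x y z = k * A w x y z + A w' x y z.
Hypothesis C_ge0 : 0 <= C.
Hypothesis A_le : forall x y z t, `|A x y z t| <= C * (nrm x * nrm y * (nrm z * nrm t)).

Let AD1 w w' x y z : A (w + w') x y z = A w x y z + A w' x y z.
Proof. by have := A_lin 1 w w' x y z; rewrite scale1r mul1r. Qed.

Let AD2 w w' x y z : A x (w + w') y z = A x w y z + A x w' y z.
Proof. by rewrite AC12 AD1 !(AC12 x). Qed.

Let AD3 w w' x y z : A x y (w + w') z = A x y w z + A x y w' z.
Proof. by rewrite AC23 AD2 !(AC23 x y). Qed.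

Let AD4 w w' x y z : A x y z (w + w') = A x y z w + A x y z w'.
Proof. by rewrite AC34 AD3 !(AC34 x y z). Qed.

Lemma quartic_expand w d : A (w + d) (w + d) (w + d) (w + d) =
  A w w w w + 4 * A w w w d + 6 * A w w d d + 4 * A w d d d + A d d d d.
Proof.
rewrite !(AD1, AD2, AD3, AD4) !(AC12 d w, AC23 _ d w, AC34 _ _ d w).
by do ?[move: (A _ _ _ _) => ?]; ring.
Qed.

Lemma cubic_expand w d h : A (w + d) (w + d) (w + d) h =
  A w w w h + 3 * A w w d h + 3 * A w d d h + A d d d h.
Proof.
rewrite !(AD1, AD2, AD3, AD4) !(AC12 d w, AC23 _ d w).
by do ?[move: (A _ _ _ _) => ?]; ring.
Qed.

Lemma dot_expand w d : dot (w + d) (w + d) = dot w w + 2 * dot w d + dot d d.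
Proof.
rewrite (dotDl dot_lin) !(dotDr dotC dot_lin) (dotC d w).
by do ?[move: (dot _ _) => ?]; ring.
Qed.

Variable m : R.
Hypothesis m_ge1 : 1 <= m.

Let Abound w1 w2 w3 w4 x1 x2 x3 x4 : nrm w1 <= x1 -> nrm w2 <= x2 -> nrm w3 <= x3 ->
  nrm w4 <= x4 -> `|A w1 w2 w3 w4| <= C * (x1 * x2 * (x3 * x4)).
Proof.
move=> h1 h2 h3 h4; apply: le_trans (A_le _ _ _ _) _; apply: ler_wpM2l => //.
by apply: ler_pM; rewrite ?mulr_ge0//; apply: ler_pM.
Qed.

Let m0 : 0 <= m. Proof. exact: le_trans m_ge1. Qed.

(** The terms of order at least two in the expansion; for [y <= 1 <= m] they
    are all dominated by [m ^ 2 * y ^ 2]. *)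
Lemma quartic_remainder w d y : nrm w <= m -> nrm d <= y -> y <= 1 ->
  `|A (w + d) (w + d) (w + d) (w + d) - A w w w w - 4 * A w w w d| <= 11 * C * m ^+ 2 * y ^+ 2.
Proof.
move=> wm dy y1; rewrite quartic_expand.
have y0 : 0 <= y := le_trans (nrm_ge0 d) dy.
have h1 := Abound wm wm dy dy; have h2 := Abound wm dy dy dy; have h3 := Abound dy dy dy dy.
have my : C * (m * y * (y * y)) <= C * m ^+ 2 * y ^+ 2.
  have -> : C * (m * y * (y * y)) = C * (m * y) * (y ^+ 2) by ring.
  apply: ler_wpM2r; rewrite ?sqr_ge0//; apply: ler_wpM2l => //.
  by rewrite expr2; apply: ler_wpM2l => //; exact: le_trans m_ge1.
have yy : C * (y * y * (y * y)) <= C * m ^+ 2 * y ^+ 2.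
  have -> : C * (y * y * (y * y)) = C * (y * y) * (y ^+ 2) by ring.
  apply: ler_wpM2r; rewrite ?sqr_ge0//; apply: ler_wpM2l => //.
  by rewrite expr2; apply: ler_pM => //; exact: le_trans m_ge1.
have mm : C * (m * m * (y * y)) = C * m ^+ 2 * y ^+ 2 by ring.
rewrite {}mm in h1.
have -> : 11 * C * m ^+ 2 * y ^+ 2 = 11 * (C * m ^+ 2 * y ^+ 2) by ring.
move: h1 h2 h3 my yy; move: (A w w d d) (A w d d d) (A d d d d) => a1 a2 a3.
move: (A w w w w) (4 * A w w w d) (C * m ^+ 2 * y ^+ 2) => t1 t2 z.
move: (C * (m * y * (y * y))) (C * (y * y * (y * y))) => z1 z2.
rewrite !ler_norml => /andP[? ?] /andP[? ?] /andP[? ?] ? ?; apply/andP; split; lra.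
Qed.

Lemma quartic_lipschitz w d y : nrm w <= m -> nrm d <= y -> y <= 1 ->
  `|A (w + d) (w + d) (w + d) (w + d) - A w w w w| <= 15 * C * m ^+ 3 * y.
Proof.
move=> wm dy y1; have := quartic_remainder wm dy y1.
have y0 : 0 <= y := le_trans (nrm_ge0 d) dy.
have h : `|A w w w d| <= C * m ^+ 3 * y.
  by apply: le_trans (Abound wm wm wm dy) _; rewrite le_eqVlt; apply/orP; left; apply/eqP; ring.
have k : C * m ^+ 2 * y ^+ 2 <= C * m ^+ 3 * y.
  have -> : C * m ^+ 3 * y = C * m ^+ 2 * y * m by ring.
  have -> : C * m ^+ 2 * y ^+ 2 = C * m ^+ 2 * y * y by ring.
  by apply: ler_wpM2l; [rewrite !mulr_ge0 ?sqr_ge0|exact: le_trans m_ge1].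
have -> : 15 * C * m ^+ 3 * y = 15 * (C * m ^+ 3 * y) by ring.
have -> : 11 * C * m ^+ 2 * y ^+ 2 = 11 * (C * m ^+ 2 * y ^+ 2) by ring.
move: h k; move: (C * m ^+ 3 * y) (C * m ^+ 2 * y ^+ 2) (A w w w d) => p q a.
move: (A w w w w) (A _ _ _ _) => t1 t2.
rewrite !ler_norml => /andP[? ?] ? /andP[? ?]; apply/andP; split; lra.
Qed.

Lemma dot_lipschitz w d y : nrm w <= m -> nrm d <= y -> y <= 1 ->
  `|dot (w + d) (w + d) - dot w w| <= 3 * m * y.
Proof.
move=> wm dy y1; rewrite dot_expand.
have y0 : 0 <= y := le_trans (nrm_ge0 d) dy.
have h1 : `|dot w d| <= m * y by apply: le_trans (dot_le _ _) _; exact: ler_pM.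
have h2 : `|dot d d| <= y * y by apply: le_trans (dot_le _ _) _; exact: ler_pM.
have h3 : y * y <= m * y by apply: ler_wpM2r => //; exact: le_trans m_ge1.
have -> : 3 * m * y = 3 * (m * y) by ring.
move: h1 h2 h3; move: (dot w w) (dot w d) (dot d d) (m * y) (y * y).
move=> a b c e f; rewrite !ler_norml => /andP[? ?] /andP[? ?] ?; apply/andP; split; lra.
Qed.

(** The energy in abstract form, with [dot] for the Dirichlet form, which is
    bounded but not coercive for the [H^1] norm [nrm]. *)
Definition functional w : R := 2^-1 * dot w w - 4^-1 * A w w w w.
Definition differential w h : R := dot w h - A w w w h.

Lemma differential_lin w k h h' :
  differential w (k *: h + h') = k * differential w h + differential w h'.
Proof.
rewrite /differential (dotDr dotC dot_lin) (dotZr dotC dot_lin) AD4.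
have -> : A w w w (k *: h) = k * A w w w h.
  have first x : A w w w x = A x w w w by rewrite AC34 AC23 AC12.
  rewrite !first.
  exact: (dotZl (dot := fun u _ => A u w w w) (fun _ _ _ _ => A_lin _ _ _ _ _ _) k h 0).
by do ?[move: (A _ _ _ _) => ?]; do ?[move: (dot _ _) => ?]; ring.
Qed.

Lemma differential_le w h : nrm w <= m -> `|differential w h| <= (1 + C * m ^+ 2) * m * nrm h.
Proof.
move=> wm.
have h1 : `|dot w h| <= m * nrm h by apply: le_trans (dot_le _ _) _; exact: ler_wpM2r.
have h2 := Abound wm wm wm (lexx (nrm h)).
apply: le_trans (ler_normB _ _) _; apply: le_trans (lerD h1 h2) _.
by rewrite le_eqVlt; apply/orP; left; apply/eqP; ring.
Qed.

Lemma functional_remainder w d y : nrm w <= m -> nrm d <= y -> y <= 1 ->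
  `|functional (w + d) - functional w - differential w d| <= (1 + 3 * C * m ^+ 2) * y ^+ 2.
Proof.
move=> wm dy y1; have := quartic_remainder wm dy y1; rewrite /functional /differential dot_expand.
have y0 : 0 <= y := le_trans (nrm_ge0 d) dy.
have h2 : `|dot d d| <= y ^+ 2 by apply: le_trans (dot_le _ _) _; rewrite expr2; exact: ler_pM.
have z0 : 0 <= C * m ^+ 2 * y ^+ 2 by rewrite !mulr_ge0 ?sqr_ge0.
have -> : (1 + 3 * C * m ^+ 2) * y ^+ 2 = y ^+ 2 + 3 * (C * m ^+ 2 * y ^+ 2) by ring.
have -> : 11 * C * m ^+ 2 * y ^+ 2 = 11 * (C * m ^+ 2 * y ^+ 2) by ring.
move: h2 z0; move: (C * m ^+ 2 * y ^+ 2) (y ^+ 2) (A w w w d) (A w w w w) => p q a b.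
move: (A _ _ _ _) (dot w w) (dot w d) (dot d d)=> c e f g.
by rewrite !ler_norml => /andP[? ?] ? /andP[? ?]; apply/andP; split; lra.
Qed.

Lemma differential_lipschitz w d h : nrm w <= m -> nrm d <= 1 ->
  `|differential (w + d) h - differential w h| <= (1 + 7 * C * m ^+ 2) * nrm d * nrm h.
Proof.
move=> wm d1; rewrite /differential cubic_expand (dotDl dot_lin).
have h0 := dot_le d h.
have dm : nrm d <= m by exact: le_trans m_ge1.
have h1 := Abound wm wm (lexx (nrm d)) (lexx (nrm h)).
have h2 := Abound wm dm (lexx (nrm d)) (lexx (nrm h)).
have h3 := Abound dm dm (lexx (nrm d)) (lexx (nrm h)).
have -> : (1 + 7 * C * m ^+ 2) * nrm d * nrm h =
  nrm d * nrm h + 7 * (C * (m * m * (nrm d * nrm h))) by ring.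
move: h0 h1 h2 h3; move: (C * (m * m * (nrm d * nrm h))) => z; move: (nrm d * nrm h) => z1.
move: (A w w d h) (A w d d h) (A d d d h).
move: (A w w w h) (dot w h) (dot d h)=> a b c e f g.
by rewrite !ler_norml => /andP[? ?] /andP[? ?] /andP[? ?] /andP[? ?]; apply/andP; split; lra.
Qed.

End quartic_expansion.

(** * Differentiability from quadratic remainders *)

Section local_estimates.
Variable R : realType.

Lemma local_lipschitz_continuous (V W : normedModType R) (f : V -> W) (x : V) (K : R) :
  0 <= K -> (forall h, `|h| <= 1 -> `|f (x + h) - f x| <= K * `|h|) ->
  f y @[y --> x] --> f x.
Proof.
move=> K0 fK; apply/cvgrPdist_le => /= e e0; near=> y.
have -> : y = x + (y - x) by rewrite addrC subrK.
rewrite distrC; have h1 : `|y - x| <= 1 by rewrite distrC; near: y; apply: cvgr_dist_le.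
apply: le_trans (fK _ h1) _; rewrite distrC.
have h2 : `|x - y| <= e / (K + 1) by near: y; apply: cvgr_dist_le => //; rewrite divr_gt0 ?ltr_wpDl.
apply: le_trans (ler_wpM2l K0 h2) _; rewrite mulrCA ler_piMr ?(ltW e0)//.
by rewrite ler_pdivrMr ?mul1r ?lerDl ?ler01// ltr_wpDl.
Unshelve. all: by end_near. Qed.

(** A quadratic remainder is negligible against the norm, and a bounded linear
    form is continuous. *)
Lemma quadratic_remainder_differentiable (V : normedModType R) (f L : V -> R) (x : V) (b K r : R) :
  0 <= b -> 0 <= K -> 0 < r -> (forall k h h', L (k *: h + h') = k * L h + L h') ->
  (forall h, `|L h| <= b * `|h|) ->
  (forall h, `|h| <= r -> `|f (x + h) - f x - L h| <= K * `|h| ^+ 2) ->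
  differentiable f x /\ forall h, 'd f x h = L h.
Proof.
move=> b0 K0 r0 Llin Lb fL.
have Ladd : linear L by move=> k u v; exact: Llin.
pose df : {linear V -> R} := HB.pack L (GRing.isLinear.Build R V R *:%R L Ladd).
have cdf : continuous df.
  move=> y; apply: (@local_lipschitz_continuous _ _ _ _ b) => // h _.
  have -> : df (y + h) - df y = L h.
    by rewrite /=; have := Llin 1 h y; rewrite scale1r mul1r addrC => ->; rewrite addrK.
  exact: Lb.
have rem : f \o shift x = cst (f x) + df +o_ 0 id.
  apply/eqaddoP => e e0; near=> h.
  have h1 : `|h| <= r by near: h; apply: nbhs0_le.
  have h2 : K * `|h| <= e.
    have : `|h| <= e / (K + 1) by near: h; apply: nbhs0_le; rewrite divr_gt0 ?ltr_wpDl.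
    move=> h2; apply: le_trans (ler_wpM2l K0 h2) _; rewrite mulrCA ler_piMr ?(ltW e0)//.
    by rewrite ler_pdivrMr ?mul1r ?lerDl ?ler01// ltr_wpDl.
  have -> : (f \o shift x - (cst (f x) + df)) h = f (x + h) - f x - L h.
    by rewrite -[LHS]/(f (h + x) - (f x + L h)) opprD addrA (addrC h).
  apply: le_trans (fL _ h1) _; rewrite expr2 mulrA; exact: ler_wpM2r.
have dE := diff_unique cdf rem.
split; first by apply/diff_locallyP; rewrite dE.
by move=> h; rewrite dE.
Unshelve. all: by end_near. Qed.

End local_estimates.

(** * Projections for the mass constraint *)

Section mass_gradient.
Variable R : realType.
Local Notation H := (H1rad R).
Implicit Types u v g h : H.

Lemma h1norm_sqr_le (u : H) (b : R) : 0 <= b -> h1dot u u <= b * h1norm u -> h1norm u <= b.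
Proof.
move=> b0; have := h1norm_ge0 u; rewrite le_eqVlt => /orP[/eqP <- //|u0].
by rewrite -h1norm_sqr expr2 ler_pM2r.
Qed.

Lemma h1dot_CS u v : `|h1dot u v| <= h1norm u * h1norm v.
Proof.
rewrite -(ler_pXn2r (_ : 0 < 2)%N) ?nnegrE ?mulr_ge0 ?h1norm_ge0//.
rewrite real_normK ?num_real// exprMn !h1norm_sqr.
exact: (dot_CauchySchwarz (@h1dotC R) (@h1dot_lin R) (@h1dot_ge0 R)).
Qed.

Lemma mass_CS u v : `|mass u v| <= h1norm u * h1norm v.
Proof.
rewrite -(ler_pXn2r (_ : 0 < 2)%N) ?nnegrE ?mulr_ge0 ?h1norm_ge0//.
rewrite real_normK ?num_real// exprMn !h1norm_sqr.
apply: le_trans (dot_CauchySchwarz (@massC R) (@mass_lin R) (@mass_ge0 R) _ _) _.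
by apply: ler_pM; rewrite ?mass_ge0 ?mass_le.
Qed.

Lemma mass_Riesz u : exists g, forall v, mass u v = h1dot g v.
Proof.
apply: (@H1rad_Riesz R (mass u) (h1dot u u)).
- by move=> k v w; rewrite !(massC u) mass_lin.
- exact: h1dot_ge0.
- move=> v; rewrite -!h1norm_sqr -exprMn -[X in X <= _]real_normK ?num_real//.
  by rewrite lerXn2r ?nnegrE ?mulr_ge0 ?h1norm_ge0// mass_CS.
Qed.

(** Half the gradient, for the [H^1] inner product, of [u |-> mass u u]: it
    spans the normal direction to the sphere, which [u] itself does not. *)
Definition mass_grad u : H := projT1 (cid (mass_Riesz u)).

Lemma mass_gradE u v : h1dot (mass_grad u) v = mass u v.
Proof. by rewrite /mass_grad; case: cid. Qed.

(** Identities between representing vectors, such as linearity and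
    equivariance, are proved by testing. *)
Lemma h1dot_inj u v : (forall h, h1dot u h = h1dot v h) -> u = v.
Proof.
move=> uv; apply/eqP; rewrite -subr_eq0; apply/eqP/h1dot_eq0.
by rewrite h1dotBl uv subrr.
Qed.

Lemma mass_grad_lin k u v : mass_grad (k *: u + v) = k *: mass_grad u + mass_grad v.
Proof. by apply: h1dot_inj => h; rewrite h1dot_lin !mass_gradE mass_lin. Qed.

Lemma mass_grad_le u : h1norm (mass_grad u) <= h1norm u.
Proof.
apply: h1norm_sqr_le; rewrite ?h1norm_ge0// mass_gradE.
by apply: le_trans (ler_norm _) _; exact: mass_CS.
Qed.

Lemma mass_grad_continuous u : mass_grad v @[v --> u] --> mass_grad u.
Proof.
apply: (@local_lipschitz_continuous _ _ _ _ _ 1) => // h _; rewrite mul1r.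
have -> : mass_grad (u + h) - mass_grad u = mass_grad h.
  have := mass_grad_lin 1 h u; rewrite !scale1r addrC => ->.
  by rewrite addrK.
exact: mass_grad_le.
Qed.

Lemma h1dot_cvg (T : Type) (F : set_system T) {FF : Filter F} (f g : T -> H) (u v : H) :
  f x @[x --> F] --> u -> g x @[x --> F] --> v -> h1dot (f x) (g x) @[x --> F] --> h1dot u v.
Proof.
move=> fu gv.
have hf : `|f x - u| * `|g x| @[x --> F] --> (0 : R).
  rewrite -[X in _ --> X](mul0r `|v|); apply: cvgM; last exact: cvg_norm.
  by rewrite -(normr0 H) -(subrr u); apply: cvg_norm; apply: cvgB => //; exact: cvg_cst.
have hg : `|u| * `|g x - v| @[x --> F] --> (0 : R).
  rewrite -[X in _ --> X](mulr0 `|u|); apply: cvgMr.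
  by rewrite -(normr0 H) -(subrr v); apply: cvg_norm; apply: cvgB => //; exact: cvg_cst.
have := cvgD hf hg; rewrite addr0 => /(_ FF) hfg.
apply: cvg_zero; apply: norm_cvg0.
apply: (@squeeze_cvgr _ _ _ _ (fun=> 0) _ _ _ 0 _ hfg); last exact: cvg_cst.
apply: nearW => x; rewrite normr_ge0/=.
rewrite (_ : (_ - _) x = h1dot (f x - u) (g x) + h1dot u (g x - v)); last first.
  by rewrite h1dotBl h1dotBr addrA subrK.
by apply: le_trans (ler_normD _ _) _; apply: lerD; exact: h1dot_CS.
Qed.

Lemma mass_cvg (T : Type) (F : set_system T) {FF : Filter F} (f g : T -> H) (u v : H) :
  f x @[x --> F] --> u -> g x @[x --> F] --> v -> mass (f x) (g x) @[x --> F] --> mass u v.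
Proof.
move=> fu gv; under eq_fun do rewrite -mass_gradE; rewrite -mass_gradE.
apply: h1dot_cvg => //; exact: (cvg_comp _ _ fu (@mass_grad_continuous u)).
Qed.

(** Orthogonal projection of [g] onto the kernel of [mass u]. *)
Definition tangent_part u g : H :=
  g - (h1dot g (mass_grad u) / h1dot (mass_grad u) (mass_grad u)) *: mass_grad u.

Lemma mass_grad_gt0 u : 0 < mass u u -> 0 < h1dot (mass_grad u) (mass_grad u).
Proof.
move=> u0; rewrite lt_neqAle h1dot_ge0 andbT eq_sym; apply/eqP => /h1dot_eq0 n0.
by move: u0; rewrite -mass_gradE n0 (dot0l (@h1dot_lin R)) ltxx.
Qed.

Lemma mass_tangent_part u g : 0 < mass u u -> mass u (tangent_part u g) = 0.
Proof.
move=> /mass_grad_gt0 n0; rewrite -mass_gradE h1dotBr h1dotZr (h1dotC _ g).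
by rewrite divfK ?subrr// gt_eqF.
Qed.

Lemma h1dot_tangent_part u g h : mass u h = 0 -> h1dot (tangent_part u g) h = h1dot g h.
Proof. by move=> uh; rewrite h1dotBl h1dotZl (mass_gradE u h) uh mulr0 subr0. Qed.

Lemma tangent_part_cvg (T : Type) (F : set_system T) {FF : Filter F} (f g : T -> H) (u v : H) :
  0 < mass u u -> f x @[x --> F] --> u -> g x @[x --> F] --> v ->
  tangent_part (f x) (g x) @[x --> F] --> tangent_part u v.
Proof.
move=> u0 fu gv; have fg : mass_grad (f x) @[x --> F] --> mass_grad u.
  exact: (cvg_comp _ _ fu (@mass_grad_continuous u)).
apply: cvgB => //; apply: cvgZ => //; apply: cvgM; first exact: h1dot_cvg.
by apply: cvgV; [rewrite gt_eqF// mass_grad_gt0|exact: h1dot_cvg].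
Qed.

(** Radial projection onto the sphere of mass [a ^+ 2]. *)
Definition sphere_proj (a : R) u : H := (a / Num.sqrt (mass u u)) *: u.

Lemma mass_sphere_proj a u : 0 < mass u u -> mass (sphere_proj a u) (sphere_proj a u) = a ^+ 2.
Proof.
move=> u0; rewrite /sphere_proj (dotZl (@mass_lin R)) (dotZr (@massC R) (@mass_lin R)) mulrA -expr2.
by rewrite expr_div_n sqr_sqrtr ?(ltW u0)// divfK// gt_eqF.
Qed.

Lemma sphere_proj_id a u : 0 < a -> mass u u = a ^+ 2 -> sphere_proj a u = u.
Proof.
by move=> a0 ua; rewrite /sphere_proj ua sqrtr_sqr gtr0_norm// divff ?gt_eqF// scale1r.
Qed.

Lemma sphere_proj_cvg (T : Type) (F : set_system T) {FF : Filter F} a (f : T -> H) (u : H) :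
  0 < mass u u -> f x @[x --> F] --> u -> sphere_proj a (f x) @[x --> F] --> sphere_proj a u.
Proof.
move=> u0 fu; apply: cvgZ => //; apply: cvgMr; apply: cvgV; first by rewrite gt_eqF ?sqrtr_gt0.
by apply: continuous_cvg; [exact: sqrt_continuous|exact: mass_cvg].
Qed.

(** A tangential displacement [v] changes the mass only at second order, and
    [1 - a / S] is at most [(S ^ 2 - a ^ 2) / a ^ 2] for [S >= a]. *)
Lemma sphere_proj_defect a u v : 0 < a -> mass u u = a ^+ 2 -> mass u v = 0 ->
  `|a / Num.sqrt (mass (u - v) (u - v)) - 1| <= mass v v / a ^+ 2.
Proof.
move=> a0 ua uv.
have -> : mass (u - v) (u - v) = a ^+ 2 + mass v v.
  rewrite (dotBl (@mass_lin R)) !(dotBr (@massC R) (@mass_lin R)) ua uv (massC v) uv; ring.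
have := mass_ge0 v; move: (mass v v) => q q0.
set S := Num.sqrt _; have S2 : S ^+ 2 = a ^+ 2 + q by rewrite sqr_sqrtr ?addr_ge0 ?sqr_ge0.
have Sa : a <= S.
  by rewrite -(ler_pXn2r (_ : 0 < 2)%N) ?nnegrE ?sqrtr_ge0 ?(ltW a0)// S2 lerDl.
have S0 : 0 < S by apply: lt_le_trans a0 Sa.
rewrite distrC ger0_norm; last by rewrite subr_ge0 ler_pdivrMr// mul1r.
rewrite ler_pdivlMr ?exprn_gt0// -(ler_pM2r S0).
have -> : (1 - a / S) * a ^+ 2 * S = (S - a) * a ^+ 2 by field; rewrite gt_eqF.
have -> : q = (S - a) * (S + a) by have -> : q = S ^+ 2 - a ^+ 2 by [rewrite S2; ring]; ring.
rewrite -mulrA; apply: ler_wpM2l; first by rewrite subr_ge0.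
nra.
Qed.

End mass_gradient.

(** * The constrained gradient of the energy *)

Section energy_gradient.
Variable R : realType.
Local Notation H := (H1rad R).
Local Notation E := (H1rad R * H1rad R)%type.
Variables mu beta C : R.
Implicit Types w h z : E.
Hypothesis C_ge0 : 0 <= C.
Local Notation A := (quad2 mu beta).
Hypothesis A_le : forall w1 w2 w3 w4 : E,
  `|A w1 w2 w3 w4| <= C * (h1norm2 w1 * h1norm2 w2 * (h1norm2 w3 * h1norm2 w4)).
Local Notation J := (@energy R mu mu beta).
Local Notation dJ := (differential (@kin R) A).

Lemma energyE w : J w = functional (@kin R) A w.
Proof. by rewrite /energy kineticE quarticE. Qed.

Lemma energy_diff_lin w k h h' : dJ w (k *: h + h') = k * dJ w h + dJ w h'.
Proof.
exact: (differential_lin (@kinC R) (@kin_lin R) (quad2C12 mu beta) (quad2C23 mu beta)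
  (quad2C34 mu beta) (quad2_lin mu beta)).
Qed.

Let m_of w : R := 1 + h1norm2 w.
Let m1 w : 1 <= m_of w. Proof. by rewrite lerDl h1norm2_ge0. Qed.
Let wm w : h1norm2 w <= m_of w. Proof. by rewrite lerDr. Qed.

Lemma energy_diff_le w h (m : R) : 1 <= m -> h1norm2 w <= m ->
  `|dJ w h| <= (1 + C * m ^+ 2) * m * h1norm2 h.
Proof. by move=> m_ge1; exact: (differential_le (@h1norm2_ge0 R) (@kin_bound R) C_ge0 A_le). Qed.

Lemma energy_remainder w d (m y : R) : 1 <= m -> h1norm2 w <= m -> h1norm2 d <= y -> y <= 1 ->
  `|J (w + d) - J w - dJ w d| <= (1 + 3 * C * m ^+ 2) * y ^+ 2.
Proof.
rewrite !energyE => m_ge1; exact: (functional_remainder (@h1norm2_ge0 R) (@kinC R) (@kin_lin R)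
  (@kin_bound R) (quad2C12 mu beta) (quad2C23 mu beta) (quad2C34 mu beta) (quad2_lin mu beta)
  C_ge0 A_le).
Qed.

Lemma energy_differentiable w : differentiable J w /\ forall h, 'd J w h = dJ w h.
Proof.
have m0 : 0 <= m_of w := le_trans ler01 (m1 w).
have K0 : 0 <= 1 + 3 * C * m_of w ^+ 2 by rewrite addr_ge0// !mulr_ge0// sqr_ge0.
have b0 : 0 <= (1 + C * m_of w ^+ 2) * m_of w.
  by rewrite mulr_ge0// addr_ge0// mulr_ge0// sqr_ge0.
apply: (@quadratic_remainder_differentiable R E J (dJ w) w ((1 + C * m_of w ^+ 2) * m_of w * 2)
  ((1 + 3 * C * m_of w ^+ 2) * 4) 2^-1) => //.
- exact: mulr_ge0.
- exact: mulr_ge0.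
- exact: energy_diff_lin.
- move=> h; apply: le_trans (energy_diff_le h (m1 w) (wm w)) _.
  by rewrite -[leRHS]mulrA; apply: ler_wpM2l => //; exact: h1norm2_le_norm.
- move=> h h1; have h2 : 2 * `|h| <= 1 by rewrite mulrC -ler_pdivlMr ?div1r.
  apply: le_trans (energy_remainder (m1 w) (wm w) (h1norm2_le_norm h) h2) _.
  by rewrite exprMn mulrA; apply: ler_wpM2r; rewrite ?sqr_ge0//; apply: ler_wpM2l => //; rewrite expr2; lra.
Qed.

(** Representation on each factor, applied to the restrictions of [f]. *)
Lemma E_Riesz (f : E -> R) (b : R) : (forall k h h', f (k *: h + h') = k * f h + f h') ->
  0 <= b -> (forall h, `|f h| <= b * h1norm2 h) -> exists g, forall h, f h = h1dot2 g h.
Proof.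
move=> flin b0 fb.
have f0 : f 0 = 0 by have := flin (-1) 0 0; rewrite scaler0 addr0 mulN1r; lra.
have inj (i : H -> E) : (forall k u v, i (k *: u + v) = k *: i u + i v) ->
    (forall u, h1norm2 (i u) = h1norm u) -> exists g, forall u, f (i u) = h1dot g u.
  move=> ilin inorm; apply: (@H1rad_Riesz R (f \o i) (b ^+ 2)) => [k u v||u].
  - by rewrite /= ilin flin.
  - exact: sqr_ge0.
  - rewrite /= -h1norm_sqr -inorm -exprMn -[X in X <= _]real_normK ?num_real//.
    by rewrite lerXn2r ?nnegrE ?mulr_ge0 ?h1norm2_ge0.
have [||g1 g1P] := inj (fun u => (u, 0)).
- by move=> k u v; rewrite -[RHS]/(_, _)/= scaler0 addr0.
- by move=> u; rewrite /h1norm2 /h1dot2 /= (dot0l (@h1dot_lin R)) addr0.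
have [||g2 g2P] := inj (fun u => (0, u)).
- by move=> k u v; rewrite -[RHS]/(_, _)/= scaler0 addr0.
- by move=> u; rewrite /h1norm2 /h1dot2 /= (dot0l (@h1dot_lin R)) add0r.
exists (g1, g2) => -[u v]; rewrite /h1dot2/= -g1P -g2P.
have := flin 1 (u, 0) (0, v); rewrite mul1r scale1r => <-.
by congr f; rewrite -[RHS]/(_, _)/= addr0 add0r.
Qed.

Lemma energy_gradient_exists w : exists g, forall h, dJ w h = h1dot2 g h.
Proof.
apply: (E_Riesz (energy_diff_lin w) _ (fun h => energy_diff_le h (m1 w) (wm w))).
have m0 : 0 <= m_of w := le_trans ler01 (m1 w).
by rewrite mulr_ge0// addr_ge0// mulr_ge0// sqr_ge0.
Qed.

Definition egrad w : E := projT1 (cid (energy_gradient_exists w)).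

Lemma egradE w h : h1dot2 (egrad w) h = dJ w h.
Proof. by rewrite /egrad; case: cid. Qed.

Lemma h1dot2_inj w z : (forall h, h1dot2 w h = h1dot2 z h) -> w = z.
Proof.
move=> wz; have d0 : h1dot2 (w - z) (w - z) = 0.
  by rewrite (dotBl (@h1dot2_lin R)) wz subrr.
apply/eqP; rewrite -subr_eq0 -normr_eq0 eq_le normr_ge0 andbT.
by apply: le_trans (norm_le_h1norm2 _) _; rewrite /h1norm2 d0 sqrtr0.
Qed.

(** Both forms are invariant under the exchange of the components because the
    two coefficients [mu] are equal. *)
Lemma egrad_sigma w : egrad (sigma w) = sigma (egrad w).
Proof.
apply: h1dot2_inj => -[h1 h2]; rewrite egradE -[(h1, h2)]/(sigma (h2, h1)) h1dot2_sigma egradE.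
by rewrite /differential kin_sigma quad2_sigma.
Qed.

Lemma h1norm2_sqr_le w (b : R) : 0 <= b -> h1dot2 w w <= b * h1norm2 w -> h1norm2 w <= b.
Proof.
move=> b0; have := h1norm2_ge0 w; rewrite le_eqVlt => /orP[/eqP <- //|u0].
by rewrite -h1norm2_sqr expr2 ler_pM2r.
Qed.

Lemma egrad_le w (m : R) : 1 <= m -> h1norm2 w <= m ->
  h1norm2 (egrad w) <= (1 + C * m ^+ 2) * m.
Proof.
move=> m_ge1 w_le; have m0 : 0 <= m := le_trans ler01 m_ge1.
apply: h1norm2_sqr_le; first by rewrite mulr_ge0// addr_ge0// mulr_ge0// sqr_ge0.
by rewrite egradE; apply: le_trans (ler_norm _) _; exact: energy_diff_le.
Qed.

Lemma egrad_continuous w : egrad z @[z --> w] --> egrad w.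
Proof.
have C7 : 0 <= 1 + 7 * C * (1 + h1norm2 w) ^+ 2 by rewrite addr_ge0// !mulr_ge0// ?sqr_ge0 ?addr_ge0 ?h1norm2_ge0.
have key h : h1norm2 h <= 1 ->
    h1norm2 (egrad (w + h) - egrad w) <= (1 + 7 * C * (1 + h1norm2 w) ^+ 2) * h1norm2 h.
  move=> h1; apply: h1norm2_sqr_le; first by rewrite mulr_ge0 ?h1norm2_ge0.
  rewrite {1}(dotBl (@h1dot2_lin R)) !egradE; apply: le_trans (ler_norm _) _.
  exact: (differential_lipschitz (@h1norm2_ge0 R) (@kin_lin R)
    (@kin_bound R) (quad2C12 mu beta) (quad2C23 mu beta) (quad2_lin mu beta) C_ge0 A_le (m1 w) _ (wm w)).
have close (e : R) : 0 < e -> \forall z \near w, `|w - z| <= e.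
  by move=> e0; have /cvgrPdist_le := @cvg_id _ (nbhs w); apply.
set D := 1 + 7 * C * (1 + h1norm2 w) ^+ 2 in C7 key.
have final (x n e : R) : 0 <= x -> 0 <= n -> n * (2 * (x + 1)) <= e -> x * (2 * n) <= e by nra.
have D0 : 0 < 2 * (D + 1) by rewrite mulr_gt0// ltr_wpDl.
apply/cvgrPdist_le => e e0.
have c1 := close 2^-1 (_ : 0 < 2^-1); have c2 := close _ (divr_gt0 e0 D0).
have {}c1 := c1 ltac:(by rewrite invr_gt0).
apply: filter_app c2; apply: filterS c1 => z.
rewrite !(distrC w) => h1 h2.
have {}h1 : h1norm2 (z - w) <= 1.
  by apply: le_trans (h1norm2_le_norm _) _; rewrite mulrC -ler_pdivlMr// div1r.
rewrite distrC; apply: le_trans (norm_le_h1norm2 _) _.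
have zE : z = w + (z - w) by rewrite addrC subrK.
rewrite [X in egrad X - _]zE; apply: le_trans (key _ h1) _.
rewrite ler_pdivlMr// in h2.
have n2 : h1norm2 (z - w) <= 2 * `|z - w| := h1norm2_le_norm _.
have n0 : 0 <= `|z - w| := normr_ge0 _.
apply: le_trans (ler_wpM2l C7 n2) _.
move: n0 h2; clear n2; move: `|z - w| => n n0 h2.
exact: (final _ _ _ C7 n0 h2).
Qed.

Definition cgrad w : E := (tangent_part w.1 (egrad w).1, tangent_part w.2 (egrad w).2).

Lemma cgrad_sigma w : cgrad (sigma w) = sigma (cgrad w).
Proof. by rewrite /cgrad egrad_sigma. Qed.

Section at_point.
Variables (w : E) (w1 : 0 < mass w.1 w.1) (w2 : 0 < mass w.2 w.2).

(** The gradient and its projection agree on tangent vectors; this carries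
    the estimates below. *)
Lemma h1dot2_cgrad h : tangent w h -> h1dot2 (cgrad w) h = h1dot2 (egrad w) h.
Proof. by move=> [h1 h2]; rewrite /h1dot2 /= !h1dot_tangent_part. Qed.

Lemma tangent_cgrad : tangent w (cgrad w).
Proof. by split; exact: mass_tangent_part. Qed.

Lemma cgrad_constrained_gradient : is_constrained_gradient J w (cgrad w).
Proof.
have [dif dE] := energy_differentiable w; split => //; first exact: tangent_cgrad.
by move=> h th; rewrite dE h1dot2_cgrad// egradE.
Qed.

(** The projection is orthogonal, so it does not increase the norm, however
    small the normal vector is. *)
Lemma cgrad_le : h1norm2 (cgrad w) <= h1norm2 (egrad w).
Proof.
apply: h1norm2_sqr_le; first exact: h1norm2_ge0.
rewrite h1dot2_cgrad; last exact: tangent_cgrad.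
by apply: le_trans (ler_norm _) _; exact: h1dot2_le.
Qed.

Lemma energy_diff_cgrad : dJ w (cgrad w) = h1norm2 (cgrad w) ^+ 2.
Proof. by rewrite -egradE -h1dot2_cgrad ?h1norm2_sqr//; exact: tangent_cgrad. Qed.

Lemma cgrad_continuous : cgrad z @[z --> w] --> cgrad w.
Proof.
have ge := @egrad_continuous w.
have f1 : (z : E).1 @[z --> w] --> w.1 by exact: cvg_fst.
have f2 : (z : E).2 @[z --> w] --> w.2 by exact: cvg_snd.
have g1 : (egrad z).1 @[z --> w] --> (egrad w).1 by exact: (cvg_comp _ _ ge (@cvg_fst _ _ _ _ _)).
have g2 : (egrad z).2 @[z --> w] --> (egrad w).2 by exact: (cvg_comp _ _ ge (@cvg_snd _ _ _ _ _)).
have h1 := tangent_part_cvg w1 f1 g1; have h2 := tangent_part_cvg w2 f2 g2.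
exact: (cvg_pair (h1 _) (h2 _)).
Qed.

End at_point.

End energy_gradient.

(** * The descent estimate *)

Section descent.
Variable R : realType.
Local Notation H := (H1rad R).
Local Notation E := (H1rad R * H1rad R)%type.
Variables mu beta C a : R.
Implicit Types w h z : E.
Hypothesis a_gt0 : 0 < a.
Hypothesis C_ge0 : 0 <= C.
Local Notation A := (quad2 mu beta).
Hypothesis A_le : forall w1 w2 w3 w4 : E,
  `|A w1 w2 w3 w4| <= C * (h1norm2 w1 * h1norm2 w2 * (h1norm2 w3 * h1norm2 w4)).
Local Notation J := (@energy R mu mu beta).
Local Notation dJ := (differential (@kin R) A).
Local Notation Q w := (quad2 mu beta w w w w).
Local Notation egrad := (egrad C_ge0 A_le).
Local Notation V := (cgrad C_ge0 A_le).

Definition masses w : Prop := mass w.1 w.1 = a ^+ 2 /\ mass w.2 w.2 = a ^+ 2.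

Definition step_dir (s : R) w : E := w - s *: V w.
Definition grad_step (s : R) w : E :=
  (sphere_proj a (step_dir s w).1, sphere_proj a (step_dir s w).2).

Let sqa : 0 < a ^+ 2. Proof. exact: exprn_gt0. Qed.

Lemma h1norm2_scale2 (p c1 c2 : R) w : 0 <= p -> `|c1| <= p -> `|c2| <= p ->
  h1norm2 ((c1 *: w.1, c2 *: w.2) : E) <= p * h1norm2 w.
Proof.
move=> p0 h1 h2; rewrite -(ler_pXn2r (_ : 0 < 2)%N) ?nnegrE ?mulr_ge0 ?h1norm2_ge0//.
rewrite exprMn !h1norm2_sqr /h1dot2/= !h1dotZl !h1dotZr !mulrA -!expr2 (mulrDr (p ^+ 2)).
have sq (c : R) : `|c| <= p -> c ^+ 2 <= p ^+ 2.
  by move=> cp; rewrite -(real_normK (num_real c)) lerXn2r ?nnegrE.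
by apply: lerD; apply: ler_wpM2r; rewrite ?h1dot_ge0 ?sq.
Qed.

Lemma step_dir_fst s w : (step_dir s w).1 = w.1 - s *: (V w).1.
Proof. by []. Qed.

Lemma step_dir_snd s w : (step_dir s w).2 = w.2 - s *: (V w).2.
Proof. by []. Qed.

(** The step is tangential, so it can only increase the masses. *)
Lemma masses_step_dir s w : masses w ->
  0 < mass (step_dir s w).1 (step_dir s w).1 /\ 0 < mass (step_dir s w).2 (step_dir s w).2.
Proof.
move=> [w1 w2]; have pos (u v : H) : mass u u = a ^+ 2 -> mass u v = 0 ->
    0 < mass (u - s *: v) (u - s *: v).
  move=> ua uv; rewrite (dotBl (@mass_lin R)) !(dotBr (@massC R) (@mass_lin R)).
  rewrite !(dotZl (@mass_lin R), dotZr (@massC R) (@mass_lin R)) (massC v u) uv ua.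
  have := mass_ge0 v; rewrite !mulr0 subr0 sub0r opprK mulrA -expr2 => v0.
  by rewrite ltr_wpDr// mulr_ge0// sqr_ge0.
have [t1 t2] : tangent w (V w) by apply: tangent_cgrad; rewrite ?w1 ?w2.
rewrite step_dir_fst step_dir_snd.
by split; [exact: (pos _ _ w1 t1)|exact: (pos _ _ w2 t2)].
Qed.

Lemma masses_grad_step s w : masses w -> masses (grad_step s w).
Proof. by move=> /(masses_step_dir s)[h1 h2]; split; exact: mass_sphere_proj. Qed.

Lemma grad_step0 w : masses w -> grad_step 0 w = w.
Proof.
move=> [w1 w2]; rewrite /grad_step /step_dir scale0r subr0 !sphere_proj_id//.
by case: (w).
Qed.

(** The normalization error [r] is of second order in the step. *)
Lemma grad_step_displacement (s m : R) w : masses w -> 1 <= m -> h1norm2 w <= m ->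
  0 <= s -> s * h1norm2 (V w) <= 1 ->
  exists2 r, grad_step s w = w + (r - s *: V w) &
    h1norm2 r <= 2 * m / a ^+ 2 * (s * h1norm2 (V w)) ^+ 2.
Proof.
move=> mw m1 wm s0 sy; have [w1 w2] := mw.
have [t1 t2] : tangent w (V w) by apply: tangent_cgrad; rewrite ?w1 ?w2.
set x := step_dir s w; set y := h1norm2 (V w) in sy *.
pose d (u : H) := a / Num.sqrt (mass u u) - 1.
exists (d x.1 *: x.1, d x.2 *: x.2).
  have dE (u : H) : sphere_proj a u = u + d u *: u.
    by rewrite /d scalerBl scale1r addrC subrK.
  rewrite [RHS]addrCA [RHS]addrC -/(step_dir s w) -/x /grad_step -/x [LHS]surjective_pairing/=.
  by rewrite !dE.
have p0 : 0 <= (s * y) ^+ 2 / a ^+ 2 by rewrite divr_ge0 ?sqr_ge0.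
have y0 : 0 <= y := h1norm2_ge0 _.
have dle (u v : H) : mass u u = a ^+ 2 -> mass u v = 0 -> h1norm v <= y ->
    `|d (u - s *: v)| <= (s * y) ^+ 2 / a ^+ 2.
  move=> ua uv vy; rewrite /d.
  have us : mass u (s *: v) = 0 by rewrite (dotZr (@massC R) (@mass_lin R)) uv mulr0.
  apply: le_trans (sphere_proj_defect a_gt0 ua us) _.
  rewrite ler_pM2r ?invr_gt0// !(dotZl (@mass_lin R), dotZr (@massC R) (@mass_lin R)).
  rewrite mulrA -expr2 exprMn; apply: ler_wpM2l; first exact: sqr_ge0.
  apply: le_trans (mass_le v) _; rewrite -h1norm_sqr lerXn2r ?nnegrE//.
  exact: h1norm_ge0.
have d1 := dle _ _ w1 t1 (h1norm_fst (V w)); have d2 := dle _ _ w2 t2 (h1norm_snd (V w)).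
apply: le_trans (h1norm2_scale2 x p0 d1 d2) _.
have xm : h1norm2 x <= 2 * m.
  have := h1norm2D w (- (s *: V w)).
  rewrite h1norm2N h1norm2Z (ger0_norm s0) -/y => /le_trans; apply.
  by rewrite mulr_natl mulr2n; apply: lerD => //; exact: le_trans sy m1.
have -> : 2 * m / a ^+ 2 * (s * y) ^+ 2 = (s * y) ^+ 2 / a ^+ 2 * (2 * m).
  by move: (a ^+ 2)^-1 ((s * y) ^+ 2) => A1 B1; ring.
exact: ler_wpM2l.
Qed.

(** The derivative at [l = 1] of the energy along the dilation orbit of [w]. *)
Definition pohoz_defect w : R := kin w w - 3 / 4 * Q w.

(** With [l = 4 k / (3 q)] the left-hand side is the maximum over the orbit
    [l ^ 2 * k / 2 - l ^ 3 * q / 4]; the excess over its value at [l = 1] is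
    quadratic in [l - 1]. *)
Lemma fibre_max (k q : R) : 0 < q ->
  let l := 1 + (k - 3 / 4 * q) / (3 / 4 * q) in
  l ^+ 2 * k / 6 = 2^-1 * k - 4^-1 * q + q / 8 * (l - 1) ^+ 2 * (l + 2).
Proof. by move=> q0 /=; field; rewrite gt_eqF. Qed.

Variable q : R.
Hypothesis q_gt0 : 0 < q.

(** The factor that brings [w] back to the Pohozaev set, as soon as the quartic
    term is large enough; the maximum keeps it continuous everywhere. *)
Definition fibre_scale w : R := 1 + pohoz_defect w / Num.max (3 / 4 * Q w) q.

Definition deform (s : R) w : E :=
  dil2 (fibre_scale (grad_step s w)) (grad_step s w).

(** By [fibre_max] the cost of the dilation is quadratic in the defect. *)
Lemma deform_energy z : q <= 3 / 4 * Q z -> `|pohoz_defect z| <= q / 2 ->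
  [/\ 2^-1 <= fibre_scale z,
      kin (dil2 (fibre_scale z) z) (dil2 (fibre_scale z) z) =
        3 / 4 * Q (dil2 (fibre_scale z) z) &
      J (dil2 (fibre_scale z) z) <= J z + pohoz_defect z ^+ 2 / q].
Proof.
move=> qQ hq; have lE : fibre_scale z = 1 + (kin z z - 3 / 4 * Q z) / (3 / 4 * Q z).
  by rewrite /fibre_scale max_l.
have Q34 : 0 < 3 / 4 * Q z := lt_le_trans q_gt0 qQ.
have Q0 : 0 < Q z by lra.
have h1 : `|fibre_scale z - 1| <= 2^-1.
  rewrite lE addrC addKr normrM (ger0_norm (_ : 0 <= (3 / 4 * Q z)^-1)) ?invr_ge0 ?(ltW Q34)//.
  by rewrite ler_pdivrMr//; apply: le_trans hq _; lra.
have [l1 l2] : 2^-1 <= fibre_scale z /\ fibre_scale z <= 3 / 2.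
  by move: h1; rewrite ler_norml => /andP[? ?]; split; lra.
have l0 : 0 < fibre_scale z by lra.
have KE : kin z z = 3 / 4 * Q z * fibre_scale z.
  by rewrite lE; field; rewrite gt_eqF.
split => //.
  by rewrite kin_dil// quad2_dil// KE; move: (Q z) (fibre_scale z) => A1 B1; ring.
rewrite !energyE /functional kin_dil// quad2_dil//.
have -> : 2^-1 * (fibre_scale z ^+ 2 * kin z z) - 4^-1 * (fibre_scale z ^+ 3 * Q z) =
    fibre_scale z ^+ 2 * kin z z / 6.
  by rewrite KE; move: (Q z) (fibre_scale z) => A1 B1; field.
rewrite [in leLHS]lE (fibre_max _ Q0) -lE lerD2l.
have hE : pohoz_defect z = 3 / 4 * Q z * (fibre_scale z - 1).
  by rewrite lE /pohoz_defect; field; rewrite gt_eqF.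
rewrite ler_pdivlMr// hE; move: l1 l2 qQ Q0; move: (Q z) (fibre_scale z) => x l l1 l2 qQ x0.
have -> : (3 / 4 * x * (l - 1)) ^+ 2 = x * (l - 1) ^+ 2 * (9 / 16 * x) by field.
have -> : x / 8 * (l - 1) ^+ 2 * (l + 2) * q = x * (l - 1) ^+ 2 * ((l + 2) / 8 * q) by field.
apply: ler_wpM2l; first by rewrite mulr_ge0 ?sqr_ge0// ltW.
nra.
Qed.

Let sqr_arith (x X : R) : x ^+ 2 <= X -> 0 <= x -> x <= 1 + X.
Proof. by move=> ? ?; nra. Qed.

Let half_arith (x p j : R) : 0 <= x -> 2 * p <= 1 -> j - x + p * x <= j - x / 2.
Proof. by move=> ? ?; nra. Qed.

Let remainder_arith (A1 B1 x2 x3 x4 x5 : R) : `|x5| <= A1 ->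
  `|x3 - x4 - (- x2 + x5)| <= B1 -> x3 <= x4 - x2 + (A1 + B1).
Proof. by rewrite !ler_norml => /andP[? ?] /andP[? ?]; lra. Qed.

Let defect_arith (A1 B1 x2 x3 x4 : R) : 0 < q -> `|x2 - 3 / 4 * x4| <= 3 * B1 ->
  `|x3 - x4| <= 15 * A1 -> 0 <= A1 -> 0 <= B1 -> 3 * B1 + 12 * A1 <= q / 2 ->
  2 * q <= 3 / 4 * x4 ->
  `|x2 - 3 / 4 * x3| <= 3 * B1 + 12 * A1 /\ q <= 3 / 4 * x3.
Proof.
move=> q0; rewrite !ler_norml => /andP[? ?] /andP[? ?] ? ? ? ?.
by split; [apply/andP; split|]; lra.
Qed.

(** The first-order gain is [s * |V w| ^ 2]; every error (Taylor remainder,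
    normalization, dilation back) is a uniform constant times
    [s ^ 2 * |V w| ^ 2], because the displacement itself is of size [s * |V w|]. *)
Lemma descent (c2 : R) : exists2 tau : R, 0 < tau & forall w (s : R),
  masses w -> kin w w = 3 / 4 * Q w -> J w <= c2 -> 2 * q <= kin w w -> 0 <= s <= tau ->
  [/\ 2^-1 <= fibre_scale (grad_step s w),
      kin (deform s w) (deform s w) = 3 / 4 * Q (deform s w) &
      J (deform s w) <= J w - s / 2 * h1norm2 (V w) ^+ 2].
Proof.
(* [m] bounds the norm of [w], [b] that of the gradient, [k * (s * y)] the
   displacement, [e * (s * y)] the defect, and [D] collects the second order
   errors. *)
pose m : R := 1 + (6 * `|c2| + 2 * a ^+ 2).
have m1 : 1 <= m by rewrite lerDl addr_ge0// mulr_ge0// ltW.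
have m0 : 0 <= m := le_trans ler01 m1.
pose b : R := (1 + C * m ^+ 2) * m.
have b0 : 0 <= b by rewrite mulr_ge0// addr_ge0// mulr_ge0// sqr_ge0.
pose k : R := 1 + 2 * m / a ^+ 2.
have k1 : 1 <= k by rewrite lerDl divr_ge0 ?mulr_ge0// ltW.
have k0 : 0 <= k := le_trans ler01 k1.
pose e : R := (3 * m + 12 * C * m ^+ 3) * k.
have e0 : 0 <= e by rewrite mulr_ge0// addr_ge0 ?mulr_ge0// exprn_ge0.
pose D : R := 2 * m * b / a ^+ 2 + (1 + 3 * C * m ^+ 2) * k ^+ 2 + e ^+ 2 / q.
have D1 : 0 <= 2 * m * b / a ^+ 2 by apply: divr_ge0; [exact: mulr_ge0 (mulr_ge0 _ m0) b0|exact: ltW].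
have D2 : 0 <= (1 + 3 * C * m ^+ 2) * k ^+ 2.
  by apply: mulr_ge0; rewrite ?sqr_ge0// addr_ge0// !mulr_ge0// sqr_ge0.
have D3 : 0 <= e ^+ 2 / q by rewrite divr_ge0 ?sqr_ge0// ltW.
have D0 : 0 <= D by rewrite !addr_ge0.
have kb0 : 0 <= k * b by exact: mulr_ge0.
have eb0 : 0 <= 2 * e * b / q.
  by apply: divr_ge0; [exact: mulr_ge0 (mulr_ge0 _ e0) b0|exact: ltW].
have D20 : 0 <= 2 * D by exact: mulr_ge0.
have [T [T1 kT eT DT]] : exists T : R,
    [/\ 1 <= T, k * b <= T, 2 * e * b / q <= T & 2 * D <= T].
  exists (1 + k * b + 2 * e * b / q + 2 * D); move: kb0 eb0 D20.
  by move: (k * b) (2 * e * b / q) (2 * D) => x1 x2 x3 *; split; lra.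
have T0 : 0 < T := lt_le_trans ltr01 T1.
have part (t u : R) : 0 <= t <= T^-1 -> 0 <= u -> u <= T -> t * u <= 1.
  move=> /andP[t0 tT] u0 uT; apply: (@le_trans _ _ (T^-1 * T)); first exact: ler_pM.
  by rewrite mulVf ?gt_eqF.
exists T^-1; first by rewrite invr_gt0.
move=> w s mw pw Jw Kw sT; have /andP[s0 _] := sT; have [w1 w2] := mw.
have skb := part _ _ sT kb0 kT; have seb := part _ _ sT eb0 eT; have sD := part _ _ sT D20 DT.
have wm : h1norm2 w <= m.
  have nw : h1norm2 w ^+ 2 <= 6 * `|c2| + 2 * a ^+ 2.
    rewrite h1norm2_sqr /h1dot2 !h1dotE w1 w2.
    have KJ : kin w w = 6 * J w by rewrite energyE /functional pw; field.
    have : dirichlet w.1 w.1 + dirichlet w.2 w.2 <= 6 * `|c2|.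
      rewrite -/(kin w w) KJ; apply: ler_wpM2l => //; apply: le_trans Jw (ler_norm _).
    by move: (dirichlet _ _) (dirichlet _ _) (`|c2|) (a ^+ 2) => x1 x2 x3 x4 ?; lra.
  rewrite /m; move: nw (h1norm2_ge0 w); exact: sqr_arith.
have wb := egrad_le C_ge0 A_le m1 wm.
have yb : h1norm2 (V w) <= b.
  by apply: le_trans wb; apply: cgrad_le; rewrite ?w1 ?w2.
have y0 := h1norm2_ge0 (V w); set y := h1norm2 (V w) in yb y0 *.
have x0 : 0 <= s * y by exact: mulr_ge0.
have xs : s * y <= s * b by exact: ler_wpM2l.
have kx1 : k * (s * y) <= 1.
  by apply: le_trans skb; rewrite (mulrCA s k b); exact: ler_wpM2l.
have x1 : s * y <= 1 by apply: le_trans kx1; rewrite ler_peMl.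
have ex : e * (s * y) <= q / 2.
  have : e * (s * b) <= q / 2.
    rewrite -(ler_pM2r (_ : 0 < 2 / q)) ?divr_gt0//.
    have -> : q / 2 * (2 / q) = 1 by field; rewrite gt_eqF.
    by apply: le_trans seb; rewrite le_eqVlt; apply/orP; left; apply/eqP; move: (q^-1) => qq; ring.
  by apply: le_trans; exact: ler_wpM2l.
have [r zE rx] := grad_step_displacement mw m1 wm s0 x1; rewrite -/y in rx.
set d := r - s *: V w in zE.
have dk : h1norm2 d <= k * (s * y).
  apply: le_trans (h1norm2D _ _) _; rewrite h1norm2N h1norm2Z (ger0_norm s0) -/y.
  apply: (@le_trans _ _ (2 * m / a ^+ 2 * (s * y) + s * y)); last first.
    by rewrite /k; move: (2 * m / a ^+ 2) (s * y) => x2 x3; rewrite le_eqVlt; apply/orP; left; apply/eqP; ring.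
  rewrite lerD2r; apply: le_trans rx _; apply: ler_wpM2l; first by rewrite divr_ge0 ?mulr_ge0// ltW.
  by rewrite expr2 ler_piMl.
set z := grad_step s w in zE *.
have Jz : J z <= J w - s * y ^+ 2 + (2 * m * b / a ^+ 2 + (1 + 3 * C * m ^+ 2) * k ^+ 2) * (s * y) ^+ 2.
  have := energy_remainder C_ge0 A_le m1 wm dk kx1; rewrite -zE.
  have -> : dJ w d = - (s * y ^+ 2) + dJ w r.
    have -> : d = (- s) *: V w + r by rewrite /d scaleNr addrC.
    rewrite energy_diff_lin; congr (_ + _).
    by rewrite energy_diff_cgrad ?w1 ?w2// mulNr.
  have dr : `|dJ w r| <= 2 * m * b / a ^+ 2 * (s * y) ^+ 2.
    apply: le_trans (energy_diff_le C_ge0 A_le r m1 wm) _; rewrite -/b.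
    apply: le_trans (ler_wpM2l b0 rx) _; rewrite le_eqVlt; apply/orP; left; apply/eqP.
    by move: (a ^+ 2)^-1 ((s * y) ^+ 2) => A1 B1; ring.
  have -> : (1 + 3 * C * m ^+ 2) * (k * (s * y)) ^+ 2 = (1 + 3 * C * m ^+ 2) * k ^+ 2 * (s * y) ^+ 2.
    by move: (1 + _) (s * y) => A1 B1; ring.
  rewrite (mulrDl (2 * m * b / a ^+ 2)); move: dr.
  move: (2 * m * b / a ^+ 2 * (s * y) ^+ 2) ((1 + 3 * C * m ^+ 2) * k ^+ 2 * (s * y) ^+ 2) => A1 B1.
  move: (s * y ^+ 2) (J z) (J w) (dJ w r) => x2 x3 x4 x5.
  exact: remainder_arith.
have Kz : `|kin z z - kin w w| <= 3 * (m * (k * (s * y))).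
  rewrite zE mulrA.
  exact: (dot_lipschitz (@h1norm2_ge0 R) (@kinC R) (@kin_lin R) (@kin_bound R) m1 wm dk kx1).
have Qz : `|Q z - Q w| <= 15 * (C * m ^+ 3 * (k * (s * y))).
  rewrite zE; apply: le_trans (quartic_lipschitz (@h1norm2_ge0 R) (quad2C12 mu beta)
    (quad2C23 mu beta) (quad2C34 mu beta) (quad2_lin mu beta) C_ge0 A_le m1 wm dk kx1) _.
  by rewrite !mulrA.
have Cm0 : 0 <= C * m ^+ 3 * (k * (s * y)) by rewrite !mulr_ge0// exprn_ge0.
have mk0 : 0 <= m * (k * (s * y)) by rewrite !mulr_ge0.
have eE : e * (s * y) = 3 * (m * (k * (s * y))) + 12 * (C * m ^+ 3 * (k * (s * y))).
  by rewrite /e; move: (s * y) => x2; ring.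
have [hz qz] : `|pohoz_defect z| <= e * (s * y) /\ q <= 3 / 4 * Q z.
  rewrite eE in ex *; rewrite pw in Kz Kw.
  exact: (defect_arith q_gt0 Kz Qz Cm0 mk0 ex Kw).
have [l0 Kd Jd] := deform_energy qz (le_trans hz ex).
split => //; apply: le_trans Jd _.
have hq : pohoz_defect z ^+ 2 / q <= e ^+ 2 / q * (s * y) ^+ 2.
  rewrite [leRHS]mulrAC ler_pM2r ?invr_gt0// -exprMn -(real_normK (num_real (pohoz_defect z))).
  by rewrite lerXn2r ?nnegrE ?normr_ge0// mulr_ge0.
apply: le_trans (lerD Jz hq) _.
have -> : J w - s * y ^+ 2 + (2 * m * b / a ^+ 2 + (1 + 3 * C * m ^+ 2) * k ^+ 2) * (s * y) ^+ 2 +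
    e ^+ 2 / q * (s * y) ^+ 2 = J w - s * y ^+ 2 + D * s * (s * y ^+ 2).
  by rewrite /D; move: (2 * m * b / a ^+ 2) (e ^+ 2 / q) (1 + 3 * C * m ^+ 2) (J w) => A1 B1 C1 j; ring.
have : 2 * (D * s) <= 1 by rewrite mulrA mulrC.
have : 0 <= s * y ^+ 2 by rewrite mulr_ge0 ?sqr_ge0.
rewrite [s / 2 * _]mulrAC.
exact: half_arith.
Qed.

End descent.

(** * Continuity of the deformation *)

Section deformation_continuity.
Variable R : realType.
Local Notation H := (H1rad R).
Local Notation E := (H1rad R * H1rad R)%type.

Lemma H1dil_norm_le (l : R) (u : H) : h1norm (H1dil l u) <= (1 + `|l|) * h1norm u.
Proof.
have l1 : 0 <= 1 + `|l| by rewrite addr_ge0.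
rewrite -(ler_pXn2r (_ : 0 < 2)%N) ?nnegrE ?mulr_ge0 ?h1norm_ge0//.
rewrite exprMn !h1norm_sqr; apply: le_trans (h1dot_H1dil_le l u) _.
apply: ler_wpM2r; first exact: h1dot_ge0.
rewrite -[l ^+ 2](real_normK (num_real l)).
by have := normr_ge0 l; move: `|l| => x x0; nra.
Qed.

(** Joint continuity: strong continuity in [l] and local boundedness of the
    operators. *)
Lemma H1dil_cvg (T : Type) (F : set_system T) (FF : Filter F) (f : T -> R) (g : T -> H)
    (l : R) (u : H) : 0 < l -> f x @[x --> F] --> l -> g x @[x --> F] --> u ->
  H1dil (f x) (g x) @[x --> F] --> H1dil l u.
Proof.
move=> l0 fl gu.
have h1 : (1 + `|f x|) * `|g x - u| @[x --> F] --> (0 : R).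
  rewrite -[X in _ --> X](mulr0 (1 + `|l|)); apply: cvgM.
    by apply: cvgD; [exact: cvg_cst|exact: cvg_norm].
  by rewrite -(normr0 H) -(subrr u); apply: cvg_norm; apply: cvgB => //; exact: cvg_cst.
have h2 : h1norm (H1dil (f x) u - H1dil l u) @[x --> F] --> (0 : R).
  have := cvg_comp _ _ fl (H1dil_continuous u l0) => h.
  rewrite -[X in _ --> X](@sqrtr0 R); exact: (cvg_comp _ _ h (@sqrt_continuous R 0)).
have := cvgD h1 h2; rewrite addr0 => /(_ FF) h12.
apply: cvg_zero; apply: norm_cvg0.
apply: (@squeeze_cvgr _ _ _ _ (fun=> 0) _ _ _ 0 _ h12); last exact: cvg_cst.
apply: nearW => x; rewrite normr_ge0/=.
rewrite (_ : (_ - _) x = H1dil (f x) (g x - u) + (H1dil (f x) u - H1dil l u)).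
  apply: le_trans (ler_normD _ _) _; apply: lerD => //; exact: H1dil_norm_le.
have -> : H1dil (f x) (g x - u) = H1dil (f x) (g x) - H1dil (f x) u.
  have := H1dil_lin (f x) (-1) u (g x); rewrite !scaleN1r addrC => ->.
  by rewrite addrC.
by rewrite addrA subrK.
Qed.

Variables mu beta C a : R.
Hypothesis a_gt0 : 0 < a.
Hypothesis C_ge0 : 0 <= C.
Hypothesis A_le : forall w1 w2 w3 w4 : E, `|quad2 mu beta w1 w2 w3 w4| <=
  C * (h1norm2 w1 * h1norm2 w2 * (h1norm2 w3 * h1norm2 w4)).
Variable q : R.
Hypothesis q_gt0 : 0 < q.
Local Notation J := (@energy R mu mu beta).
Local Notation Q w := (quad2 mu beta w w w w).
Local Notation V := (cgrad C_ge0 A_le).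

Lemma kin_cvg (T : Type) (F : set_system T) (FF : Filter F) (f : T -> E) (w : E) :
  f x @[x --> F] --> w -> kin (f x) (f x) @[x --> F] --> kin w w.
Proof.
move=> fw; have f1 : (f x).1 @[x --> F] --> w.1 by exact: (cvg_comp _ _ fw cvg_fst).
have f2 : (f x).2 @[x --> F] --> w.2 by exact: (cvg_comp _ _ fw cvg_snd).
have kE (z : E) : kin z z = (h1dot z.1 z.1 - mass z.1 z.1) + (h1dot z.2 z.2 - mass z.2 z.2).
  by rewrite !h1dotE /kin; ring.
rewrite kE; under eq_fun do rewrite kE.
by apply: cvgD; apply: cvgB; [exact: h1dot_cvg|exact: mass_cvg|exact: h1dot_cvg|exact: mass_cvg].
Qed.

Lemma energy_cvg (T : Type) (F : set_system T) (FF : Filter F) (f : T -> E) (w : E) :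
  f x @[x --> F] --> w -> J (f x) @[x --> F] --> J w.
Proof.
move=> fw; have [dJw _] := energy_differentiable C_ge0 A_le w.
exact: (cvg_comp _ _ fw (differentiable_continuous dJw)).
Qed.

Lemma quartic_cvg (T : Type) (F : set_system T) (FF : Filter F) (f : T -> E) (w : E) :
  f x @[x --> F] --> w -> Q (f x) @[x --> F] --> Q w.
Proof.
move=> fw; have QE z : Q z = 2 * kin z z - 4 * J z.
  by rewrite energyE /functional; field.
rewrite QE; under eq_fun do rewrite QE.
by apply: cvgB; apply: cvgMr; [exact: kin_cvg|exact: energy_cvg].
Qed.

Lemma fibre_scale_cvg (T : Type) (F : set_system T) (FF : Filter F) (f : T -> E) (w : E) :
  f x @[x --> F] --> w -> fibre_scale mu beta q (f x) @[x --> F] --> fibre_scale mu beta q w.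
Proof.
move=> fw; apply: cvgD; first exact: cvg_cst.
have cQ : 3 / 4 * Q (f x) @[x --> F] --> 3 / 4 * Q w by apply: cvgMr; exact: quartic_cvg.
apply: cvgM; first by apply: cvgB => //; exact: kin_cvg.
apply: cvgV; last by apply: cvgr_max => //; exact: cvg_cst.
by rewrite gt_eqF// lt_max q_gt0 orbT.
Qed.

Lemma grad_step_cvg (T : Type) (F : set_system T) (FF : Filter F) (s : T -> R) (f : T -> E)
    (s0 : R) (w : E) : masses a w -> s x @[x --> F] --> s0 -> f x @[x --> F] --> w ->
  grad_step a C_ge0 A_le (s x) (f x) @[x --> F] --> grad_step a C_ge0 A_le s0 w.
Proof.
move=> mw ss0 fw; have [w1 w2] := mw; have [d1 d2] := masses_step_dir a_gt0 C_ge0 A_le s0 mw.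
rewrite step_dir_fst in d1; rewrite step_dir_snd in d2.
have cV : V (f x) @[x --> F] --> V w.
  apply: (cvg_comp _ _ fw); apply: cgrad_continuous; rewrite ?w1 ?w2; exact: exprn_gt0.
have f1 : (f x).1 @[x --> F] --> w.1 by exact: (cvg_comp _ _ fw cvg_fst).
have f2 : (f x).2 @[x --> F] --> w.2 by exact: (cvg_comp _ _ fw cvg_snd).
have V1 : (V (f x)).1 @[x --> F] --> (V w).1 by exact: (cvg_comp _ _ cV cvg_fst).
have V2 : (V (f x)).2 @[x --> F] --> (V w).2 by exact: (cvg_comp _ _ cV cvg_snd).
have c1 : (f x).1 - s x *: (V (f x)).1 @[x --> F] --> w.1 - s0 *: (V w).1.
  by apply: cvgB; [exact: f1|exact: cvgZ].
have c2 : (f x).2 - s x *: (V (f x)).2 @[x --> F] --> w.2 - s0 *: (V w).2.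
  by apply: cvgB; [exact: f2|exact: cvgZ].
have s1 := @sphere_proj_cvg R T F FF a _ _ d1 c1.
have s2 := @sphere_proj_cvg R T F FF a _ _ d2 c2.
exact: (cvg_pair s1 s2).
Qed.

Lemma deform_cvg (T : Type) (F : set_system T) (FF : Filter F) (s : T -> R) (f : T -> E)
    (s0 : R) (w : E) : masses a w -> 0 < fibre_scale mu beta q (grad_step a C_ge0 A_le s0 w) ->
  s x @[x --> F] --> s0 -> f x @[x --> F] --> w ->
  deform a C_ge0 A_le q (s x) (f x) @[x --> F] --> deform a C_ge0 A_le q s0 w.
Proof.
move=> mw l0 ss0 fw; have cz := grad_step_cvg FF mw ss0 fw.
have cl := fibre_scale_cvg FF cz.
pose z x := grad_step a C_ge0 A_le (s x) (f x).
pose z0 := grad_step a C_ge0 A_le s0 w.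
have z1 : (z x).1 @[x --> F] --> z0.1 by exact: (cvg_comp _ _ cz cvg_fst).
have z2 : (z x).2 @[x --> F] --> z0.2 by exact: (cvg_comp _ _ cz cvg_snd).
have h1 : H1dil (fibre_scale mu beta q (z x)) (z x).1 @[x --> F] -->
    H1dil (fibre_scale mu beta q z0) z0.1 by exact: H1dil_cvg.
have h2 : H1dil (fibre_scale mu beta q (z x)) (z x).2 @[x --> F] -->
    H1dil (fibre_scale mu beta q z0) z0.2 by exact: H1dil_cvg.
rewrite /deform /dil2; exact: (cvg_pair h1 h2).
Qed.

End deformation_continuity.

(** * The minimax argument *)

Section cutoff.
Variable R : realType.
Implicit Types j lo d hi : R.

Definition cutoff lo d hi j : R :=
  Num.max 0 (Num.min 1 (Num.min ((j - lo) / d) (hi - j))).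

Lemma cutoff_ge0 lo d hi j : 0 <= cutoff lo d hi j.
Proof. by rewrite le_max lexx. Qed.

Lemma cutoff_le1 lo d hi j : cutoff lo d hi j <= 1.
Proof. by rewrite ge_max ler01 ge_min lexx. Qed.

Lemma cutoff_eq0 lo d hi j : 0 < d -> j <= lo \/ hi <= j -> cutoff lo d hi j = 0.
Proof.
move=> d0 h; apply: max_l; rewrite !ge_min; case: h => h.
  by rewrite (_ : (j - lo) / d <= 0) ?orbT// pmulr_lle0 ?invr_gt0// subr_le0.
by rewrite (_ : hi - j <= 0) ?orbT// subr_le0.
Qed.

Lemma cutoff_eq1 lo d hi j : 0 < d -> lo + d <= j -> j <= hi - 1 -> cutoff lo d hi j = 1.
Proof.
move=> d0 h1 h2; rewrite /cutoff min_l; first by rewrite max_r.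
by rewrite le_min ler_pdivlMr// mul1r; apply/andP; split; lra.
Qed.

Lemma cutoff_cvg lo d hi (T : Type) (F : set_system T) (FF : Filter F) (f : T -> R) (l : R) :
  f x @[x --> F] --> l -> cutoff lo d hi (f x) @[x --> F] --> cutoff lo d hi l.
Proof.
move=> fl; apply: cvgr_max; first exact: cvg_cst.
apply: cvgr_min; first exact: cvg_cst.
apply: cvgr_min; last by apply: cvgB => //; exact: cvg_cst.
by apply: cvgMl; apply: cvgB => //; exact: cvg_cst.
Qed.

End cutoff.

Section near_critical_points.
Variable R : realType.
Local Notation H := (H1rad R).
Local Notation E := (H1rad R * H1rad R)%type.
Variables mu beta C a : R.
Hypothesis a_gt0 : 0 < a.
Hypothesis C_ge0 : 0 <= C.
Hypothesis A_le : forall w1 w2 w3 w4 : E, `|quad2 mu beta w1 w2 w3 w4| <=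
  C * (h1norm2 w1 * h1norm2 w2 * (h1norm2 w3 * h1norm2 w4)).
Local Notation J := (@energy R mu mu beta).
Local Notation Q w := (quad2 mu beta w w w w).
Local Notation V := (cgrad C_ge0 A_le).
Local Notation P := (@pohozaev R a a mu mu beta).

Lemma pohozaevE w : P w <-> masses a w /\ kin w w = 3 / 4 * Q w.
Proof.
rewrite /pohozaev /mass_constraint /mass_sphere /masses !mass_sqr /= kineticE quarticE.
by split => [[[? ?] ?]|[[? ?] ?]].
Qed.

Lemma energy_pohozaev w : P w -> kin w w = 6 * J w.
Proof. by move=> /pohozaevE[_ pw]; rewrite energyE /functional pw; field. Qed.

Lemma energy_sigma w : J (sigma w) = J w.
Proof. by rewrite !energyE /functional kin_sigma quad2_sigma. Qed.

Lemma deform_sigma q s w :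
  deform a C_ge0 A_le q s (sigma w) = sigma (deform a C_ge0 A_le q s w).
Proof.
have gs : grad_step a C_ge0 A_le s (sigma w) = sigma (grad_step a C_ge0 A_le s w).
  by rewrite /grad_step /step_dir cgrad_sigma.
by rewrite /deform gs /fibre_scale /pohoz_defect kin_sigma quad2_sigma.
Qed.

Lemma fibre_scale_pohozaev q w : P w -> fibre_scale mu beta q w = 1.
Proof. by move=> /pohozaevE[_ pw]; rewrite /fibre_scale /pohoz_defect pw subrr mul0r addr0. Qed.

Lemma deform0 q w : P w -> deform a C_ge0 A_le q 0 w = w.
Proof.
move=> Pw; have /pohozaevE[mw _] := Pw.
by rewrite /deform grad_step0// fibre_scale_pohozaev// /dil2 !H1dil1; case: (w).
Qed.

Lemma masses_dil2 (l : R) z : 0 < l -> masses a z -> masses a (dil2 l z).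
Proof. by move=> l0 [z1 z2]; split; rewrite mass_dil. Qed.

Variables (c b0 : R) (F : set (set E)) (B : set E).
Hypothesis stable : sigma_homotopy_stable P B F.
Hypothesis b0_ge0 : 0 <= b0.
Hypothesis b0_c : b0 < c.
Hypothesis JB : forall w, B w -> J w <= b0.
Hypothesis c_le : forall A, F A -> (c%:E <= sup_on J A)%E.

Let e0 : R := (c - b0) / 2.
Let e0_gt0 : 0 < e0. Proof. by rewrite divr_gt0// subr_gt0. Qed.
Let lo_gt0 : 0 < c - e0. Proof. by rewrite /e0; move: b0_ge0 b0_c; lra. Qed.

(** The deformed set belongs to the family, hence reaches the minimax level.  A
    point of [A] whose deformation does so has lost little energy, and by
    [descent] this loss controls its gradient. *)
Lemma near_critical_point : exists2 K : R, 0 < K & forall e A, 0 < e -> e <= e0 / 2 -> e <= 1 ->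
  F A -> (sup_on J A < (c + e)%:E)%E ->
  exists w, [/\ A w, P w, `|J w - c| <= e & h1norm2 (V w) ^+ 2 <= K * e].
Proof.
pose q := 3 * (c - e0).
have q0 : 0 < q by rewrite mulr_gt0.
have [tau tau0 D] := @descent R mu beta C a a_gt0 C_ge0 A_le q q0 (c + 2).
(* The deformation is switched off below [c - e0], which lies above the energies
   on [B], and above [c + 2]; it acts fully near the level [c]. *)
pose chi w := cutoff (c - e0) (e0 / 2) (c + 2) (J w).
pose eta (p : R * E) := deform a C_ge0 A_le q (p.1 * (tau * chi p.2)) p.2.
have chi01 w : 0 <= chi w <= 1 by rewrite cutoff_ge0 cutoff_le1.
have e20 : 0 < e0 / 2 by exact: divr_gt0.
have main t w : 0 <= t <= 1 -> P w ->
    [/\ 0 < fibre_scale mu beta q (grad_step a C_ge0 A_le (t * (tau * chi w)) w),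
        P (eta (t, w)) &
        J (eta (t, w)) <= J w - t * (tau * chi w) / 2 * h1norm2 (V w) ^+ 2].
  move=> /andP[t0 t1] Pw; have /pohozaevE[mw pw] := Pw; rewrite /eta/=.
  have [h0|[h1 h2]] : chi w = 0 \/ (c - e0 <= J w /\ J w <= c + 2).
    have [h1|h1] := leP (J w) (c - e0); first by left; apply: cutoff_eq0 => //; left.
    have [h2|h2] := leP (c + 2) (J w); first by left; apply: cutoff_eq0 => //; right.
    by right; split; exact: ltW.
    by rewrite h0 !mulr0 grad_step0// fibre_scale_pohozaev// deform0// !mul0r subr0.
  have /andP[x0 x1] := chi01 w.
  have st : 0 <= t * (tau * chi w) <= tau.
    apply/andP; split; first by rewrite !mulr_ge0// ltW.
    by apply: le_trans (ler_wpM2r _ t1) _; rewrite ?mulr_ge0 ?(ltW tau0)// mul1r ler_piMr// ltW.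
  have kw : 2 * q <= kin w w.
    by rewrite energy_pohozaev// /q; move: (c - e0) (J w) h1 => *; lra.
  have [l1 Kd Jd] := D w _ mw pw h2 kw st.
  have l0 : 0 < fibre_scale mu beta q (grad_step a C_ge0 A_le (t * (tau * chi w)) w).
    by apply: lt_le_trans l1; rewrite invr_gt0.
  split => //; apply/pohozaevE; split => //.
  by apply: masses_dil2 => //; exact: masses_grad_step.
have adm : admissible_deformation P B eta.
  split.
  - apply: continuous_in_subspaceT => -[t w]; rewrite inE => -[/= t01 Pw].
    have /pohozaevE[mw _] := Pw; rewrite in_itv/= in t01; have [l0 _ _] := main t w t01 Pw.
    have c1 : (x : R * E).1 @[x --> (t, w)] --> t by exact: cvg_fst.
    have c2 : (x : R * E).2 @[x --> (t, w)] --> w by exact: cvg_snd.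
    apply: (@deform_cvg R mu beta C a a_gt0 C_ge0 A_le q q0 _ (nbhs (t, w)) _ _ snd _ w mw l0) => //.
    apply: cvgM => //; apply: cvgMr; apply: cutoff_cvg; exact: (energy_cvg C_ge0 A_le _ c2).
  - by move=> t w; rewrite in_itv/= => t01 Pw; have [] := main t w t01 Pw.
  - by move=> t w _ _; rewrite /eta /chi /= energy_sigma deform_sigma.
  - by move=> w Pw; rewrite /eta/= mul0r deform0.
  - move=> t w _ Bw; rewrite /eta/=.
    have -> : chi w = 0.
      by apply: cutoff_eq0 => //; left; have := JB Bw; rewrite /e0; move: b0_c; lra.
    rewrite !mulr0 deform0//.
    case: stable => -[D' _ BE] _ _ _ _; by move: Bw; rewrite BE => -[].
exists (4 / tau); first exact: divr_gt0.
move=> e A e_gt0 ee0 e1 FA Ac.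
have [_ _ FK _ [Fstab _]] := stable; have [_ AP] := FK A FA.
have FA' := Fstab A eta FA adm.
pose A' := [set eta (1 : R, w) | w in A]%classic.
have : ((c - e)%:E < sup_on J A')%E.
  by apply: lt_le_trans (c_le FA'); rewrite lte_fin ltrBlDr ltrDl.
move/ereal_sup_gt => [_ [_ [w Aw <-] <-]]; rewrite lte_fin => Jeta.
have Pw := AP w Aw.
have t01 : 0 <= (1 : R) <= 1 by rewrite ler01 lexx.
have [_ _ Jd] := main 1 w t01 Pw; rewrite mul1r in Jd.
have Jw : J w < c + e.
  rewrite -lte_fin; apply: le_lt_trans Ac; apply: ereal_sup_ubound; by exists w.
have /andP[x0 x1] := chi01 w.
have Jw' : c - e < J w.
  apply: lt_le_trans Jeta _; apply: le_trans Jd _.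
  rewrite gerBl; apply: mulr_ge0; last exact: sqr_ge0.
  by apply: divr_ge0 => //; exact: mulr_ge0 (ltW tau0) x0.
have chi1 : chi w = 1.
  apply: cutoff_eq1 => //; move: Jw Jw' ee0 e1; move: (J w) => j; lra.
exists w; split => //.
  by rewrite ler_norml; move: Jw Jw'; move: (J w) => j ? ?; apply/andP; split; lra.
rewrite chi1 mulr1 in Jd; move: Jd Jeta Jw; move: (J w) (J _) (h1norm2 (V w) ^+ 2) => j j' y h1 h2 h3.
have : tau / 2 * y <= 2 * e by lra.
rewrite mulrAC ler_pdivrMr// => h4.
by rewrite mulrAC ler_pdivlMr// mulrC; lra.
Qed.

(** The points are taken in the given sets, which is how they inherit the sign
    of their elements. *)
Lemma palais_smale_sequence (A : nat -> set E) : (forall n, F (A n)) ->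
  sup_on J (A n) @[n --> \oo] --> c%:E ->
  exists w k, [/\ forall n, A (k n) (w n), forall n, P (w n),
    (J (w n))%:E @[n --> \oo] --> c%:E &
    exists2 g : nat -> E, forall n, is_constrained_gradient J (w n) (g n) &
      h1norm2 (g n) @[n --> \oo] --> (0 : R)].
Proof.
move=> FA Ac; have [K K0 near_c] := near_critical_point.
pose e1 := Num.min (e0 / 2) 1.
have e1_gt0 : 0 < e1 by rewrite lt_min divr_gt0//= ltr01.
pose e n : R := e1 / n.+1%:R.
have e_gt0 n : 0 < e n by rewrite divr_gt0.
have e_le n : e n <= e1 by rewrite ler_piMr ?(ltW e1_gt0)// invf_le1// ler1n.
have ecv : e n @[n --> \oo] --> (0 : R).
  by rewrite -[X in _ --> X](mulr0 e1); apply: cvgMr; exact: cvg_harmonic.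
have /choice[k kP] n : exists i, (sup_on J (A i) < (c + e n)%:E)%E.
  have /Ac [N _ /(_ N (leqnn N))] : nbhs c%:E [set y | (y < (c + e n)%:E)%E].
    by apply: open_nbhs_nbhs; split; [exact: open_ereal_lt_ereal|rewrite /= lte_fin ltrDl].
  by exists N.
have /choice[w wP] n : exists w, [/\ A (k n) w, P w, `|J w - c| <= e n &
    h1norm2 (V w) ^+ 2 <= K * e n].
  apply: near_c => //; apply: le_trans (e_le n) _; rewrite ge_min lexx ?orbT//.
exists w, k; split.
- by move=> n; have [] := wP n.
- by move=> n; have [] := wP n.
- apply: cvg_EFin; first exact: nearW.
  apply: cvg_zero; apply: norm_cvg0.
  apply: (@squeeze_cvgr _ _ _ _ (fun=> 0) _ _ _ 0 _ ecv); last exact: cvg_cst.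
  by apply: nearW => n; rewrite normr_ge0/=; have [] := wP n.
- exists (fun n => V (w n)).
    move=> n; have [_ /pohozaevE[[w1 w2] _] _ _] := wP n.
    by apply: cgrad_constrained_gradient; rewrite ?w1 ?w2 exprn_gt0.
  have scv : Num.sqrt (K * e n) @[n --> \oo] --> (0 : R).
    rewrite -[X in _ --> X](@sqrtr0 R).
    have Kcv : K * e n @[n --> \oo] --> (0 : R).
      by rewrite -[X in _ --> X](mulr0 K); exact: cvgMr.
    exact: (cvg_comp _ _ Kcv (@sqrt_continuous R 0)).
  apply: (@squeeze_cvgr _ _ _ _ (fun=> 0) _ _ _ 0 _ scv); last exact: cvg_cst.
  apply: nearW => n; rewrite h1norm2_ge0/=; have [_ _ _ h] := wP n.
  by rewrite -(ger0_norm (h1norm2_ge0 (V (w n)))) -sqrtr_sqr ler_wsqrtr.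
Qed.

End near_critical_points.

Theorem theorem1p5 (R : realType) (beta a1 a2 mu1 mu2 : R)
    (a12 : a1 = a2) (a1_gt0 : 0 < a1) (mu12 : mu1 = mu2) (mu1_gt0 : 0 < mu1)
    (F : set (set (H1rad R * H1rad R))) (B : set (H1rad R * H1rad R)) :
  let J := energy mu1 mu2 beta in
  let P := pohozaev a1 a2 mu1 mu2 beta in
  let c := minimax J F in
  sigma_homotopy_stable P B F ->
  (exists2 w0, P w0 & B `<=` connected_component P w0) ->
  (maxe (sup_on J B) 0 < c)%E -> (c < +oo)%E ->
  let palais_smale (w : nat -> H1rad R * H1rad R) :=
    [/\ forall n, P (w n),
        (J (w n))%:E @[n --> \oo] --> c &
        exists2 g : nat -> H1rad R * H1rad R,
          forall n, is_constrained_gradient J (w n) (g n) &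
          h1norm2 (g n) @[n --> \oo] --> (0 : R)] in
  (exists w, palais_smale w) /\
  ((exists A : nat -> set (H1rad R * H1rad R),
      [/\ forall n, F (A n),
          sup_on J (A n) @[n --> \oo] --> c &
          forall n w, A n w ->
            {ae lebesgue3 R, forall x, 0 <= w.1 x} /\
            {ae lebesgue3 R, forall x, 0 <= w.2 x}]) ->
   exists w, palais_smale w /\
     {ae lebesgue3 R, forall x,
       (h1fun (w n).1)^\- x @[n --> \oo] --> (0 : R) /\
       (h1fun (w n).2)^\- x @[n --> \oo] --> (0 : R)}).
Proof.
move=> J P c; subst a2 mu2 => stable _ b_lt c_lt ps.
have [C C0 A_le] := quad2_bound mu1 beta.
have c_gt0 : (0 < c)%E by apply: le_lt_trans b_lt; rewrite le_max lexx orbT.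
have cE : c = (fine c)%:E by rewrite fineK// gt0_fin_numE.
have b_ge0 : (0 <= maxe (sup_on J B) 0)%E by rewrite le_max lexx orbT.
have bE : maxe (sup_on J B) 0%E = (fine (maxe (sup_on J B) 0))%:E.
  by rewrite fineK// ge0_fin_numE//; exact: lt_trans b_lt c_lt.
set b0 := fine (maxe _ _) in bE.
have b0_ge0 : 0 <= b0 by rewrite -lee_fin -bE.
have b0_c : b0 < fine c by rewrite -lte_fin -bE -cE.
have JB w : B w -> J w <= b0.
  by move=> Bw; rewrite -lee_fin -bE le_max; apply/orP; left; apply: ereal_sup_ubound; exists w.
have c_le A : F A -> ((fine c)%:E <= sup_on J A)%E.
  by move=> FA; rewrite -cE; apply: ereal_inf_lbound; exists A.
have PS := palais_smale_sequence a1_gt0 C0 A_le stable b0_ge0 b0_c JB c_le.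
rewrite -cE in PS; split; last first.
  move=> [A [FA Ac Apos]]; have [w [k [wA Pw Jw g]]] := PS A FA Ac.
  exists w; split; first by split.
  have pos n : {ae lebesgue3 R, forall x, 0 <= (w n).1 x /\ 0 <= (w n).2 x}.
    have [h1 h2] := Apos _ _ (wA n).
    by apply: filter_app h2; apply: filterS h1 => x ? ?.
  apply: filterS (ae_foralln pos) => x wx.
  have neg0 (u : nat -> H1rad R) : (forall n, 0 <= u n x) ->
      (h1fun (u n))^\- x @[n --> \oo] --> (0 : R).
    move=> u0; rewrite (_ : (fun n => _) = fun=> 0); first exact: cvg_cst.
    by apply/funext => n; rewrite /funrneg max_r// oppr_le0.
  by split; apply: neg0 => n; have [] := wx n.
have /choice[A AP] n : exists A, F A /\ (sup_on J A < (fine c + n.+1%:R^-1)%:E)%E.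
  have : (c < (fine c + n.+1%:R^-1)%:E)%E by rewrite {1}cE lte_fin ltrDl invr_gt0.
  by move/ereal_inf_lt => [_ [A FA <-] h]; exists A.
have [||w [_ [_ Pw Jw g]]] := PS A; last by exists w; split.
  by move=> n; have [] := AP n.
have up : (fine c + n.+1%:R^-1)%:E @[n --> \oo] --> c.
  rewrite {2}cE; apply: cvg_EFin; first exact: nearW.
  rewrite -[X in _ --> X]addr0; apply: cvgD; [exact: cvg_cst|exact: cvg_harmonic].
apply: (@squeeze_cvge _ _ _ _ (fun=> c) _ _ _ _ _ up); last exact: cvg_cst.
apply: nearW => n; have [FA h] := AP n; rewrite (ltW h) andbT.
by apply: ereal_inf_lbound; exists (A n).
Qed.
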